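(* For every integer $i\geq 1$, the coefficient of $R_2^i$ in $\Sigma_{2i+3,4}$ is $$[R_2^i]\,\Sigma_{2i+3,4}=\tfrac{1}{540}\,i(i+1)^3(i+2)^3(i+3)(2i+3).$$
   Context: Kerov's character polynomials. For $k\ge1$, $\Sigma_k$ denotes Kerov's character polynomial: the universal polynomial with integer coefficients in indeterminates $R_2,R_3,\ldots,R_{k+1}$ such that $\widehat{\chi}_\omega(k1^{n-k})=\Sigma_k(R_2(\omega),\ldots,R_{k+1}(\omega))$ for all partitions $\omega\vdash n$ and all $n\geq k$. Here $\widehat{\chi}_\omega(k1^{n-k})=n(n-1)\cdots(n-k+1)\,\chi_\omega(k1^{n-k})/\chi_\omega(1^n)$, where $\chi_\omega(\lambda)$ is the character of the irreducible representation of the symmetric group $\mathfrak{S}_n$ indexed by $\omega$ on the class of cycle type $\lambda$. The free cumulants $R_i(\omega)$ are defined by $z^{-1}+\sum_{i\ge1}R_i(\omega)z^{i-1}=H_\omega^{\langle -1\rangle}(z)$ (compositional inverse, $H_\omega$ being expanded in powers of $1/z$ at infinity), where $H_\omega(z)=\prod_{i=1}^{m-1}(z-y_i)/\prod_{i=1}^{m}(z-x_i)$, with $x_1,\ldots,x_m$ the local minima and $y_1,\ldots,y_{m-1}$ the local maxima of the boundary curve of the Young diagram of $\omega$ (French convention) rotated counterclockwise by $45^\circ$, scaled so that these are integers (i.e. the $x_i$ are the contents, column minus row, of the addable boxes of $\omega$, and the $y_i$ the contents of the removable boxes). Equivalently, by a known theorem (Okounkov, Biane, Stanley): with $R(x)=1+\sum_{i\ge2}R_ix^i$,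 $F(x)=x/R(x)$, $G(x)=1/F^{\langle-1\rangle}(x^{-1})$, where $\langle -1\rangle$ is compositional inverse, one has $\Sigma_k=-\frac1k[x^{-1}]_\infty\prod_{j=0}^{k-1}G(x-j)$, where $[x^{-1}]_\infty$ is the coefficient of $x^{-1}$ in the expansion at $x=\infty$ (in descending powers of $x$). Graded pieces: $\Sigma_{k,2n}=[u^{k+1-2n}]\,\Sigma_k(R_2u^2,R_3u^3,\ldots,R_{k+1}u^{k+1})$; in particular $\Sigma_{k,4}$ is the sum of all terms of weight $k-3$ in $\Sigma_k$, where $R_{j_1}\cdots R_{j_i}$ has weight $j_1+\cdots+j_i$. *)

(* Defs.v *)
From HB Require Import structures.
From mathcomp Require Import all_boot all_order all_algebra all_fingroup.
From mathcomp Require Import all_solvable all_field all_character.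
From mathcomp Require Import mpoly ring.

Set Implicit Arguments.
Unset Strict Implicit.
Unset Printing Implicit Defensive.

Import Order.TTheory GRing.Theory Num.Theory.
Local Open Scope ring_scope.

(* Formal power series in one variable over rat, as coefficient sequences.
   Every operation computes its n-th coefficient on truncations of order n. *)

Definition fps := nat -> rat.

Definition fps_trunc (f : fps) (n : nat) : {poly rat} := \poly_(j < n.+1) f j.

Definition fps_of_poly (p : {poly rat}) : fps := fun n => p`_n.

Definition fps_mul (f g : fps) : fps :=
  fun n => (fps_trunc f n * fps_trunc g n)`_n.

(* meaningful when g has no constant term *)
Definition fps_comp (f g : fps) : fps :=
  fun n => (fps_trunc f n \Po fps_trunc g n)`_n.

(* 1 / f modulo X^n, for f with nonzero constant term *)
Fixpoint fps_inv_poly (f : fps) (n : nat) : {poly rat} :=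
  if n is m.+1 then
    let q := fps_inv_poly f m in
    q + (((m == 0%N)%:R - (fps_trunc f m * q)`_m) / f 0%N) *: 'X^m
  else 0.

Definition fps_inv (f : fps) : fps := fun n => (fps_inv_poly f n.+1)`_n.

(* the compositional inverse of f modulo X^n, for f with zero constant term and
   nonzero linear term *)
Fixpoint fps_rev_poly (f : fps) (n : nat) : {poly rat} :=
  if n is m.+1 then
    let q := fps_rev_poly f m in
    if m == 0%N then 0 else
    q + (((m == 1%N)%:R - (fps_trunc f m \Po q)`_m) / f 1%N) *: 'X^m
  else 0.

Definition fps_rev (f : fps) : fps := fun n => (fps_rev_poly f n.+1)`_n.

Lemma size_fps_inv_poly f n : (size (fps_inv_poly f n) <= n)%N.
Proof.
elim: n => [|n IH] /=; first by rewrite size_poly0.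
rewrite (leq_trans (size_polyD _ _)) // geq_max (leq_trans IH) //=.
by rewrite (leq_trans (size_scale_leq _ _)) // size_polyXn.
Qed.

Lemma size_fps_rev_poly f n : (size (fps_rev_poly f n) <= n)%N.
Proof.
elim: n => [|n IH] /=; first by rewrite size_poly0.
case: eqP => _; first by rewrite size_poly0.
rewrite (leq_trans (size_polyD _ _)) // geq_max (leq_trans IH) //=.
by rewrite (leq_trans (size_scale_leq _ _)) // size_polyXn.
Qed.

Lemma fps_trunc_inv f n : fps_trunc (fps_inv f) n = fps_inv_poly f n.+1.
Proof.
apply/polyP => j; rewrite coef_poly; case: ltnP => [lj|]; last first.
  move=> nj; rewrite [RHS]nth_default //.
  exact: leq_trans (size_fps_inv_poly _ _) nj.
elim: n lj => [|n IH]; first by rewrite ltnS leqn0 => /eqP->.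
rewrite ltnS leq_eqVlt => /predU1P[->//|/[dup] ltj /IH->].
rewrite [fps_inv_poly f n.+2]/= coefD coefZ coefXn.
by rewrite (ltn_eqF ltj) mulr0 addr0.
Qed.

Lemma fps_trunc_rev f n : fps_trunc (fps_rev f) n = fps_rev_poly f n.+1.
Proof.
apply/polyP => j; rewrite coef_poly; case: ltnP => [lj|]; last first.
  move=> nj; rewrite [RHS]nth_default //.
  exact: leq_trans (size_fps_rev_poly _ _) nj.
elim: n lj => [|n IH]; first by rewrite ltnS leqn0 => /eqP->.
rewrite ltnS leq_eqVlt => /predU1P[->//|/[dup] ltj /IH->].
rewrite [fps_rev_poly f n.+2]/= coefD coefZ coefXn.
by rewrite (ltn_eqF ltj) mulr0 addr0.
Qed.

Lemma fps_mulV f n : f 0%N != 0 -> fps_mul f (fps_inv f) n = (n == 0%N)%:R.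
Proof.
move=> f0; rewrite /fps_mul fps_trunc_inv [fps_inv_poly f n.+1]/= mulrDr coefD.
rewrite -scalerAr coefZ coefMXn ltnn subnn coef_poly /= divfK //.
by rewrite addrC subrK.
Qed.

Lemma fps_comp_rev f n :
  f 0%N = 0 -> f 1%N != 0 -> fps_comp f (fps_rev f) n = (n == 1%N)%:R.
Proof.
move=> f0 f1; rewrite /fps_comp fps_trunc_rev.
have rev0 m : (fps_rev_poly f m)`_0 = 0.
  case: m => [|m]; first by rewrite coef0.
  elim: m => [|m IH]; first by rewrite coef0.
  by rewrite [fps_rev_poly f m.+2]/= coefD coefZ coefXn mulr0 addr0.
case: n => [|n].
  by rewrite comp_poly0r coefC eqxx coef_poly f0.
rewrite [fps_rev_poly f n.+2]/= -/(fps_rev_poly f n.+1).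
set q := fps_rev_poly f n.+1; set T := fps_trunc f n.+1; set c := _ / _.
suff -> : (T \Po (q + c *: 'X^(n.+1)))`_n.+1 = (T \Po q)`_n.+1 + c * f 1%N.
  by rewrite divfK // addrC subrK.
have q0 : q`_0 = 0 by exact: rev0.
clearbody c.
have aux (a b d x y : {poly rat}) :
    (a + x * y) * (b + d * y) = a * b + (x * b + d * a + d * (x * y)) * y.
  by ring.
have pow j : exists2 p,
    (q + c *: 'X^(n.+1)) ^+ j = q ^+ j + p * 'X^(n.+1) & p`_0 = (j == 1%N)%:R * c.
  elim: j => [|j [p pE p0]]; first by exists 0; rewrite ?coef0 !mul0r ?addr0.
  exists (p * q + c *: q ^+ j + c *: (p * 'X^(n.+1))).
    rewrite [LHS]exprSr pE [q ^+ j.+1]exprSr -!mul_polyC; exact: aux.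
  rewrite !coefD !coefZ coefMXn coef0M q0 !mulr0 add0r addr0 /=.
  rewrite -horner_coef0 hornerE horner_coef0 q0 expr0n mulrC.
  by case: j {pE p0}.
rewrite !comp_polyE !coef_sum.
rewrite (eq_bigr (fun j : 'I_(size T) =>
  (T`_j *: q ^+ j)`_n.+1 + T`_j * ((j == 1 :> nat)%:R * c))); last first.
  move=> j _; have [p -> pc] := pow j.
  by rewrite !coefZ coefD coefMXn ltnn subnn pc mulrDr.
rewrite big_split; congr (_ + _).
have T1 : T`_1 = f 1%N by rewrite coef_poly.
have sT : (1 < size T)%N.
  by rewrite ltnNge; apply: contra f1 => /leq_sizeP/(_ 1%N (leqnn _)); rewrite T1 => ->.
rewrite (bigD1 (Ordinal sT)) //= mul1r T1 mulrC big1 ?addr0 // => j.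
by rewrite -val_eqE /= => /negPf->; rewrite mul0r mulr0.
Qed.

(* Partitions are nonincreasing lists of positive parts; the rows of the Young
   diagram are numbered from 0, so that row r has nth 0 w r boxes. *)

Definition is_partition_of (n : nat) (w : seq nat) : bool :=
  [&& sorted geq w, 0%N \notin w & sumn w == n].

(* contents (column minus row) of the addable boxes *)
Definition addable_contents (w : seq nat) : seq int :=
  [seq (nth 0%N w r)%:Z - r%:Z | r <- iota 0 (size w).+1
     & (r == 0%N) || (nth 0 w r < nth 0 w r.-1)%N].

(* contents of the removable boxes: the last box of row r is in column
   nth 0 w r - 1 *)
Definition removable_contents (w : seq nat) : seq int :=
  [seq (nth 0%N w r)%:Z - 1 - r%:Z | r <- iota 0 (size w)
     & (nth 0 w r.+1 < nth 0 w r)%N].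

(* The expansion at infinity of H_w(z) = \prod (z - y) / \prod (z - x), as a
   series in t = 1/z.  There is one more x than there are y, hence
   H_w(1/t) = t \prod (1 - y t) / \prod (1 - x t). *)
Definition H_series (w : seq nat) : fps :=
  fps_mul
    (fps_of_poly ('X * \prod_(y <- removable_contents w) (1 - y%:~R *: 'X)))
    (fps_inv (fps_of_poly (\prod_(x <- addable_contents w) (1 - x%:~R *: 'X)))).

(* K(z) = z^-1 + \sum_(i >= 1) R_i z^(i-1) is the compositional inverse of H_w,
   i.e. H_w(K(z)) = z.  With h(t) = H_w(1/t) this says K(z) = 1 / g(z), where g
   is the compositional inverse of h, so R_i is the coefficient of z^i in
   z K(z) = 1 / (g(z) / z). *)
Definition free_cumulant (w : seq nat) (i : nat) : rat :=
  fps_inv (fun n => fps_rev (H_series w) n.+1) i.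

(* The tableau of shape w filled row by row with 0, ..., n-1 has entry j in row
   reshape_index w j and column reshape_offset w j.  Its row and column
   stabilisers in 'S_n follow. *)

Section YoungSubgroups.
Variables (n : nat) (w : seq nat).

Definition row_stab : {set 'S_n} :=
  [set s : 'S_n | [forall j : 'I_n, reshape_index w (s j) == reshape_index w j]].

Definition col_stab : {set 'S_n} :=
  [set s : 'S_n | [forall j : 'I_n, reshape_offset w (s j) == reshape_offset w j]].

Lemma row_stab_group_set : group_set row_stab.
Proof.
apply/group_setP; split=> [|s t].
  by rewrite inE; apply/forallP => j; rewrite perm1.
rewrite !inE => /forallP Hs /forallP Ht; apply/forallP => j.
by rewrite permM (eqP (Ht _)).
Qed.
Canonical row_stab_group := Group row_stab_group_set.

Lemma col_stab_group_set : group_set col_stab.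
Proof.
apply/group_setP; split=> [|s t].
  by rewrite inE; apply/forallP => j; rewrite perm1.
rewrite !inE => /forallP Hs /forallP Ht; apply/forallP => j.
by rewrite permM (eqP (Ht _)).
Qed.
Canonical col_stab_group := Group col_stab_group_set.

End YoungSubgroups.

Section Sign.
Variables (n : nat) (G : {group 'S_n}).

Fact cfSign_subproof :
  is_class_fun <<G>>%g [ffun s : 'S_n => (-1) ^+ (odd_perm s) *+ (s \in G)].
Proof.
rewrite genGid; apply: intro_class_fun => [s t Gs Gt | s /negPf-> //].
by rewrite groupJr // Gs odd_permJ.
Qed.

Definition cfSign : 'CF(G) := Cfun 0%N cfSign_subproof.

End Sign.

(* 'chi_c is the irreducible character of 'S_n indexed by the partition w: the
   unique common constituent of the trivial character induced from the row
   stabiliser and of the sign character induced from the column stabiliser of a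
   tableau of shape w.  In particular w = [:: n] gives the trivial character. *)
Definition irr_indexed_by (n : nat) (w : seq nat) (c : Iirr [set: 'S_n]) : bool :=
  (c \in irr_constt ('Ind[[set: 'S_n]] (1 : 'CF(row_stab_group n w)))) &&
  (c \in irr_constt ('Ind[[set: 'S_n]] (cfSign (col_stab_group n w)))).

(* fixed points count as parts equal to 1 *)
Definition has_cycle_type (n : nat) (s : 'S_n) (mu : seq nat) : bool :=
  perm_eq [seq #|B| | B : {set 'I_n} <- enum (porbits s)] mu.

(* The variable 'X_j of {mpoly int[k]} stands for R_(j+2), 0 <= j < k. *)

(* n ^_ k is the falling factorial n (n - 1) ... (n - k + 1). *)
Definition is_kerov_polynomial (k : nat) (Sigma : {mpoly int[k]}) : Prop :=
  forall (n : nat) (w : seq nat) (c : Iirr [set: 'S_n]) (s : 'S_n),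
    (k <= n)%N -> is_partition_of n w -> irr_indexed_by w c ->
    has_cycle_type s (k :: nseq (n - k) 1%N) ->
    (n ^_ k)%:R * 'chi_c s / 'chi_c 1%g =
      ratr (mmap (intr : int -> rat) (fun j : 'I_k => free_cumulant w (j + 2))
                 Sigma).

(* Sigma(R_2 u^2, ..., R_(k+1) u^(k+1)), as a polynomial in u *)
Definition kerov_weighted (k : nat) (Sigma : {mpoly int[k]}) :
    {poly {mpoly int[k]}} :=
  mmap (fun a : int => (a%:MP_[k])%:P)
       (fun j : 'I_k => ('X_j : {mpoly int[k]})%:P * 'X^(j + 2)) Sigma.

(* Sigma_(k, d), the coefficient of u^(k + 1 - d), which is 0 when d > k + 1 *)
Definition kerov_graded (k : nat) (Sigma : {mpoly int[k]}) (d : nat) :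
    {mpoly int[k]} :=
  if (d <= k.+1)%N then (kerov_weighted Sigma)`_(k.+1 - d) else 0.

(* the monomial R_2^i *)
Definition mnm_R2 (k i : nat) : 'X_{1..k} :=
  [multinom (if j == 0 :> nat then i else 0)%N | j < k].

(* Main.v *)
Require Import Defs.
From HB Require Import structures.
From mathcomp Require Import all_boot all_order all_algebra all_fingroup.
From mathcomp Require Import all_solvable all_field all_character.
From mathcomp Require Import mpoly.
From mathcomp Require Import boolp.
From mathcomp Require Import ring zify.

Set Implicit Arguments.
Unset Strict Implicit.
Unset Printing Implicit Defensive.

Import Order.TTheory GRing.Theory Num.Theory.
Local Open Scope ring_scope.

(** The monomial R_2^i has the weight k - 3 = 2 i that the graded piece selects,
    for k = 2 i + 3. So its coefficient is that of T^i in Sigma(T, 0, ..., 0),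
    and the proof consists in making sense of the latter: no partition has such
    cumulants.

    Frobenius's formula. Let w have m rows, and let beta l = w_l + m - 1 - l. The
    alternating sum over the t in 'S_m of the permutation characters on the
    colourings of content beta - staircase o t has norm 1 (frobenius_norm): by
    Burnside's lemma its scalar square counts integer arrays with signs, and the
    count is a coefficient in the Jacobi-Trudi identity. A common constituent of
    the two induced characters that define 'chi_c is orthogonal to all the terms
    with t <> 1, because dominance puts two cells of equal colour in one column
    (shifted_content_clash). Hence the alternating sum is 'chi_c
    (indexed_characterE), and its value at a k-cycle can be computed
    (character_k_cycle).

    From partitions to complex contents. Write c l = w_l - l and G = 1 / H_w. The
    value at a k-cycle is the residue at infinity of the product of the
    G(x - j) / (- k), with -J <= j <= J and k = 2 J + 1 (frobenius_residue), and
    the free cumulants are the solution of G(R(z) / z) = 1 / z (free_cumulantE).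
    Sigma(R) and the residue are polynomials in the contents c l, so that their
    equality extends from partitions to all complex contents
    (kerov_identity_complex). Over an algebraically closed field there are
    contents with R_2 = T and no other cumulant up to k + 1 (special_contents).
    For these G + T / G = x to high order (gamma_quadratic).

    The coefficient. By homogeneity the coefficient of T^i in the residue is of
    total degree 4 in the translations j, so that the factors are only needed to
    fourth order. The substitution s = p / (1 + p)^2 makes the roots of the
    quadratic equation rational at j = 0, and Lagrange inversion
    (lagrange_coef) turns the coefficient of s^i into one of p^i. The
    fourth-order term (theta_prod_coef) is a combination of quotients
    (1 + p)^a / (1 - p)^b, with power sums of 1, ..., i + 1 as coefficients. *)

(** * Formal power series *)

Definition series (A : Type) := nat -> A.

Section SeriesZmod.
Variable A : zmodType.
Implicit Types f g : series A.

HB.instance Definition _ := gen_eqMixin (series A).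
HB.instance Definition _ := gen_choiceMixin (series A).

Definition series0 : series A := fun=> 0.
Definition series_opp f : series A := fun n => - f n.
Definition series_add f g : series A := fun n => f n + g n.

Fact series_addA : associative series_add.
Proof. by move=> f g h; apply: funext => n; rewrite /series_add addrA. Qed.
Fact series_addC : commutative series_add.
Proof. by move=> f g; apply: funext => n; rewrite /series_add addrC. Qed.
Fact series_add0 : left_id series0 series_add.
Proof. by move=> f; apply: funext => n; rewrite /series_add add0r. Qed.
Fact series_addN : left_inverse series0 series_opp series_add.
Proof. by move=> f; apply: funext => n; rewrite /series_add addNr. Qed.

HB.instance Definition _ := GRing.isZmodule.Build (series A)
  series_addA series_addC series_add0 series_addN.

Lemma seriesP f g : f =1 g -> f = g.
Proof. exact: funext. Qed.

Lemma series0E n : (0 : series A) n = 0. Proof. by []. Qed.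
Lemma seriesDE f g n : (f + g) n = f n + g n. Proof. by []. Qed.
Lemma seriesNE f n : (- f) n = - f n. Proof. by []. Qed.
Lemma series_sumE (I : Type) (r : seq I) (P : pred I) (F : I -> series A) n :
  (\sum_(i <- r | P i) F i) n = \sum_(i <- r | P i) F i n.
Proof. by elim/big_rec2: _ => // i x f _ <-. Qed.

End SeriesZmod.

Section SeriesRing.
Variable A : comNzRingType.
Implicit Types f g h : series A.

Definition series_trunc f n : {poly A} := \poly_(j < n.+1) f j.

Definition series1 : series A := fun n => (n == 0%N)%:R.
Definition series_mul f g : series A :=
  fun n => (series_trunc f n * series_trunc g n)`_n.

(* A coefficient of a product may be computed on any longer truncations. *)
Lemma series_mul_trunc f g n (p q : {poly A}) :
    (forall j, (j <= n)%N -> p`_j = f j) -> (forall j, (j <= n)%N -> q`_j = g j) ->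
  series_mul f g n = (p * q)`_n.
Proof.
move=> pf qg; rewrite /series_mul !coefM; apply: eq_bigr => j _.
by rewrite !coef_poly ltn_ord ltnS leq_subr pf ?qg ?leq_subr // -ltnS.
Qed.

Fact series_mulA : associative series_mul.
Proof.
move=> f g h; apply: funext => n.
have tr (u : series A) j : (j <= n)%N -> (series_trunc u n)`_j = u j.
  by move=> jn; rewrite coef_poly ltnS jn.
have tr2 (u v : series A) j : (j <= n)%N ->
    (series_trunc u n * series_trunc v n)`_j = series_mul u v j.
  move=> jn; apply/esym/series_mul_trunc => i ij.
    by rewrite tr // (leq_trans ij).
  by rewrite tr // (leq_trans ij).
rewrite (series_mul_trunc (tr f) (tr2 g h)) mulrA.
by rewrite -(series_mul_trunc (tr2 f g) (tr h)).
Qed.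
Fact series_mulC : commutative series_mul.
Proof. by move=> f g; apply: funext => n; rewrite /series_mul mulrC. Qed.
Fact series_mul1 : left_id series1 series_mul.
Proof.
move=> f; apply: funext => n.
rewrite (@series_mul_trunc _ _ _ 1 (series_trunc f n)) ?mul1r ?coef_poly ?leqnn //.
  by move=> j _; rewrite coef1.
by move=> j jn; rewrite coef_poly ltnS jn.
Qed.
Fact series_mulD : left_distributive series_mul (@series_add A).
Proof.
move=> f g h; apply: funext => n.
rewrite /series_mul /series_add -coefD -mulrDl; congr (polyseq (_ * _))`_n.
by apply/polyP=> j; rewrite coefD !coef_poly; case: ifP => //; rewrite addr0.
Qed.
Fact series_1neq0 : series1 != 0 :> series A.
Proof.
apply/eqP => /(congr1 (fun f : series A => f 0%N)) /eqP.
by rewrite /series1 /= series0E oner_eq0.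
Qed.

HB.instance Definition _ := GRing.Zmodule_isComNzRing.Build (series A)
  series_mulA series_mulC series_mul1 series_mulD series_1neq0.

Lemma series1E n : (1 : series A) n = (n == 0%N)%:R. Proof. by []. Qed.

Lemma seriesME f g n : (f * g) n = \sum_(j < n.+1) f j * g (n - j)%N.
Proof.
rewrite [LHS]coefM; apply: eq_bigr => j _.
by rewrite !coef_poly ltn_ord ltnS leq_subr.
Qed.

Lemma series_M0 f g : (f * g) 0%N = f 0%N * g 0%N.
Proof. by rewrite seriesME big_ord1. Qed.

Definition series_poly (p : {poly A}) : series A := fun n => p`_n.

Fact series_poly_additive : zmod_morphism series_poly.
Proof. by move=> p q; apply: funext => n; rewrite /series_poly coefB. Qed.
Fact series_poly_monoid : monoid_morphism series_poly.
Proof.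
split=> [|p q]; apply: funext => n; first by rewrite /series_poly coef1.
by rewrite /series_poly; symmetry; apply: series_mul_trunc.
Qed.
HB.instance Definition _ :=
  GRing.isZmodMorphism.Build {poly A} (series A) series_poly series_poly_additive.
HB.instance Definition _ :=
  GRing.isMonoidMorphism.Build {poly A} (series A) series_poly series_poly_monoid.

Definition seriesC : A -> series A := series_poly \o polyC.
HB.instance Definition _ := GRing.RMorphism.on seriesC.

Lemma seriesCE a n : seriesC a n = a *+ (n == 0%N).
Proof. by rewrite /seriesC /= /series_poly coefC; case: n. Qed.

Definition seriesX : series A := series_poly 'X.

Lemma seriesXnE k n : (seriesX ^+ k) n = (n == k)%:R.
Proof. by rewrite /seriesX -rmorphXn /= /series_poly coefXn. Qed.

Lemma seriesCM a f n : (seriesC a * f) n = a * f n.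
Proof.
rewrite seriesME big_ord_recl seriesCE subn0 big1 ?addr0 // => i _.
by rewrite seriesCE mul0r.
Qed.

Lemma seriesXnM k f n : (seriesX ^+ k * f) n = if (n < k)%N then 0 else f (n - k)%N.
Proof.
rewrite seriesME; case: ltnP => [nk|kn].
  rewrite big1 // => i _; rewrite seriesXnE ltn_eqF ?mul0r //.
  by rewrite (leq_trans _ nk) // ltn_ord.
rewrite (bigD1 (Ordinal (kn : (k < n.+1)%N))) //= seriesXnE eqxx mul1r big1 ?addr0 //.
by move=> i /negPf ni; rewrite seriesXnE [_ == k]ni mul0r.
Qed.

Lemma seriesXM f n : (seriesX * f) n = if n is n'.+1 then f n' else 0.
Proof. by rewrite -[seriesX]expr1 seriesXnM; case: n => // n; rewrite subn1. Qed.

Lemma seriesXE n : seriesX n = (n == 1%N)%:R.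
Proof. by rewrite -[seriesX]expr1 seriesXnE. Qed.

Lemma series_lin0 c : (1 - seriesC c * seriesX) 0%N = 1.
Proof. by rewrite seriesDE seriesNE seriesCM seriesXE mulr0 subr0. Qed.

Definition ev0 f : A := f 0%N.
Fact ev0_additive : zmod_morphism ev0. Proof. by []. Qed.
Fact ev0_monoid : monoid_morphism ev0.
Proof. by split=> // f g; rewrite /ev0 series_M0. Qed.
HB.instance Definition _ :=
  GRing.isZmodMorphism.Build (series A) A ev0 ev0_additive.
HB.instance Definition _ :=
  GRing.isMonoidMorphism.Build (series A) A ev0 ev0_monoid.

(** ** Congruence modulo a power of the variable *)

Definition agree n f g := forall j, (j < n)%N -> f j = g j.

Lemma agree_refl n f : agree n f f. Proof. by []. Qed.
Lemma agree_sym n f g : agree n f g -> agree n g f.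
Proof. by move=> fg j jn; rewrite fg. Qed.
Lemma agree_trans n f g h : agree n f g -> agree n g h -> agree n f h.
Proof. by move=> fg gh j jn; rewrite fg ?gh. Qed.
Lemma agreeD n f f' g g' : agree n f f' -> agree n g g' -> agree n (f + g) (f' + g').
Proof. by move=> ff gg j jn; rewrite !seriesDE ff ?gg. Qed.
Lemma agreeN n f f' : agree n f f' -> agree n (- f) (- f').
Proof. by move=> ff j jn; rewrite !seriesNE ff. Qed.
Lemma agreeM n f f' g g' : agree n f f' -> agree n g g' -> agree n (f * g) (f' * g').
Proof.
move=> ff gg j jn; rewrite !seriesME; apply: eq_bigr => i _.
by rewrite ff ?gg // ?(leq_ltn_trans _ jn) ?leq_subr // -ltnS.
Qed.
Lemma agreeX n k f f' : agree n f f' -> agree n (f ^+ k) (f' ^+ k).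
Proof. by move=> ff; elim: k => // k IH; rewrite !exprS; apply: agreeM. Qed.
Lemma agree_prod n (I : Type) (r : seq I) (P : pred I) (F G : I -> series A) :
    (forall i, P i -> agree n (F i) (G i)) ->
  agree n (\prod_(i <- r | P i) F i) (\prod_(i <- r | P i) G i).
Proof.
move=> FG; elim/big_ind2: _ => // f f' g g'; exact: agreeM.
Qed.

Lemma agree_to0 n f g : agree n f g -> agree n (f - g) 0.
Proof. by move=> fg j jn; rewrite seriesDE seriesNE fg // subrr. Qed.

Lemma agree_of0 n f g : agree n (f - g) 0 -> agree n f g.
Proof. by move=> fg j jn; apply/eqP; rewrite -subr_eq0; apply/eqP/(fg j jn). Qed.

Lemma agree0P n f : agree n f 0 <-> exists g, f = seriesX ^+ n * g.
Proof.
split=> [f0|[g ->] j jn]; last by rewrite seriesXnM jn.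
exists (fun j => f (n + j)%N); apply: seriesP => j; rewrite seriesXnM.
by case: ltnP => [/f0//|nj]; rewrite subnKC.
Qed.

Lemma agree0M n f g : agree n f 0 -> agree n (f * g) 0.
Proof. by move=> f0; rewrite -(mul0r g); apply: agreeM. Qed.

Lemma agree0MS n f g : agree n f 0 -> g 0%N = 0 -> agree n.+1 (f * g) 0.
Proof.
move=> /agree0P[u ->] g0.
have /agree0P[v ->] : agree 1 g 0 by case=> // _; rewrite g0.
by apply/agree0P; exists (u * v); rewrite expr1 mulrACA -exprSr.
Qed.

(** ** Fixed points of contractions *)

Definition contraction (Phi : series A -> series A) :=
  forall n f g, agree n f g -> agree n.+1 (Phi f) (Phi g).

Definition series_fix (Phi : series A -> series A) : series A :=
  fun n => iter n.+1 Phi 0 n.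

(** The coefficient of degree n no longer changes after n + 1 iterations. *)
Lemma series_fixE Phi : contraction Phi -> Phi (series_fix Phi) = series_fix Phi.
Proof.
move=> cP.
have it j n : agree n (iter n Phi 0) (iter (n + j) Phi 0).
  by elim: n => // n IH; rewrite addSn !iterS; apply: cP.
have fx n : agree n (series_fix Phi) (iter n Phi 0).
  by move=> j jn; rewrite /series_fix (it (n - j.+1)%N j.+1 j) // subnKC.
by apply: seriesP => n; rewrite (cP _ _ _ (fx n)) // -iterS.
Qed.

End SeriesRing.

Arguments seriesX {A}.
Notation "''t'" := (@seriesX _) (at level 0) : ring_scope.

Section SeriesUnit.
Variable A : comUnitRingType.
Implicit Types f g h : series A.

Let invstep f g : series A := seriesC (f 0%N)^-1 * (1 - (f - seriesC (f 0%N)) * g).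

Definition series_unit : pred (series A) := fun f => f 0%N \is a GRing.unit.
Definition series_inv f : series A :=
  if series_unit f then series_fix (invstep f) else f.

Fact series_mulV : {in series_unit, left_inverse 1 series_inv *%R}.
Proof.
move=> f uf0; have uf : f 0%N \is a GRing.unit by [].
have -> : series_inv f = series_fix (invstep f) by rewrite /series_inv /series_unit uf.
have cP : contraction (invstep f).
  move=> n g h gh; apply: agreeM => //; apply: agreeD => //; apply: agreeN.
  apply: agree_of0; rewrite -mulrBr mulrC; apply: agree0MS; first exact: agree_to0.
  by rewrite seriesDE seriesNE seriesCE subrr.
have E := series_fixE cP; set g := series_fix _ in E *.
have : seriesC (f 0%N) * g = 1 - (f - seriesC (f 0%N)) * g.
  by rewrite -[in LHS]E /invstep mulrA -rmorphM divrr // rmorph1 mul1r.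
move/(congr1 (fun x => x + (f - seriesC (f 0%N)) * g)).
by rewrite subrK -mulrDl addrC subrK mulrC.
Qed.
Fact series_unitP f g : g * f = 1 -> series_unit f.
Proof.
move=> /(congr1 (@ev0 A)); rewrite rmorphM rmorph1 => gf.
by apply/unitrPr; exists (ev0 g); rewrite mulrC.
Qed.
Fact series_inv_out : {in [predC series_unit], series_inv =1 id}.
Proof. by move=> f; rewrite inE /series_inv -topredE /= => /negPf->. Qed.

HB.instance Definition _ := GRing.ComNzRing_hasMulInverse.Build (series A)
  series_mulV series_unitP series_inv_out.

Lemma series_unitE f : (f \is a GRing.unit) = (f 0%N \is a GRing.unit).
Proof. by []. Qed.

Lemma series_unit1 f : f 0%N = 1 -> f \is a GRing.unit.
Proof. by rewrite series_unitE => ->; rewrite unitr1. Qed.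

Lemma ev0V f : f \is a GRing.unit -> f^-1 0%N = (f 0%N)^-1.
Proof. exact: (rmorphV (@ev0 A)). Qed.

Lemma agree_div n f g h : h \is a GRing.unit -> agree n (f * h) (g * h) -> agree n f g.
Proof.
by move=> uh fg; rewrite -(mulrK uh f) -(mulrK uh g); apply: agreeM.
Qed.

(** ** Hensel lifting of a simple root with constant term 1 *)

(** The difference quotient of P; on the diagonal it is the derivative, up to
    terms that vanish at 0. *)
Lemma horner_sub (P : {poly series A}) f g : exists2 S,
  P.[f] - P.[g] = (f - g) * S & f 0%N = g 0%N -> S 0%N = (P^`()).[g] 0%N.
Proof.
elim/poly_ind: P => [|P c [S SE S0]].
  by exists 0; rewrite ?horner0 ?subrr ?mulr0 // deriv0 horner0.
exists (S * f + P.[g]).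
  by rewrite !hornerMXaddC mulrDr mulrA -SE; ring.
move=> fg; rewrite derivD derivC addr0 derivM derivX !hornerE.
by rewrite !seriesDE !series_M0 fg S0 // addrC.
Qed.

Section Hensel.
Variable P : {poly series A}.
Hypothesis P1 : P.[1] 0%N = 0.
Hypothesis dP1 : (P^`()).[1] 0%N = 1.

Let ev0_horner (Q : {poly series A}) f : f 0%N = 1 -> Q.[f] 0%N = Q.[1] 0%N.
Proof.
move=> f0; have [S SE _] := horner_sub Q f 1.
have /(congr1 (@ev0 A)) := SE; rewrite !(rmorphM, rmorphB) /= /ev0 f0 subrr mul0r.
by move/eqP; rewrite subr_eq0 => /eqP.
Qed.

(** The difference quotient of P at two candidates has constant term 1, hence is
    invertible. *)
Lemma hensel_unique n f g : f 0%N = 1 -> g 0%N = 1 ->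
  agree n P.[f] P.[g] -> agree n f g.
Proof.
move=> f0 g0 /agree_to0 fg; have [S SE] := horner_sub P f g.
rewrite f0 g0 ev0_horner // dP1 => /(_ erefl) S0.
by apply: agree_of0; apply: (@agree_div _ _ _ S); rewrite ?series_unit1 // mul0r -SE.
Qed.

(** Since P has derivative 1 at 1, the map f - P(f) is a contraction once the
    constant term of its argument is reset to 1. *)
Lemma hensel_exists : exists2 f, f 0%N = 1 & P.[f] = 0.
Proof.
pose nf f : series A := f - seriesC (f 0%N) + 1.
pose Phi f : series A := nf f - P.[nf f].
have nf0 f : nf f 0%N = 1 by rewrite /nf !seriesDE seriesNE seriesCE subrr add0r.
have Phi0 f : Phi f 0%N = 1 by rewrite /Phi seriesDE seriesNE ev0_horner // P1 subr0 nf0.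
have cP : contraction Phi.
  case=> [|n] f g fg; first by case=> // _; rewrite !Phi0.
  apply: agree_of0; have [S SE] := horner_sub P (nf f) (nf g).
  rewrite !nf0 ev0_horner // dP1 => /(_ erefl) S0.
  have -> : Phi f - Phi g = (nf f - nf g) * (1 - S).
    by rewrite mulrBr -SE mulr1 /Phi; ring.
  apply: agree0MS; last by rewrite seriesDE seriesNE S0 subrr.
  apply: agree_to0; rewrite /nf (fg 0%N) //; apply: agreeD => //; exact: agreeD.
exists (series_fix Phi); first by rewrite -(series_fixE cP) Phi0.
have E := series_fixE cP; set f := series_fix Phi in E *.
have nfE : nf f = f by rewrite /nf -[f in f 0%N]E Phi0 rmorph1 subrK.
by move: E; rewrite /Phi nfE => /eqP; rewrite addrC -subr_eq0 addrK oppr_eq0 => /eqP.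
Qed.

End Hensel.

Lemma series_prod_lin0 (I : Type) (r : seq I) (P : pred I) (c : I -> A) :
  (\prod_(i <- r | P i) (1 - seriesC (c i) * 't)) 0%N = 1.
Proof.
by rewrite -[LHS]/(ev0 _) rmorph_prod big1 // => i _; rewrite /= /ev0 series_lin0.
Qed.

Lemma series_prod_lin_unit (I : Type) (r : seq I) (P : pred I) (c : I -> A) :
  \prod_(i <- r | P i) (1 - seriesC (c i) * 't) \is a GRing.unit.
Proof. by rewrite series_unit1 // series_prod_lin0. Qed.

End SeriesUnit.

(** ** Coefficientwise action of a morphism *)

Section SeriesMap.
Variables (A B : comNzRingType) (phi : {rmorphism A -> B}).

Definition series_map (f : series A) : series B := fun n => phi (f n).

Fact series_map_additive : zmod_morphism series_map.
Proof. by move=> f g; apply: seriesP => n; rewrite /series_map !seriesDE !seriesNE rmorphB. Qed.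
Fact series_map_monoid : monoid_morphism series_map.
Proof.
split=> [|f g]; apply: seriesP => n; first by rewrite /series_map !series1E rmorph_nat.
rewrite /series_map !seriesME rmorph_sum; apply: eq_bigr => j _.
by rewrite rmorphM.
Qed.
HB.instance Definition _ :=
  GRing.isZmodMorphism.Build (series A) (series B) series_map series_map_additive.
HB.instance Definition _ :=
  GRing.isMonoidMorphism.Build (series A) (series B) series_map series_map_monoid.

Lemma series_mapC a : series_map (seriesC a) = seriesC (phi a).
Proof. by apply: seriesP => n; rewrite /series_map !seriesCE rmorphMn. Qed.

Lemma series_mapX : series_map 't = 't.
Proof.
by apply: seriesP => n; rewrite /series_map /seriesX /series_poly !coefX rmorph_nat.
Qed.

End SeriesMap.

(** * Colourings of a finite set up to permutation *)

Section Colourings.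
Variables (n : nat) (X : finType).
Implicit Types (f g : {ffun 'I_n -> X}) (s : 'S_n).

Definition colour_count f (x : X) : nat := #|[set j | f j == x]|.

Definition same_content f g := [forall x, colour_count f x == colour_count g x].

Definition preserves s f := [forall j, f (s j) == f j].

Fact stab_group_set f : group_set [set s | preserves s f].
Proof.
apply/group_setP; split=> [|s t].
  by rewrite inE; apply/forallP => j; rewrite perm1.
rewrite !inE => /forallP Hs /forallP Ht; apply/forallP => j.
by rewrite permM (eqP (Ht _)).
Qed.
Definition stab f := Group (stab_group_set f).

Lemma in_stab s f : (s \in stab f) = preserves s f.
Proof. by rewrite inE. Qed.

Definition recolour f s : {ffun 'I_n -> X} := [ffun j => f (s j)].

Lemma colour_count_sum f : (\sum_x colour_count f x)%N = n.
Proof.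
under eq_bigr => x _ do rewrite /colour_count -sum1dep_card.
transitivity #|'I_n|; last exact: card_ord.
by rewrite -sum1_card (partition_big f predT).
Qed.

Lemma colour_count_recolour f s x : colour_count (recolour f s) x = colour_count f x.
Proof.
rewrite /colour_count -(card_preimset [set j | f j == x] (@perm_inj _ s)).
by apply: eq_card => j; rewrite !inE ffunE.
Qed.

Lemma same_content_recolour f g :
  reflect (exists s, g = recolour f s) (same_content g f).
Proof.
apply: (iffP forallP) => [fg|[s ->] x]; last by rewrite colour_count_recolour.
have ct (h : {ffun 'I_n -> X}) x : count_mem x [tuple h i | i < n] = colour_count h x.
  rewrite /colour_count cardsE cardE size_filter count_map.
  rewrite val_ord_tuple enumT.
  by apply: eq_count => j.
have /tuple_permP[s Es] : perm_eq [tuple g i | i < n] [tuple f i | i < n].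
  by apply/allP => x _ /=; rewrite !ct.
exists s; apply/ffunP => j; rewrite ffunE.
have := congr1 (fun u : seq X => nth (g j) u j) Es.
by rewrite -!(tnth_nth _ _ j) !tnth_mktuple.
Qed.

Lemma content_exists (mu : X -> nat) : (\sum_x mu x)%N = n ->
  exists f, forall x, colour_count f x = mu x.
Proof.
move=> mun; pose s := flatten [seq nseq (mu x) x | x <- enum X].
have ss : size s = n.
  rewrite size_flatten /shape -map_comp sumnE big_map big_enum /=.
  by rewrite -[RHS]mun; apply: eq_bigr => x _; rewrite size_nseq.
have /eqP ss' := ss; exists [ffun j => tnth (Tuple ss') j] => x.
have -> : mu x = count_mem x s.
  rewrite count_flatten -map_comp sumnE big_map big_enum /= (bigD1 x) //=.
  rewrite count_nseq /= eqxx mul1n big1 ?addn0 // => y /negPf yx.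
  by rewrite count_nseq /= yx.
transitivity (count_mem x (map (tnth (Tuple ss')) (enum 'I_n))); last first.
  by rewrite map_tnth_enum.
rewrite /colour_count cardsE cardE size_filter count_map enumT; apply: eq_count => j.
by rewrite /= -topredE /= ffunE.
Qed.

(** The permutations carrying a fixed colouring to another one of the same
    content form a coset of the stabiliser of the latter. *)
Lemma sum_card_stab f0 :
  (\sum_(f | same_content f f0) #|stab f|)%N = n`!.
Proof.
have -> : n`! = #|[set: 'S_n]| by rewrite cardsT card_Sn.
rewrite -sum1_card (partition_big (recolour f0) (same_content^~ f0)) /=; last first.
  by move=> s _; apply/same_content_recolour; exists s.
apply: eq_bigr => f /same_content_recolour[g fE].
rewrite -(card_imset _ (mulIg g)) -sum1_card; apply: eq_bigl => s; rewrite in_setT /=.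
symmetry; apply/eqP/imsetP => [sf|[t]]; last first.
  rewrite in_stab => /forallP tf ->; apply/ffunP=> j; rewrite ffunE permM.
  by move/eqP: (tf j); rewrite fE !ffunE.
exists (s * g^-1)%g; last by rewrite mulgKV.
rewrite in_stab; apply/forallP => j; rewrite fE !ffunE permM permKV.
by move/ffunP: sf => /(_ j); rewrite fE !ffunE => ->.
Qed.

(** Burnside's lemma: the orbits of colourings are the multisets of colours. *)
Lemma burnside_content (R : comNzRingType) b (w : {ffun X -> 'I_b.+1} -> R) :
    (n <= b)%N ->
  \sum_(s : 'S_n) \sum_(f | preserves s f) w [ffun x => inord (colour_count f x)] =
    n`!%:R * \sum_(mu : {ffun X -> 'I_b.+1} | (\sum_x mu x)%N == n) w mu.
Proof.
move=> nb.
have cb f x : (colour_count f x <= b)%N.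
  by apply: leq_trans nb; rewrite (leq_trans (max_card _)) ?card_ord.
rewrite (exchange_big_dep predT) //=.
pose ct f : {ffun X -> 'I_b.+1} := [ffun x => inord (colour_count f x)].
have ctE f x : ct f x = colour_count f x :> nat by rewrite ffunE inordK // ltnS.
rewrite (partition_big ct (fun mu => (\sum_x mu x)%N == n)) /=; last first.
  by move=> f _; under eq_bigr => x _ do rewrite ctE; rewrite colour_count_sum.
rewrite mulr_sumr; apply: eq_bigr => mu /eqP mun.
have [f0 f0E] := content_exists mun.
rewrite -(sum_card_stab f0) natr_sum mulr_suml; apply: congr_big => // f.
  apply/eqP/forallP => [cf x|fE]; first by rewrite f0E -cf ctE.
  by apply/ffunP => x; apply: val_inj; rewrite /= ctE (eqP (fE x)) f0E.
move=> /eqP ctf; rewrite -/(ct f) ctf sumr_const mulr_natl; congr (_ *+ _).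
by apply: eq_card => s; rewrite in_stab.
Qed.

End Colourings.

(** * The Jacobi-Trudi identity *)

Section Geometric.
Variable A : comNzRingType.

(** The series 1 / (1 - a t). *)
Definition geo (a : A) : series A := fun n => a ^+ n.

Lemma geoK a : (1 - seriesC a * 't) * geo a = 1.
Proof.
apply: seriesP => n; rewrite mulrBl mul1r seriesDE seriesNE -mulrA seriesCM seriesXM.
by case: n => [|n]; rewrite ?mulr0 ?subr0 // /geo exprS subrr.
Qed.

End Geometric.

Section JacobiTrudi.
Variables (R : comNzRingType) (m b : nat).
Local Notation P := {mpoly R[m]}.

Definition staircase (i : 'I_m) : nat := m.-1 - i.

Lemma staircase_rev i : staircase i = rev_ord i.
Proof. by rewrite /staircase /= -subn1 subnAC subn1 -subnS. Qed.

Definition mpowers (nu : {ffun 'I_m -> 'I_b.+1}) : 'X_{1..m} := [multinom nu i : nat | i < m].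

Definition complete_series : series P := \prod_(i < m) geo 'X_i.
(* The complete symmetric polynomial of degree a - d, which is 0 for a < d. *)
Definition complete a d : P := if (d <= a)%N then complete_series (a - d)%N else 0.

Lemma complete_seriesE a : (a <= b)%N ->
  complete_series a = \sum_(nu : {ffun 'I_m -> 'I_b.+1} | (\sum_i nu i)%N == a) 'X_[mpowers nu].
Proof.
move=> ab; pose F i (c : 'I_b.+1) : {poly P} := ('X_i ^+ c) *: 'X^c.
have geoF i : agree b.+1 (geo ('X_i : P)) (series_poly (\sum_c F i c)).
  move=> j jb; rewrite /series_poly coef_sum (bigD1 (Ordinal jb)) //= coefZ coefXn eqxx mulr1.
  by rewrite big1 ?addr0 // => c /negPf cj; rewrite coefZ coefXn eq_sym [_ == _]cj mulr0.
rewrite /complete_series (@agree_prod _ b.+1 _ _ _ _ _ (fun i _ => geoF i)) //.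
rewrite -rmorph_prod bigA_distr_bigA /= /series_poly coef_sum.
rewrite [RHS]big_mkcond; apply: eq_bigr => nu _.
have -> : \prod_i F i (nu i) = 'X_[mpowers nu] *: 'X^(\sum_i nu i).
  rewrite scaler_prod -expr_sum; congr (_ *: _).
  by rewrite mpolyXE_id; apply: eq_bigr => i _; rewrite mnmE.
rewrite coefZ coefXn eq_sym; case: eqP => _; by rewrite ?mulr1 ?mulr0.
Qed.

Let omit (l j : 'I_m) : P := (\prod_(i | i != l) (1 - ('X_i : P) *: 'X))`_(staircase j).

(** Multiplying \prod 1 / (1 - x_i t) by all the factors 1 - x_i t but that of l
    leaves 1 / (1 - x_l t). *)
Lemma complete_omit a l : \sum_(j < m) complete a (staircase j) * omit l j = 'X_l ^+ a.
Proof.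
pose q : {poly P} := \prod_(i | i != l) (1 - ('X_i : P) *: 'X).
have sq : (size q <= m)%N.
  rewrite (leq_trans (size_poly_prod_leq _ _)) //.
  rewrite leq_subLR; apply: (@leq_trans (#|[pred i | i != l]| * 2).+1).
    rewrite ltnS -sum_nat_const leq_sum // => i _.
    rewrite (leq_trans (size_polyD _ _)) // size_polyN size_poly1 geq_max /=.
    by rewrite (leq_trans (size_scale_leq _ _)) // size_polyX.
  rewrite muln2 -addnn -addnS leq_add2l.
  by have := cardC1 l; rewrite card_ord => ->; rewrite prednK // (leq_ltn_trans _ (ltn_ord l)).
have Eq : series_poly q * complete_series = geo 'X_l.
  rewrite /complete_series (bigD1 l) //= mulrCA -[RHS]mulr1; congr (_ * _).
  rewrite rmorph_prod -big_split big1 //= => i _; rewrite -(geoK 'X_i); congr (_ * _).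
  rewrite rmorphB rmorph1 -mul_polyC rmorphM; by [].
rewrite -[RHS]/(geo 'X_l a) -Eq seriesME.
rewrite (reindex_inj rev_ord_inj) /=.
transitivity (\sum_(j < m) if (j <= a)%N then q`_j * complete_series (a - j)%N else 0).
  apply: eq_bigr => j _; rewrite /complete /omit -/q !staircase_rev rev_ordK.
  by case: ifP => _; rewrite ?mul0r // mulrC.
pose G j := if (j <= a)%N then q`_j * complete_series (a - j)%N else 0.
pose K := maxn m a.+1.
transitivity (\sum_(j < K) G j).
  rewrite -!(big_mkord predT G) [RHS](@big_cat_nat _ _ _ m) ?leq_maxl //=.
  rewrite [X in _ + X]big_nat [X in _ + X]big1 ?addr0 // => j /andP[mj _].
  by rewrite /G nth_default ?(leq_trans sq) //; case: ifP => _ //; rewrite mul0r.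
rewrite -(big_mkord predT G) (@big_cat_nat _ _ _ a.+1) ?leq_maxr //= big_mkord.
rewrite [X in _ + X]big_nat [X in _ + X]big1 ?addr0; last first.
  by move=> j /andP[aj _]; rewrite /G leqNgt aj.
by apply: eq_bigr => j _; rewrite /G -ltnS ltn_ord.
Qed.

(** By complete_omit, a fixed matrix turns each of the matrices of complete
    symmetric polynomials into a matrix of powers. For the exponents of the
    staircase the former matrix is unitriangular, which identifies the
    determinant of the fixed matrix with the Vandermonde determinant. *)
Lemma jacobi_trudi (lam : 'I_m -> nat) :
  \det (\matrix_(i, j) ('X_i : P) ^+ staircase j) *
    \det (\matrix_(i, j) complete (lam i) (staircase j)) =
  \det (\matrix_(i, j) ('X_i : P) ^+ lam j).
Proof.
have key f : \det (\matrix_(i, j) complete (f i) (staircase j)) * \det (\matrix_(j, l) omit l j) =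
    \det (\matrix_(i, j) ('X_i : P) ^+ f j).
  rewrite -det_mulmx -det_tr; congr (\det _); apply/matrixP => i j; rewrite !mxE.
  by rewrite -(complete_omit (f j) i); apply: eq_bigr => l _; rewrite !mxE.
suff D1 : \det (\matrix_(i, j) complete (staircase i) (staircase j)) = 1.
  by rewrite -(key lam) -(key staircase) D1 mul1r mulrC.
rewrite -det_tr det_trig.
  rewrite big1 // => i _; rewrite !mxE /complete leqnn subnn.
  by rewrite /complete_series -/(ev0 _) rmorph_prod big1.
apply/is_trig_mxP => i j ij; rewrite !mxE /complete ifN // !staircase_rev /=.
have := ltn_ord j; lia.
Qed.

(** The sign-weighted count of the square arrays with prescribed margins is a
    coefficient of the alternant, once the margins run over all the shifts of
    an exponent by permuted staircases. *)
Lemma signed_arrays (lam : 'I_m -> nat) : injective lam -> (forall i, lam i <= b)%N ->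
  \sum_(t : 'S_m) \sum_(s : 'S_m) (-1) ^+ t * (-1) ^+ s *
    #|[set F : {ffun 'I_m -> {ffun 'I_m -> 'I_b.+1}} |
       [forall l, staircase (s l) + \sum_i F l i == lam l]%N &&
       [forall i, staircase (t i) + \sum_l F l i == lam i]%N]|%:R = 1 :> R.
Proof.
move=> lamI lamb.
pose L : 'X_{1..m} := [multinom lam i | i < m].
have alt (f : 'I_m -> nat) : \det (\matrix_(i, j) ('X_i : P) ^+ f j) =
    \sum_(t : 'S_m) (-1) ^+ t * 'X_[[multinom f (t i) | i < m]].
  apply: eq_bigr => t _; congr (_ * _); rewrite mpolyXE_id.
  by apply: eq_bigr => i _; rewrite mxE mnmE.
have sgn (t : 'S_m) (p : P) k : ((-1) ^+ t * p)@_k = (-1) ^+ t * p@_k.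
  by case: (odd_perm t); rewrite ?mulN1r ?mul1r ?mcoeffN ?expr1 ?expr0 ?mulN1r ?mul1r.
have := congr1 (mcoeff L) (jacobi_trudi lam).
rewrite (alt lam) raddf_sum /= (bigD1 1%g) //= [X in _ + X]big1; last first.
  move=> t t1; rewrite sgn mcoeffX; case: eqP => [/mnmP E|_]; last by rewrite mulr0.
  case/eqP: t1; apply/permP => i; rewrite perm1; apply: lamI.
  by have := E i; rewrite !mnmE.
rewrite addr0 odd_perm1 mul1r mcoeffX.
have -> : [multinom lam ((1%g : 'S_m) i) | i < m] == L.
  by apply/eqP/mnmP => i; rewrite !mnmE perm1.
rewrite mulr1n => E1; apply: (etrans _ E1); symmetry; rewrite alt mulr_suml raddf_sum; apply: eq_bigr => t _ /=.
rewrite -mulrA sgn /determinant mulr_sumr raddf_sum mulr_sumr; apply: eq_bigr => s _ /=.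
rewrite mulrCA sgn mulrA; congr (_ * _).
have -> : \prod_i (\matrix_(i, j) complete (lam i) (staircase j)) i (s i) =
   \sum_(F : {ffun 'I_m -> {ffun 'I_m -> 'I_b.+1}} |
      [forall l, staircase (s l) + \sum_i F l i == lam l]%N)
     'X_[[multinom \sum_l F l i | i < m]%N].
  transitivity (\prod_i \sum_(nu : {ffun 'I_m -> 'I_b.+1} |
       (staircase (s i) + \sum_c nu c == lam i)%N) ('X_[mpowers nu] : P)).
    apply: eq_bigr => i _; rewrite mxE /complete; case: leqP => [le|gt].
      rewrite complete_seriesE ?(leq_trans (leq_subr _ _)) //.
      by apply: eq_bigl => nu; rewrite -{2}(subnKC le) eqn_add2l.
    rewrite big_pred0 // => nu; apply/eqP => E.
    by move: gt; rewrite -E ltnNge leq_addr.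
  rewrite bigA_distr_big_dep; apply: congr_big => // F.
  move=> _; rewrite [RHS]mpolyXE_id; under eq_bigr => l _ do rewrite mpolyXE_id.
  rewrite exchange_big; apply: eq_bigr => i _ /=; rewrite mnmE expr_sum.
  by apply: eq_bigr => l _; rewrite mnmE.
rewrite mulr_sumr raddf_sum /= -sum1_card natr_sum.
under eq_bigr => F _ do rewrite -mpolyXD mcoeffX mulrb.
rewrite -big_mkcondr /=; apply: congr_big => // F.
rewrite inE; congr (_ && _); apply/eqP/forallP => [E i|E].
  by have /mnmP/(_ i) := E; rewrite mnmDE !mnmE => ->.
by apply/mnmP => i; rewrite mnmDE !mnmE; apply/eqP.
Qed.

End JacobiTrudi.

(** * Alternating sums of permutation characters *)

Section FrobeniusCount.
Variables (n m : nat) (lam : 'I_m -> nat) (R : comNzRingType).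
Implicit Types (f g : {ffun 'I_n -> 'I_m}) (s : 'S_n) (t u : 'S_m).

(* The colour l is used lam l - staircase (t l) times. *)
Definition shifted_content t f :=
  [forall l, staircase (t l) + colour_count f l == lam l]%N.

Definition fixed_colourings t s : nat :=
  #|[set f | preserves s f && shifted_content t f]|.

(** The determinantal expression of an irreducible character through the
    permutation characters on colourings of given content. *)
Definition frobenius s : R := \sum_(t : 'S_m) (-1) ^+ t * (fixed_colourings t s)%:R.

Hypothesis lamI : injective lam.
Hypothesis lam_sum : (\sum_i lam i = n + \sum_(i < m) staircase i)%N.

Let b := (n + \sum_i lam i)%N.

Let margins t u (mu : {ffun 'I_m * 'I_m -> 'I_b.+1}) : bool :=
  [forall l, staircase (u l) + \sum_i mu (l, i) == lam l]%N &&
  [forall i, staircase (t i) + \sum_l mu (l, i) == lam i]%N.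

Let pair_count (f g : {ffun 'I_n -> 'I_m}) l i :
  colour_count [ffun j => (f j, g j)] (l, i) = #|[set j | (f j == l) && (g j == i)]|.
Proof. by apply: eq_card => j; rewrite !inE ffunE xpair_eqE. Qed.

Let fixed_pairs t u :
  \sum_s ((fixed_colourings u s)%:R * (fixed_colourings t s)%:R : R) =
  n`!%:R * (\sum_(mu : {ffun 'I_m * 'I_m -> 'I_b.+1} | (\sum_x mu x)%N == n) (margins t u mu)%:R).
Proof.
rewrite -burnside_content ?leq_addr //; apply: eq_bigr => s _.
rewrite /fixed_colourings -!sum1_card !natr_sum big_distrlr /=.
rewrite pair_big_dep /= [RHS]big_mkcond [LHS]big_mkcond /=.
rewrite [RHS](reindex (fun p : {ffun 'I_n -> 'I_m} * {ffun 'I_n -> 'I_m} =>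
   [ffun j => (p.1 j, p.2 j)])) /=; last first.
  exists (fun h : {ffun 'I_n -> 'I_m * 'I_m} => ([ffun j => (h j).1], [ffun j => (h j).2])).
    by case=> f g _; congr (_, _); apply/ffunP => j; rewrite !ffunE.
  by move=> h _; apply/ffunP => j; rewrite !ffunE -surjective_pairing.
apply: eq_bigr => -[f g] _ /=; rewrite !inE mulr1.
have -> : preserves s [ffun j => (f j, g j)] = preserves s f && preserves s g.
  apply/forallP/andP => [H|[/forallP Hf /forallP Hg] j].
    by split; apply/forallP => j; have := H j; rewrite !ffunE xpair_eqE => /andP[].
  by rewrite !ffunE (eqP (Hf j)) (eqP (Hg j)).
case: (preserves s f) => //=; case: (preserves s g); rewrite ?andbF //=.
set mu := finfun _.
have muE x : mu x = colour_count [ffun j => (f j, g j)] x :> nat.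
  rewrite ffunE inordK // ltnS (leq_trans _ (leq_addr _ _)) //.
  by rewrite (leq_trans (max_card _)) ?card_ord.
have rows l : (\sum_i mu (l, i) = colour_count f l)%N.
  under eq_bigr => i _ do rewrite muE pair_count -sum1dep_card big_mkcondr.
  rewrite exchange_big /= /colour_count -sum1dep_card; apply: eq_bigr => j _.
  by rewrite -big_mkcond (big_pred1 (g j)) // => i; rewrite eq_sym.
have cols i : (\sum_l mu (l, i) = colour_count g i)%N.
  under eq_bigr => l _.
    rewrite muE pair_count -sum1dep_card (eq_bigl (fun j => (g j == i) && (f j == l))).
      rewrite big_mkcondr; over.
    by move=> j; rewrite andbC.
  rewrite exchange_big /= /colour_count -sum1dep_card; apply: eq_bigr => j _.
  by rewrite -big_mkcond (big_pred1 (f j)) // => l; rewrite eq_sym.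
have -> : margins t u mu = shifted_content u f && shifted_content t g.
  by congr (_ && _); apply: eq_forallb => l; rewrite ?rows ?cols.
by case: (_ && _).
Qed.

(** By Burnside's lemma the scalar square is the number of orbits of pairs of
    colourings, that is, the signed count of arrays with prescribed margins. *)
Lemma frobenius_norm : \sum_s frobenius s ^+ 2 = n`!%:R.
Proof.
have lamb i : (lam i <= b)%N.
  by rewrite /b (bigD1 i) //= addnCA leq_addr.
have := signed_arrays R lamI lamb; set S := (X in X = 1) => S1.
rewrite -[RHS]mulr1 -[X in _ = _ * X]S1 mulr_sumr.
transitivity (\sum_s \sum_(t : 'S_m) \sum_(u : 'S_m) (-1) ^+ t * (-1) ^+ u *
     ((fixed_colourings u s)%:R * (fixed_colourings t s)%:R : R)).
  apply: eq_bigr => s _; rewrite expr2 /frobenius big_distrlr /=.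
  by apply: eq_bigr => t _; apply: eq_bigr => u _; rewrite mulrACA [X in _ * X]mulrC.
rewrite exchange_big; apply: eq_bigr => t _ /=.
rewrite exchange_big mulr_sumr; apply: eq_bigr => u _ /=.
rewrite -mulr_sumr fixed_pairs mulrCA; congr (_ * (_ * _)).
rewrite -sum1_card natr_sum.
rewrite [LHS](reindex (fun F : {ffun 'I_m -> {ffun 'I_m -> 'I_b.+1}} =>
   [ffun x => F x.1 x.2])) /=; last first.
  exists (fun h : {ffun 'I_m * 'I_m -> 'I_b.+1} => [ffun i => [ffun j => h (i, j)]]).
    by move=> F _; apply/ffunP => i; apply/ffunP => j; rewrite !ffunE.
  by move=> h _; apply/ffunP => -[i j]; rewrite !ffunE.
rewrite [LHS]big_mkcond [RHS]big_mkcond; apply: eq_bigr => F _ /=; rewrite inE.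
have EF l i : [ffun x => F x.1 x.2] (l, i) = F l i by rewrite ffunE.
have -> : margins t u [ffun x => F x.1 x.2] =
    [forall l, staircase (u l) + \sum_i F l i == lam l]%N &&
    [forall i, staircase (t i) + \sum_l F l i == lam i]%N.
  by congr (_ && _); apply: eq_forallb => l; congr (_ + _ == _)%N;
     apply: eq_bigr => i _; rewrite EF.
case: andP => [[/forallP rows _]|_]; last by rewrite if_same.
rewrite ifT //; apply/eqP.
apply: (@addnI (\sum_(i < m) staircase i)); rewrite [RHS]addnC -lam_sum.
rewrite [X in (_ + X)%N](eq_bigr (fun p => F p.1 p.2 : nat)); last by move=> p _; rewrite ffunE.
rewrite -(pair_bigA _ (fun l i => F l i : nat)) /=.
rewrite [X in (X + _)%N](reindex_inj (@perm_inj _ u)) /= -big_split /=; apply: eq_bigr => l _.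
by rewrite -(eqP (rows l)).
Qed.

End FrobeniusCount.

(** * The irreducible character indexed by a partition *)

Section SignSums.
Local Open Scope group_scope.
Local Open Scope ring_scope.
Variable n : nat.
Implicit Types (K : {group 'S_n}).

Lemma sign_sum_odd K (z : 'S_n) : z \in K -> odd_perm z ->
  \sum_(y in K) (-1) ^+ (odd_perm y) = 0 :> algC.
Proof.
move=> Kz oz; set S := \sum_(y in K) _.
suff: S = - S by move/eqP; rewrite -addr_eq0 -mulr2n mulrn_eq0 => /eqP.
rewrite {1}/S (reindex_inj (mulIg z)) -sumrN.
apply: eq_big => [y|y _]; first by rewrite groupMr.
by rewrite odd_permM oz addbT; case: odd_perm; rewrite ?expr0 ?expr1 ?opprK.
Qed.

(** The sum is either 0 or the order of the group. *)
Lemma sign_sum_ge0 K : 0 <= \sum_(y in K) (-1) ^+ (odd_perm y) :> algC.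
Proof.
case: (pickP [pred z in K | odd_perm z]) => [z /andP[Kz oz]|even].
  by rewrite (sign_sum_odd Kz oz).
apply: sumr_ge0 => y Ky; have := even y; rewrite /= Ky /= => ->.
by rewrite expr0 ler01.
Qed.

Lemma cfSignE K s : cfSign K s = (-1) ^+ (odd_perm s) *+ (s \in K).
Proof. by rewrite cfunE. Qed.

Fact sign_repr_subproof K :
  mx_repr K (fun s : 'S_n => ((-1) ^+ (odd_perm s))%:M : 'M[algC]_1).
Proof.
split=> [|s t _ _]; first by rewrite odd_perm1.
by rewrite odd_permM signr_addb scalar_mxM.
Qed.

Lemma cfSign_char K : cfSign K \is a character.
Proof.
have -> : cfSign K = cfRepr (MxRepresentation (sign_repr_subproof K)).
  apply/cfunP => s; rewrite cfSignE cfunE /= mxtrace_scalar.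
  by case: (s \in K).
exact: cfRepr_char.
Qed.

(** Frobenius reciprocity turns the scalar product of the two induced
    characters into signed sums over the intersections of H with the
    conjugates of K. *)
Lemma cfdot_Ind_sign (H K : {group 'S_n}) :
  '['Ind[[set: 'S_n]] (1 : 'CF(H)), 'Ind[[set: 'S_n]] (cfSign K)] =
  #|H|%:R^-1 * #|K|%:R^-1 *
    \sum_(g : 'S_n) \sum_(y in H :&: K :^ g^-1) (-1) ^+ (odd_perm y).
Proof.
rewrite -cfdot_Res_r cfdotE -mulrA; congr (_ * _).
transitivity (\sum_(y in H) #|K|%:R^-1 *
   (\sum_(g : 'S_n) (-1) ^+ (odd_perm y) *+ (y ^ g \in K)%g) : algC).
  apply: eq_bigr => y Hy; rewrite cfun1E Hy mul1r cfResE ?subsetT // cfIndE ?subsetT //.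
  rewrite rmorphM fmorphV rmorph_nat rmorph_sum; congr (_ * _).
  apply: eq_big => [g|g _]; first by rewrite inE.
  by rewrite cfSignE odd_permJ rmorphMn rmorph_sign.
rewrite -mulr_sumr exchange_big; congr (_ * _); apply: eq_bigr => g _ /=.
rewrite [RHS]big_mkcond [LHS]big_mkcond; apply: eq_bigr => y _.
rewrite in_setI mem_conjg invgK; case: (y \in H) => //=.
by rewrite mulrb.
Qed.

(** When every conjugate of a column group shares a transposition with the
    stabiliser of a colouring, no irreducible character has invariants under the
    latter and sign-invariants under the former. *)
Lemma no_common_constituent (X : finType) (f : {ffun 'I_n -> X}) K (c : Iirr [set: 'S_n]) :
    (forall g : 'S_n, exists x y, [/\ x != y, f x = f y & tperm (g x) (g y) \in K]) ->
    c \in irr_constt ('Ind[[set: 'S_n]] (cfSign K)) ->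
  \sum_(s in stab f) 'chi_c s = 0.
Proof.
move=> tr cK.
have E : '['Res[stab f] 'chi_c, 1] = #|stab f|%:R^-1 * \sum_(s in stab f) 'chi_c s.
  rewrite cfdotE; congr (_ * _); apply: eq_bigr => s Ys.
  by rewrite cfResE ?subsetT // cfun1E Ys rmorph1 mulr1.
apply/eqP; apply: contraT => S0.
have : '['Res[stab f] 'chi_c, 1] != 0.
  by rewrite E mulf_neq0 // invr_eq0 pnatr_eq0 -lt0n cardG_gt0.
rewrite cfdot_Res_l cfdotC fmorph_eq0 -irr_consttE => cY.
have := constt_ortho_char (cfInd_char _ (cfun1_char _)) (cfInd_char _ (cfSign_char K)) cY cK.
rewrite cfnorm_irr cfdot_Ind_sign big1 ?mulr0.
  by move=> /(_ erefl) /eqP; rewrite oner_eq0.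
move=> g _; have [x [y [xy fxy txy]]] := tr g.
have z : tperm x y \in (stab f :&: K :^ g^-1)%G.
  rewrite inE mem_conjg invgK tpermJ txy andbT in_stab; apply/forallP => j.
  by case: tpermP => [->|->|_ _]; rewrite ?fxy.
by apply: (sign_sum_odd z); rewrite odd_tperm.
Qed.

End SignSums.

(** * Rows and columns of a Young diagram *)

Section Diagram.
Variables (n : nat) (w : seq nat).
Hypothesis wn : is_partition_of n w.

Local Notation m := (size w).
Local Notation part := (nth 0%N w).

Lemma partition_sum : sumn w = n. Proof. by case/and3P: wn => _ _ /eqP. Qed.

Lemma partition_mono i j : (i <= j)%N -> (part j <= part i)%N.
Proof.
move=> ij; case: (ltnP j m) => [jm|mj]; last by rewrite (nth_default _ mj).
case/and3P: wn => sw _ _.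
have := sorted_leq_nth (rev_trans leq_trans) leqnn 0%N sw.
by move=> /(_ i j); rewrite !inE (leq_ltn_trans ij jm) jm => /(_ isT isT ij).
Qed.

Lemma part_le i : (part i <= n)%N.
Proof.
case: (ltnP i m) => [im|mi]; last by rewrite nth_default.
by rewrite -partition_sum sumnE (big_nth 0%N) big_mkord (bigD1 (Ordinal im)) //= leq_addr.
Qed.

Lemma sum_parts : (\sum_(l < m) part l)%N = n.
Proof. by rewrite -partition_sum sumnE (big_nth 0%N) big_mkord. Qed.

Definition row_of (j : 'I_n) : nat := reshape_index w j.
Definition col_of (j : 'I_n) : nat := reshape_offset w j.

Lemma row_lt j : (row_of j < m)%N.
Proof. by rewrite reshape_indexP // partition_sum ltn_ord. Qed.

Lemma col_lt j : (col_of j < part (row_of j))%N.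
Proof. by rewrite reshape_offsetP // partition_sum ltn_ord. Qed.

Lemma row_col_inj i j : row_of i = row_of j -> col_of i = col_of j -> i = j.
Proof.
move=> rij cij; apply: val_inj.
by rewrite /= -(reshape_indexK w i) -(reshape_indexK w j) -/(row_of i) -/(col_of i) rij cij.
Qed.

Lemma box_exists r c : (c < part r)%N -> exists2 j, row_of j = r & col_of j = c.
Proof.
move=> cr; have lt : (flatten_index w r c < n)%N by rewrite -partition_sum flatten_indexP.
by exists (Ordinal lt); rewrite ?/row_of ?/col_of /= ?flatten_indexKl ?flatten_indexKr.
Qed.

Definition row_colouring : {ffun 'I_n -> 'I_m} := [ffun j => Ordinal (row_lt j)].

Lemma stab_row_colouring : stab row_colouring = row_stab_group n w :> {set 'S_n}.
Proof.
apply/setP => s; rewrite in_stab inE; apply: eq_forallb => j.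
by rewrite !ffunE -val_eqE.
Qed.

Lemma row_count (l : 'I_m) : colour_count row_colouring l = part l.
Proof.
rewrite /colour_count -[RHS]card_ord.
have bd (c : 'I_(part l)) : (flatten_index w l c < n)%N.
  by rewrite -partition_sum flatten_indexP.
have hI : injective (fun c => Ordinal (bd c)).
  move=> c d /(congr1 val) /= /(congr1 (reshape_offset w)).
  by rewrite !flatten_indexKr // => /val_inj.
rewrite -(card_codom hI); apply: eq_card => j; rewrite inE ffunE -val_eqE /=.
apply/eqP/codomP => [rj|[c ->]]; last by rewrite /row_of /= flatten_indexKl.
have cl : (col_of j < part l)%N by rewrite -rj col_lt.
by exists (Ordinal cl); apply: val_inj; rewrite /= -rj reshape_indexK.
Qed.

Lemma col_count b : #|[set j | col_of j == b]| = #|[set l : 'I_m | (b < part l)%N]|.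
Proof.
pose h j : 'I_m := Ordinal (row_lt j).
rewrite -(card_in_imset (f := h) (D := [pred j | j \in [set j | col_of j == b]])).
  apply: eq_card => l; rewrite !inE; apply/imsetP/idP => [[j]|bl].
    by rewrite !inE => /eqP <- ->; rewrite /= col_lt.
  have [j rj cj] := box_exists bl; exists j; first by rewrite !inE cj.
  by apply: val_inj.
move=> i j; rewrite !inE => /eqP ci /eqP cj /(congr1 val) /= rij.
by apply: row_col_inj; rewrite ?ci ?cj.
Qed.

Lemma tableau_stabs_meet : row_stab n w :&: col_stab n w = 1%g.
Proof.
apply/trivgP/subsetP => s; rewrite !inE => /andP[/forallP rs /forallP cs].
apply/eqP/permP => j; rewrite perm1.
by apply: row_col_inj; apply/eqP; [apply: rs | apply: cs].
Qed.

(** If no two cells have the same colour and lie in the same column, then the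
    first r colours fit in the first r rows. *)
Lemma dominance r (f : {ffun 'I_n -> 'I_m}) (g : 'S_n) : (r <= m)%N ->
    (forall x y, f x = f y -> col_of (g x) = col_of (g y) -> x = y) ->
  (\sum_(l < m | (l < r)%N) colour_count f l <= \sum_(l < m | (l < r)%N) part l)%N.
Proof.
move=> rm inj.
have -> : (\sum_(l < m | (l < r)%N) colour_count f l = \sum_(x | (f x < r)%N) 1)%N.
  rewrite (partition_big f (fun l => (l < r)%N)) //=; apply: eq_bigr => l lr.
  rewrite sum1dep_card; apply: eq_card => x; rewrite !inE.
  by case: eqP => [->|_]; rewrite ?lr ?andbF.
have colb x : (col_of (g x) < n)%N by rewrite (leq_trans (col_lt _)) // part_le.
rewrite (partition_big (fun x => Ordinal (colb x)) predT) //=.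
have -> : (\sum_(l < m | (l < r)%N) part l =
    \sum_(b < n) #|[set l : 'I_m | (l < r)%N && (b < part l)%N]|)%N.
  under [RHS]eq_bigr => b _ do rewrite -sum1dep_card big_mkcondr.
  rewrite exchange_big; apply: eq_bigr => l lr /=; rewrite -big_mkcond.
  by rewrite -(big_ord_widen n (fun=> 1%N)) ?part_le // sum1_card card_ord.
apply: leq_sum => b _; rewrite sum1dep_card.
case: (pickP [pred l : 'I_m | (l < r)%N && (part l <= b)%N]) => [l1 /andP[l1r pl1]|all].
  have -> : [set l : 'I_m | (l < r)%N && (b < part l)%N] = [set l : 'I_m | (b < part l)%N].
    apply/setP => l; rewrite !inE; case: ltnP => //= rl; symmetry; apply/negbTE.
    by rewrite -leqNgt (leq_trans (partition_mono _) pl1) // ltnW // (leq_trans l1r).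
  rewrite -col_count -(card_preimset [set j | col_of j == b] (@perm_inj _ g)); apply: subset_leq_card.
  by apply/subsetP => x; rewrite !inE -val_eqE => /andP[].
rewrite -(card_in_imset (f := f)); last first.
  move=> x y; rewrite !inE -!val_eqE /= => /andP[_ /eqP cx] /andP[_ /eqP cy] fxy.
  by apply: inj; rewrite ?cx.
apply: subset_leq_card; apply/subsetP => l /imsetP[x]; rewrite !inE => /andP[fr _] ->.
by rewrite fr ltnNge; have := all (f x); rewrite /= fr /= => ->.
Qed.

(** For t <> 1 the content beta - staircase (t l) exceeds the partition in the
    rows up to the first one moved by t, against dominance. *)
Lemma shifted_content_clash (t : 'S_m) (f : {ffun 'I_n -> 'I_m}) (g : 'S_n) :
    shifted_content (fun i => part i + staircase i)%N t f -> t != 1%g ->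
  exists x y, [/\ x != y, f x = f y & col_of (g x) = col_of (g y)].
Proof.
move=> /forallP ft t1.
case: (pickP [pred p : 'I_n * 'I_n | [&& p.1 != p.2, f p.1 == f p.2 &
     col_of (g p.1) == col_of (g p.2)]]) => [[x y] /= /and3P[xy /eqP fxy /eqP cxy]|no].
  by exists x, y.
have inj x y : f x = f y -> col_of (g x) = col_of (g y) -> x = y.
  move=> fxy cxy; have := no (x, y).
  by rewrite /= fxy cxy !eqxx !andbT; case: eqP.
have [l0 tl0 min] : exists2 l0, t l0 != l0 & forall l : 'I_m, (l < l0)%N -> t l = l.
  have [l1 tl1] : exists l, t l != l.
    apply/existsP; apply: contraR t1 => /existsPn H.
    by apply/eqP/permP => l; rewrite perm1; apply/eqP; have := H l; rewrite negbK.
  case: (@arg_minnP _ l1 (fun l => t l != l) val tl1) => l0 tl0 min.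
  exists l0 => // l ll0; apply/eqP; apply: contraLR ll0 => tl.
  by rewrite -leqNgt min.
have l0t : (l0 < t l0)%N.
  rewrite ltn_neqAle; apply/andP; split; first by rewrite eq_sym.
  rewrite leqNgt; apply/negP => lt; have := min _ lt => /perm_inj E.
  by move: lt; rewrite E ltnn.
have := dominance (ltn_ord l0) inj; rewrite leqNgt => /negP[].
rewrite (bigD1 l0) //= [X in (_ < X)%N](bigD1 l0) //=.
have E l : colour_count f l = (part l + staircase l - staircase (t l))%N.
  by rewrite -(eqP (ft l)) addKn.
rewrite -addSn leq_add //.
  rewrite E /staircase; have := eqP (ft l0); rewrite /staircase.
  have := ltn_ord l0; have := ltn_ord (t l0); lia.
apply: leq_sum => l /andP[ll0 nl]; rewrite E min ?addnK //.
by rewrite ltn_neqAle nl -ltnS.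
Qed.

End Diagram.

Section IndexedCharacter.
Variables (n : nat) (w : seq nat).
Hypothesis wn : is_partition_of n w.

Local Notation m := (size w).
Local Notation part := (nth 0%N w).

Definition beta (i : 'I_m) : nat := part i + staircase i.

Lemma beta_inj : injective beta.
Proof.
move=> i j; rewrite /beta /staircase => E; apply: val_inj => /=.
have := ltn_ord i; have := ltn_ord j.
case: (ltngtP i j) => // ij.
  have := partition_mono wn (ltnW ij); lia.
have := partition_mono wn (ltnW ij); lia.
Qed.

Lemma beta_sum : (\sum_i beta i = n + \sum_(i < m) staircase i)%N.
Proof. by rewrite big_split /= (sum_parts wn). Qed.

(** All the signed sums of cfdot_Ind_sign are nonnegative, and the one for the
    identity is 1, because a row and a column of the tableau share at most one
    cell. *)
Lemma indexed_character_exists : exists c : Iirr [set: 'S_n], irr_indexed_by w c.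
Proof.
pose phi := 'Ind[[set: 'S_n]] (1 : 'CF(row_stab_group n w)).
pose psi := 'Ind[[set: 'S_n]] (cfSign (col_stab_group n w)).
have : '[phi, psi] != 0.
  rewrite cfdot_Ind_sign !mulf_neq0 ?invr_eq0 ?pnatr_eq0 -?lt0n ?cardG_gt0 //.
  rewrite gt_eqF // (bigD1 1%g) //= invg1 conjsg1 tableau_stabs_meet big_set1.
  by rewrite odd_perm1 expr0 ltr_wpDr ?ltr01 // sumr_ge0 // => g _; apply: sign_sum_ge0.
rewrite cfdot_sum_irr => /eqP nz.
case: (pickP [pred c : Iirr [set: 'S_n] | irr_indexed_by w c]) => [c cc|no]; first by exists c.
case: nz; rewrite big1 // => c _; have := no c; rewrite /= /irr_indexed_by !irr_consttE.
by move/negbT; rewrite negb_and !negbK => /orP[]/eqP->; rewrite ?mul0r // rmorph0 mulr0.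
Qed.

(** Each term of frobenius but that of the identity is orthogonal to 'chi_c, by
    shifted_content_clash; the remaining one is the permutation character on the
    row stabiliser, in which 'chi_c occurs. So the scalar product of 'chi_c and
    frobenius is at least 1; as both have norm 1, they coincide. *)
Lemma indexed_characterE (c : Iirr [set: 'S_n]) s :
  irr_indexed_by w c -> 'chi_c s = frobenius beta algC s.
Proof.
case/andP => cY cC; set xi := frobenius beta algC.
have [d d_gt0 dE] : exists2 d : nat, (0 < d)%N &
    \sum_(s in stab (row_colouring wn)) 'chi_c s = d%:R * #|stab (row_colouring wn)|%:R.
  have Nd := Cnat_cfdot_char (cfRes_char (row_stab_group n w) (irr_char c)) (cfun1_char _).
  have [d dE] := natrP Nd; exists d.
    by rewrite lt0n -(pnatr_eq0 algC) -dE cfdot_Res_l cfdotC fmorph_eq0 -irr_consttE.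
  rewrite -dE cfdotE stab_row_colouring mulrC mulVKf; last first.
    by rewrite pnatr_eq0 -lt0n cardG_gt0.
  apply: eq_big => [v|v]; rewrite -?stab_row_colouring // => Ys.
  by rewrite cfResE ?subsetT ?cfun1E -?stab_row_colouring // Ys rmorph1 mulr1.
have dom t : t != 1%g -> forall f, shifted_content beta t f ->
   \sum_(s in stab f) 'chi_c s = 0.
  move=> t1 f ft; apply: no_common_constituent cC => g.
  have [x [y [xy fxy cxy]]] := shifted_content_clash wn g ft t1.
  exists x, y; split=> //; rewrite inE; apply/forallP => j.
  by case: tpermP => [->|->|_ _] //; rewrite -!/(col_of _ _) cxy.
have scal : \sum_s 'chi_c s * xi s = d%:R * n`!%:R.
  transitivity (\sum_(t : 'S_m) (-1) ^+ t *
      \sum_(f | shifted_content beta t f) \sum_(s in stab f) 'chi_c s).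
    rewrite /xi /frobenius; under eq_bigr => v _ do rewrite mulr_sumr.
    rewrite exchange_big; apply: eq_bigr => t _ /=.
    rewrite [in RHS](exchange_big_dep predT) //= mulr_sumr; apply: eq_bigr => v _.
    rewrite mulrCA; congr (_ * _).
    rewrite /fixed_colourings -sum1_card natr_sum mulr_sumr.
    by apply: eq_big => [f|f _]; rewrite ?mulr1 // !inE andbC.
  rewrite (bigD1 1%g) //= [X in _ + X]big1 ?addr0; last first.
    by move=> t t1; rewrite big1 ?mulr0 // => f ft; apply: dom ft.
  rewrite odd_perm1 expr0 mul1r -(sum_card_stab (row_colouring wn)) natr_sum mulr_sumr.
  apply: eq_big => [f|f].
    apply: eq_forallb => l; rewrite perm1 row_count /beta addnC eqn_add2r.
    by [].
  move=> ft; have /same_content_recolour[g fE] : same_content f (row_colouring wn).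
    apply/forallP => l; move/forallP: ft => /(_ l).
    by rewrite perm1 row_count /beta addnC eqn_add2r.
  have st : stab f = (stab (row_colouring wn) :^ g^-1)%g :> {set 'S_n}.
    apply/setP => v; rewrite mem_conjg invgK !in_stab fE.
    apply/forallP/forallP => H j.
      by have := H (g^-1 j)%g; rewrite conjgE !permM !ffunE permKV.
    by have := H (g j); rewrite conjgE !permM permK !ffunE.
  have -> : #|stab f| = #|stab (row_colouring wn)| by rewrite st cardJg.
  rewrite -dE (reindex_inj (conjg_inj g^-1%g)) /=.
  apply: eq_big => [v|v _]; last by rewrite cfunJ ?inE.
  by have /setP/(_ (v ^ g^-1)%g) := st; rewrite memJ_conjg.
have xiR v : (xi v)^* = xi v.
  rewrite /xi /frobenius rmorph_sum; apply: eq_bigr => t _.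
  by rewrite rmorphM rmorph_sign rmorph_nat.
have norm_chi : \sum_v 'chi_c v * ('chi_c v)^* = n`!%:R.
  have nf0 : n`!%:R != 0 :> algC by rewrite pnatr_eq0 -lt0n fact_gt0.
  have := cfnorm_irr c; rewrite cfdotE cardsT card_Sn => /(canRL (mulVKf nf0)).
  by rewrite mulr1 => <-; apply: eq_bigl => v; rewrite inE.
have scal' : \sum_v ('chi_c v)^* * xi v = d%:R * n`!%:R.
  have <- : (d%:R * n`!%:R)^* = d%:R * n`!%:R :> algC by rewrite rmorphM !rmorph_nat.
  rewrite -scal rmorph_sum; apply: eq_bigr => v _.
  by rewrite rmorphM /= xiR.
have : \sum_v `|'chi_c v - xi v| ^+ 2 <= 0.
  have -> : \sum_v `|'chi_c v - xi v| ^+ 2 =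
     \sum_v 'chi_c v * ('chi_c v)^* + \sum_v xi v ^+ 2
       - (\sum_v 'chi_c v * xi v + \sum_v ('chi_c v)^* * xi v).
    rewrite -!big_split -sumrN -big_split; apply: eq_bigr => v _ /=.
    by rewrite normCK rmorphB /= xiR; move: ('chi_c v) (xi v) => x y; ring.
  rewrite norm_chi scal scal' (frobenius_norm algC beta_inj beta_sum).
  rewrite -!mulr2n -mulrnBl mulrn_wle0 // subr_le0.
  by rewrite ler_peMl ?ler0n // ler1n.
move=> le0; have : \sum_v `|'chi_c v - xi v| ^+ 2 == 0.
  by rewrite eq_le le0 sumr_ge0 // => v _; rewrite exprn_ge0.
rewrite psumr_eq0 => [/allP/(_ s)|v _]; last by rewrite exprn_ge0.
rewrite mem_index_enum => /(_ isT); rewrite /= sqrf_eq0 normr_eq0 subr_eq0.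
by move/eqP.
Qed.

End IndexedCharacter.

(** * The value at a cycle *)

Section CountColourings.
Variable X : finType.

Definition join_colouring k r (f : {ffun 'I_k -> X}) (g : {ffun 'I_r -> X}) :
    {ffun 'I_(k + r) -> X} :=
  [ffun j => match split j with inl a => f a | inr c => g c end].

Lemma join_lshift k r (f : {ffun 'I_k -> X}) (g : {ffun 'I_r -> X}) a :
  join_colouring f g (lshift r a) = f a.
Proof. by rewrite ffunE; case: split_ordP => [i /lshift_inj->|i /eqP]; rewrite ?eq_lrshift. Qed.

Lemma join_rshift k r (f : {ffun 'I_k -> X}) (g : {ffun 'I_r -> X}) a :
  join_colouring f g (rshift k a) = g a.
Proof. by rewrite ffunE; case: split_ordP => [i /eqP|i /rshift_inj->]; rewrite ?eq_rlshift. Qed.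

Lemma colour_count_join k r (f : {ffun 'I_k -> X}) (g : {ffun 'I_r -> X}) x :
  colour_count (join_colouring f g) x = (colour_count f x + colour_count g x)%N.
Proof.
rewrite /colour_count -!sum1dep_card big_mkcond big_split_ord /= -!big_mkcond.
by congr (_ + _)%N; apply: eq_bigl => j; rewrite ?join_lshift ?join_rshift.
Qed.

Definition constant_start k r (f : {ffun 'I_(k + r) -> X}) :=
  [forall a : 'I_k, forall c : 'I_k, f (lshift r a) == f (lshift r c)].

Definition colourings_from r (a lam : X -> nat) : nat :=
  #|[set f : {ffun 'I_r -> X} | [forall x, a x + colour_count f x == lam x]%N]|.

(* Colourings whose first k points share a colour, sorted by this colour. *)
Lemma constant_start_count k r (a lam : X -> nat) : (0 < k)%N ->
  #|[set f : {ffun 'I_(k + r) -> X} |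
     constant_start f && [forall x, a x + colour_count f x == lam x]%N]| =
  (\sum_l colourings_from r (fun x => a x + k * (x == l))%N lam)%N.
Proof.
case: k => // k _.
rewrite -sum1dep_card (partition_big (fun f : {ffun 'I_(k.+1 + r) -> X} => f (lshift r ord0)) predT) //=.
apply: eq_bigr => l _; rewrite sum1dep_card /colourings_from.
pose c : {ffun 'I_k.+1 -> X} := [ffun=> l].
have ccount x : colour_count c x = (k.+1 * (x == l))%N.
  rewrite /colour_count; case: eqP => [->|/eqP xl].
    by rewrite muln1 -[RHS]card_ord; apply: eq_card => j; rewrite !inE ffunE eqxx.
  rewrite muln0; apply: eq_card0 => j; rewrite !inE ffunE eq_sym.
  exact/negbTE.
have cI : injective (join_colouring c : {ffun 'I_r -> X} -> _).
  move=> f g fg; apply/ffunP => j; have /ffunP/(_ (rshift k.+1 j)) := fg.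
  by rewrite !join_rshift.
rewrite -(card_imset _ cI); apply: eq_card => f; rewrite inE.
apply/idP/imsetP => [/andP[/andP[/forallP cst /forallP ct] /eqP fl]|[g]].
  have fE : f = join_colouring c [ffun j => f (rshift k.+1 j)].
    apply/ffunP => j; case: (split_ordP j) => i ->.
      rewrite join_lshift ffunE -fl; apply/eqP.
      by have /forallP/(_ ord0) := cst i.
    by rewrite join_rshift ffunE.
  exists [ffun j => f (rshift k.+1 j)] => //; rewrite inE; apply/forallP => x.
  by have := ct x; rewrite [f in colour_count f x]fE colour_count_join ccount addnA.
rewrite inE => /forallP ct ->; rewrite join_lshift ffunE eqxx andbT; apply/andP; split.
  by apply/forallP => i; apply/forallP => j; rewrite !join_lshift !ffunE.
by apply/forallP => x; rewrite colour_count_join ccount addnA.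
Qed.

(** The multinomial coefficients, written with falling factorials so that
    impossible contents contribute 0. *)
Lemma colourings_fromE r (a lam : X -> nat) : (\sum_x lam x = r + \sum_x a x)%N ->
  (colourings_from r a lam * \prod_x (lam x)`! = r`! * \prod_x (lam x) ^_ (a x))%N.
Proof.
elim: r a => [|r IH] a s.
  rewrite mul1n /colourings_from.
  have cc0 (f : {ffun 'I_0 -> X}) x : colour_count f x = 0%N.
    by apply: eq_card0 => -[].
  case: (boolP [forall x, a x == lam x]) => [/forallP E|/forallPn/=[x nx]].
    rewrite (_ : [set f | _] = setT) ?cardsT ?card_ffun ?card_ord ?mul1n.
      by apply: eq_bigr => x _; rewrite (eqP (E x)) ffactnn.
    by apply/setP => f; rewrite !inE; apply/forallP => x; rewrite cc0 addn0.
  rewrite (_ : [set f | _] = set0) ?cards0 ?mul0n; last first.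
    apply/setP => f; rewrite !inE; apply/negbTE/forallPn; exists x.
    by rewrite cc0 addn0.
  have [y ay] : exists y, (lam y < a y)%N.
    apply/existsP; apply: contraR nx => /existsPn H.
    have : (\sum_(y | y != x) a y <= \sum_(y | y != x) lam y)%N.
      by apply: leq_sum => y _; rewrite leqNgt H.
    have := s; rewrite (bigD1 x) //= [in RHS](bigD1 x) //= => s' le.
    have := H x; rewrite -leqNgt => lex; apply/eqP; lia.
  by rewrite (bigD1 y) //= ffact_small.
have -> : colourings_from r.+1 a lam = (\sum_l colourings_from r (fun x => a x + 1 * (x == l))%N lam)%N.
  rewrite -constant_start_count //; apply: eq_card => f; rewrite !inE.
  rewrite (_ : constant_start _) //.
  by apply/forallP => i; apply/forallP => j; rewrite !ord1.
rewrite big_distrl /=.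
transitivity (\sum_l r`! * ((\prod_x (lam x) ^_ (a x)) * (lam l - a l)))%N.
  apply: eq_bigr => l _; rewrite IH; last first.
    have one : (\sum_x 1 * (x == l) = 1)%N.
      by rewrite (bigD1 l) //= eqxx big1 // => x /negPf->.
    by rewrite s big_split /= one addn1 addnS.
  congr (_ * _)%N; rewrite (bigD1 l) //= eqxx addn1 ffactnSr mulnAC; congr (_ * _)%N.
  rewrite [RHS](bigD1 l) //=; congr (_ * _)%N.
  by apply: eq_bigr => x /negPf->; rewrite muln0 addn0.
rewrite -!big_distrr /= factS (mulnC r.+1) -!mulnA; congr (_ * _)%N; rewrite mulnC.
case: (boolP [forall x, a x <= lam x]%N) => [/forallP le|/forallPn[x]].
  congr (_ * _)%N; apply: (@addIn (\sum_x a x)); rewrite -s -big_split /=.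
  by apply: eq_bigr => x _; rewrite subnK.
rewrite -ltnNge => lt; have -> : (\prod_x lam x ^_ a x = 0)%N.
  by rewrite (bigD1 x) //= ffact_small.
by rewrite !muln0.
Qed.

End CountColourings.

Section Cycle.
Variables k r : nat.

Definition cycle_fun (j : 'I_(k + r)) : 'I_(k + r) :=
  match split j with inl a => lshift r (ordS a) | inr c => rshift k c end.

Lemma cycle_fun_lshift a : cycle_fun (lshift r a) = lshift r (ordS a).
Proof. by rewrite /cycle_fun; case: split_ordP => i /eqP; rewrite ?eq_lrshift // => /eqP/lshift_inj->. Qed.

Lemma cycle_fun_rshift c : cycle_fun (rshift k c) = rshift k c.
Proof. by rewrite /cycle_fun; case: split_ordP => i /eqP; rewrite ?eq_rlshift // => /eqP/rshift_inj->. Qed.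

Fact cycle_fun_inj : injective cycle_fun.
Proof.
move=> i j; case: (split_ordP i) => a ->; case: (split_ordP j) => c ->;
  rewrite ?cycle_fun_lshift ?cycle_fun_rshift.
- by move/lshift_inj/ordS_inj->.
- by move/eqP; rewrite eq_lrshift.
- by move/eqP; rewrite eq_rlshift.
- by [].
Qed.

Definition k_cycle : 'S_(k + r) := perm cycle_fun_inj.

Lemma k_cycle_lshift a : k_cycle (lshift r a) = lshift r (ordS a).
Proof. by rewrite permE cycle_fun_lshift. Qed.

Lemma k_cycle_rshift c : k_cycle (rshift k c) = rshift k c.
Proof. by rewrite permE cycle_fun_rshift. Qed.

Lemma k_cycle_iter i (a : 'I_k) :
  exists2 c : 'I_k, (k_cycle ^+ i)%g (lshift r a) = lshift r c & c = ((a + i) %% k)%N :> nat.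
Proof.
elim: i => [|i [c cE cv]].
  by exists a; rewrite ?expg0 ?perm1 // addn0 modn_small.
exists (ordS c); first by rewrite expgSr permM cE k_cycle_lshift.
by rewrite /= cv -addn1 modnDml addn1 addnS.
Qed.

Lemma preserves_k_cycle (X : finType) (f : {ffun 'I_(k + r) -> X}) :
  preserves k_cycle f = constant_start f.
Proof.
apply/forallP/forallP => [H a|H j].
  apply/forallP => c.
  have it i x : f ((k_cycle ^+ i)%g x) = f x.
    elim: i x => [|i IH] x; first by rewrite expg0 perm1.
    by rewrite expgSr permM (eqP (H _)).
  have [d dE dv] := k_cycle_iter (c + (k - a)) a.
  rewrite -(it (c + (k - a))%N (lshift r a)) dE; apply/eqP; congr (f (lshift r _)).
  apply: val_inj; rewrite /= dv addnCA subnKC ?(ltnW (ltn_ord a)) //.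
  by rewrite modnDr modn_small.
case: (split_ordP j) => [a ->|c ->]; last by rewrite k_cycle_rshift.
by rewrite k_cycle_lshift; have /forallP := H (ordS a).
Qed.

Lemma k_cycle_type : (0 < k)%N -> has_cycle_type k_cycle (k :: nseq (k + r - k) 1%N).
Proof.
move=> k_gt0; pose L := [set lshift r a | a in 'I_k].
have oL a : porbit k_cycle (lshift r a) = L.
  apply/setP => x; apply/porbitP/imsetP => [[i ->]|[c _ ->]].
    by have [d -> _] := k_cycle_iter i a; exists d.
  have [d dE dv] := k_cycle_iter (c + (k - a)) a.
  exists (c + (k - a))%N; rewrite dE; congr lshift; apply: val_inj; rewrite /= dv.
  by rewrite addnCA subnKC ?(ltnW (ltn_ord a)) // modnDr modn_small.
have oR c : porbit k_cycle (rshift k c) = [set rshift k c].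
  apply/setP => x; rewrite inE; apply/porbitP/eqP => [[i ->]|->]; last first.
    by exists 0%N; rewrite expg0 perm1.
  by elim: i => [|i IH]; rewrite ?expg0 ?perm1 // expgSr permM IH k_cycle_rshift.
have pE : perm_eq (enum (porbits k_cycle)) (L :: [seq [set rshift k c] | c <- enum 'I_r]).
  apply: uniq_perm; first exact: enum_uniq.
    rewrite /= map_inj_uniq ?enum_uniq => [|c d /set1_inj/rshift_inj//].
    rewrite andbT; apply/mapP => -[c _ LE].
    have : lshift r (Ordinal k_gt0) \in L by apply: imset_f.
    by rewrite LE inE eq_lrshift.
  move=> B; rewrite mem_enum inE; apply/imsetP/orP => [[j _ ->]|].
    case: (split_ordP j) => [a ->|c ->]; first by left; rewrite oL.
    by right; apply/mapP; exists c; rewrite ?mem_enum ?oR.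
  case=> [/eqP->|/mapP[c _ ->]].
    by exists (lshift r (Ordinal k_gt0)); rewrite ?oL.
  by exists (rshift k c); rewrite ?oR.
rewrite /has_cycle_type (permPl (perm_map _ pE)) /= -map_comp.
rewrite card_imset ?card_ord; last exact: lshift_inj.
rewrite (eq_map (g := fun=> 1%N)) => [|c]; last by rewrite /= cards1.
have -> : map (fun=> 1%N) (enum 'I_r) = nseq (size (enum 'I_r)) 1%N by elim: (enum _) => //= _ s ->.
by rewrite size_enum_ord addKn.
Qed.

End Cycle.

Section FallingDeterminant.
Variables (F : fieldType) (m : nat).
Implicit Types y : 'I_m -> F.

Definition falling s (x : F) : F := \prod_(i < s) (x - i%:R).

Lemma falling_nat s a : falling s a%:R = (a ^_ s)%:R.
Proof.
elim: s => [|s IH]; first by rewrite /falling big_ord0.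
rewrite /falling big_ord_recr -/(falling s _) IH ffactnSr natrM /=.
case: (leqP s a) => [sa|sa]; first by rewrite natrB.
by rewrite ffact_small // !mul0r.
Qed.

Lemma fallingD s k x : falling (k + s) x = falling k x * falling s (x - k%:R).
Proof.
rewrite /falling big_split_ord; congr (_ * _); apply: eq_bigr => i _ /=.
by rewrite natrD opprD addrA.
Qed.

Definition falling_det y := \det (\matrix_(i, j < m) falling (staircase j) (y i)).

Definition difference_product y := \prod_(i < m) \prod_(j < m | (i < j)%N) (y j - y i).

(** The falling factorials are monic polynomials of the degrees given by the
    staircase, so that the determinant is that of Vandermonde, up to a sign. *)
Lemma falling_detE : exists2 eps : F, eps != 0 &
  forall y, falling_det y = eps * difference_product y.
Proof.
pose P s : {poly F} := \prod_(i < s) ('X - i%:R%:P).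
have PE s x : (P s).[x] = falling s x.
  by rewrite horner_prod; apply: eq_bigr => i _; rewrite !hornerE.
have sP s : size (P s) = s.+1 by rewrite /P -big_enum size_prod_XsubC size_enum_ord.
pose A : 'M[F]_m := \matrix_(a, j) (P j)`_a.
have detA : \det A = 1.
  rewrite -det_tr det_trig; last first.
    by apply/is_trig_mxP => i j ij; rewrite !mxE nth_default // sP.
  apply: big1 => i _; rewrite !mxE.
  have /monicP : P i \is monic by apply: monic_prod_XsubC.
  by rewrite lead_coefE sP.
exists (\det (col_perm (perm (@rev_ord_inj m)) A)).
  by rewrite col_permE det_mulmx detA mul1r det_perm signr_eq0.
move=> y; rewrite /falling_det.
rewrite [RHS]mulrC; have <- : \det (Vandermonde m (\row_j y j)) = difference_product y.
  rewrite det_Vandermonde; apply: eq_bigr => i _; apply: eq_bigr => j _.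
  by rewrite !mxE.
rewrite -[X in X * _]det_tr -det_mulmx; congr (\det _); apply/matrixP => i j; rewrite !mxE.
rewrite -PE (@horner_coef_wide _ m); last first.
  by rewrite sP staircase_rev ltn_ord.
by apply: eq_bigr => a _; rewrite !mxE permE staircase_rev mulrC.
Qed.

(** The factors of the difference product without the variable l do not change. *)
Lemma difference_product_change l y y' : (forall j, j != l -> y' j = y j) ->
  difference_product y' * \prod_(j | j != l) (y l - y j) =
  difference_product y * \prod_(j | j != l) (y' l - y' j).
Proof.
pose rest z := \prod_(i < m | i != l) \prod_(j < m | (i < j)%N && (j != l)) (z j - z i) : F.
have E z : difference_product z =
    (-1) ^+ #|[pred j : 'I_m | (l < j)%N]| * rest z * \prod_(j | j != l) (z l - z j).
  rewrite /difference_product (bigD1 l) //=.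
  under [X in _ * X]eq_bigr => i il.
    rewrite (bigID (fun j => j == l)) /= mulrC.
    over.
  rewrite big_split /= -/(rest z).
  have -> : \prod_(j < m | (l < j)%N) (z j - z l) =
     (-1) ^+ #|[pred j : 'I_m | (l < j)%N]| * \prod_(j < m | (l < j)%N) (z l - z j).
    by rewrite -prodrN; apply: eq_bigr => j _; rewrite opprB.
  rewrite [in RHS](bigID (fun j : 'I_m => (l < j)%N)) /=.
  have -> : \prod_(i | i != l) \prod_(j < m | (i < j)%N && (j == l)) (z j - z i) =
      \prod_(i < m | (i != l) && ~~ (l < i)%N) (z l - z i).
    rewrite big_mkcondr; apply: eq_bigr => i il.
    case: ltnP => li /=.
      by rewrite big_pred0 // => j; apply/negbTE/andP => -[ij /eqP jl]; move: ij; rewrite jl ltnNge ltnW.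
    rewrite (big_pred1 l) // => j /=; case: eqP => [->|]; rewrite ?andbF //.
    by rewrite andbT ltn_neqAle il.
  rewrite (eq_bigl (fun j => (j != l) && (l < j)%N)).
    by set a := _ ^+ _; move: (rest z) a => R a; ring.
  by move=> j; case: eqP => [->|]; rewrite ?ltnn.
move=> yy; rewrite !E.
have -> : rest y' = rest y.
  by apply: eq_bigr => i il; apply: eq_bigr => j /andP[_ jl]; rewrite !yy.
by ring.
Qed.

End FallingDeterminant.

Section CycleValue.
Variables (m : nat) (lam : 'I_m -> nat).
Hypothesis lamI : injective lam.

Let sum_stairs (t : 'S_m) : (\sum_x staircase (t x) = \sum_(x < m) staircase x)%N.
Proof. by rewrite [RHS](reindex_inj (@perm_inj _ t)). Qed.

Let fact_prod : algC := (\prod_x (lam x)`!)%:R.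

Lemma frobenius_1 n : (\sum_i lam i = n + \sum_(i < m) staircase i)%N ->
  frobenius lam algC (1%g : 'S_n) * fact_prod =
    n`!%:R * falling_det (fun i => (lam i)%:R : algC).
Proof.
move=> s; rewrite /frobenius mulr_suml mulr_sumr; apply: eq_bigr => t _.
rewrite -mulrA [RHS]mulrCA; congr (_ * _).
have -> : fixed_colourings lam t (1%g : 'S_n) = colourings_from n (fun x => staircase (t x)) lam.
  apply: eq_card => f; rewrite !inE (_ : preserves _ _) //.
  by apply/forallP => j; rewrite perm1.
rewrite /fact_prod -natrM colourings_fromE ?sum_stairs // natrM natr_prod; congr (_ * _).
by apply: eq_bigr => i _; rewrite mxE falling_nat.
Qed.

(** A colouring fixed by the cycle gives one colour l to all of its k points,
    which amounts to lowering the exponent of l by k. *)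
Lemma frobenius_k_cycle k r : (0 < k)%N ->
    (\sum_i lam i = (k + r) + \sum_(i < m) staircase i)%N ->
  frobenius lam algC (k_cycle k r) * fact_prod =
    r`!%:R * \sum_l falling k (lam l)%:R *
       falling_det (fun i => (lam i)%:R - (k * (i == l))%:R : algC).
Proof.
move=> k_gt0 s; rewrite /frobenius mulr_suml.
under [in RHS]eq_bigr => l _ do rewrite mulr_sumr.
rewrite [in RHS]exchange_big mulr_sumr; apply: eq_bigr => t _ /=.
rewrite -mulrA.
have -> : fixed_colourings lam t (k_cycle k r) =
    (\sum_l colourings_from r (fun x => staircase (t x) + k * (x == l))%N lam)%N.
  rewrite -constant_start_count //; apply: eq_card => f; rewrite !inE.
  by rewrite preserves_k_cycle.
rewrite /fact_prod -natrM big_distrl natr_sum !mulr_sumr; apply: eq_bigr => l _ /=.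
rewrite (mulrCA (falling _ _)) [RHS]mulrCA; congr (_ * _).
rewrite colourings_fromE; last first.
  have kl : (\sum_(x < m) k * (x == l) = k)%N.
    by rewrite (bigD1 l) //= eqxx muln1 big1 ?addn0 // => x /negPf->; rewrite muln0.
  by rewrite s big_split /= sum_stairs kl [(_ + k)%N]addnC addnA (addnC r).
rewrite natrM natr_prod; congr (_ * _); rewrite (bigD1 l) //= [in RHS](bigD1 l) //= mulrA.
rewrite !mxE eqxx muln1; congr (_ * _).
  by rewrite -falling_nat addnC fallingD.
by apply: eq_bigr => i /negPf il; rewrite mxE il muln0 addn0 subr0 falling_nat.
Qed.

End CycleValue.

(** Frobenius's formula for the normalised character at a k-cycle. *)
Lemma character_k_cycle k r w (c : Iirr [set: 'S_(k + r)]) :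
    (0 < k)%N -> is_partition_of (k + r) w -> irr_indexed_by w c ->
  ((k + r) ^_ k)%:R * 'chi_c (k_cycle k r) / 'chi_c 1%g =
    \sum_(l < size w) falling k (beta l)%:R *
      \prod_(j < size w | j != l) (((beta l)%:R - k%:R - (beta j)%:R) /
                                   ((beta l)%:R - (beta j)%:R)).
Proof.
move=> k_gt0 wn cw; rewrite !(indexed_characterE wn _ cw).
have bI := beta_inj wn; have bs := beta_sum wn.
set B := @beta w in bI bs *.
have := frobenius_1 bs; have := frobenius_k_cycle k_gt0 bs.
set p := (\prod_x _)%:R; set x := frobenius _ _ _; set y := frobenius _ _ _ => Ex Ey.
have p0 : p != 0 by rewrite pnatr_eq0 -lt0n prodn_gt0 // => i; rewrite fact_gt0.
have [eps eps0 epsE] := falling_detE algC (size w).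
set u := fun i => (B i)%:R : algC.
have ud i j : i != j -> u i - u j != 0.
  by move=> ij; rewrite subr_eq0 /u eqr_nat (inj_eq bI).
have V0 : difference_product u != 0.
  apply/prodf_neq0 => i _; apply/prodf_neq0 => j ij; apply: ud.
  by rewrite -val_eqE /= gtn_eqF.
have r0 : r`!%:R != 0 :> algC by rewrite pnatr_eq0 -lt0n fact_gt0.
have n0 : ((k + r) ^_ k)%:R != 0 :> algC by rewrite pnatr_eq0 -lt0n ffact_gt0 leq_addr.
have nE : (k + r)`!%:R = ((k + r) ^_ k)%:R * r`!%:R :> algC.
  by rewrite -natrM -{3}(addKn k r) ffact_fact ?leq_addr.
rewrite -[x](mulfK p0) Ex -[y](mulfK p0) Ey nE epsE.
set S := \sum_(l < size w) _.
rewrite (_ : S = eps * difference_product u * \sum_(l < size w) falling k (B l)%:R *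
      \prod_(j < size w | j != l) (((B l)%:R - k%:R - (B j)%:R) / ((B l)%:R - (B j)%:R))).
  set T := \sum_(l < size w) _; clearbody T.
  by field; rewrite p0 n0 r0 eps0 V0.
rewrite mulr_sumr; apply: eq_bigr => l _; rewrite epsE [RHS]mulrCA; congr (_ * _).
rewrite -mulrA; congr (_ * _); set u' := fun i => _.
have uu j : j != l -> u' j = u j by rewrite /u' => /negPf->; rewrite muln0 subr0.
have D0 : \prod_(j | j != l) (u l - u j) != 0.
  by apply/prodf_neq0 => j jl; rewrite ud // eq_sym.
apply: (mulIf D0); rewrite (difference_product_change uu) -mulrA; congr (_ * _).
rewrite -big_split; apply: eq_bigr => j jl /=.
by rewrite divfK ?ud 1?eq_sym // (uu j jl) /u' eqxx muln1.
Qed.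

(** * Residues at infinity *)

Section Homogenisation.
Variable A : comUnitRingType.
Implicit Types (p q : {poly A}) (x y : series A).

(* The form of degree d whose dehomogenisation is p; at (1, 't) it is the
   reversed polynomial, that is, the expansion of p at infinity. *)
Definition binform d p x y : series A := \sum_(r < d.+1) seriesC p`_r * x ^+ r * y ^+ (d - r).

Lemma formD d p q x y : binform d (p + q) x y = binform d p x y + binform d q x y.
Proof.
by rewrite -big_split; apply: eq_bigr => r _; rewrite coefD rmorphD !mulrDl.
Qed.

Lemma formN d p x y : binform d (- p) x y = - binform d p x y.
Proof.
by rewrite -sumrN; apply: eq_bigr => r _; rewrite coefN rmorphN !mulNr.
Qed.

Lemma formZ d a p x y : binform d (a *: p) x y = seriesC a * binform d p x y.
Proof.
by rewrite mulr_sumr; apply: eq_bigr => r _; rewrite coefZ rmorphM !mulrA.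
Qed.

Lemma form1 x y : binform 0 1 x y = 1.
Proof. by rewrite /binform big_ord1 coef1 rmorph1 !mulr1. Qed.

Lemma form_shift d e p x y : (size p <= d.+1)%N ->
  binform (d + e) p x y = y ^+ e * binform d p x y.
Proof.
move=> sp; rewrite /binform -addSn big_split_ord /= [X in _ + X]big1 ?addr0.
  rewrite mulr_sumr; apply: eq_bigr => r _.
  by rewrite addnC -addnBA -1?ltnS // exprD; ring.
by move=> r _; rewrite nth_default ?rmorph0 ?mul0r // (leq_trans sp) // leq_addr.
Qed.

Lemma form_XM d p x y : (size p <= d.+1)%N ->
  binform d.+1 ('X * p) x y = x * binform d p x y.
Proof.
move=> sp; rewrite /binform big_ord_recl coefXM rmorph0 !mul0r add0r mulr_sumr.
by apply: eq_bigr => r _; rewrite coefXM /= subSS exprS; ring.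
Qed.

Lemma form_XsubC d p c x y : (size p <= d.+1)%N ->
  binform d.+1 (('X - c%:P) * p) x y = (x - seriesC c * y) * binform d p x y.
Proof.
move=> sp; rewrite mulrBl formD formN mul_polyC formZ form_XM //.
by rewrite -addn1 form_shift // expr1; ring.
Qed.

Lemma form_prod d p (s : seq A) x y : (size p <= d.+1)%N ->
  binform (size s + d) ((\prod_(c <- s) ('X - c%:P)) * p) x y =
    (\prod_(c <- s) (x - seriesC c * y)) * binform d p x y.
Proof.
move=> sp; elim: s => [|c s IH]; first by rewrite !big_nil !mul1r.
rewrite !big_cons -mulrA addSn form_XsubC ?IH ?mulrA //.
rewrite (leq_trans (size_polyMleq _ _)) // size_prod_XsubC /=.
by rewrite -addnS leq_add2l.
Qed.

End Homogenisation.

Section Residue.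
Variable F : fieldType.

Lemma lagrange_lead m (mu : 'I_m -> F) (p : {poly F}) : injective mu -> (size p <= m)%N ->
  p`_m.-1 = \sum_l p.[mu l] / \prod_(j | j != l) (mu l - mu j).
Proof.
case: m mu => [mu|m mu] muI sp.
  by rewrite big_ord0; move: sp; rewrite leqn0 size_poly_eq0 => /eqP->; rewrite coef0.
have d0 l : \prod_(j | j != l) (mu l - mu j) != 0.
  by apply/prodf_neq0 => j jl; rewrite subr_eq0 (inj_eq muI) eq_sym.
pose b l : {poly F} := \prod_(j | j != l) ('X - (mu j)%:P).
have sb l : size (b l) = m.+1.
  rewrite /b -big_filter size_prod_XsubC; congr _.+1.
  by rewrite -sum1_size big_filter sum1_card cardC1 card_ord.
pose L : {poly F} := \sum_l (p.[mu l] / \prod_(j | j != l) (mu l - mu j)) *: b l.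
have pL : p = L.
  apply/eqP; rewrite -subr_eq0; apply: contraT => nz.
  have : (size [seq mu l | l <- enum 'I_m.+1] < size (p - L)%R)%N.
    apply: max_poly_roots => //.
      apply/allP => _ /mapP[l _ ->]; rewrite rootE hornerD hornerN.
      suff -> : L.[mu l] = p.[mu l] by rewrite subrr.
      rewrite horner_sum (bigD1 l) //= [X in _ + X]big1 ?addr0.
        have bl : (b l).[mu l] = \prod_(j | j != l) (mu l - mu j).
          by rewrite horner_prod; apply: eq_bigr => j _; rewrite hornerXsubC.
        by rewrite hornerZ bl divfK.
      move=> i il; rewrite hornerZ horner_prod; apply/eqP; rewrite mulf_eq0; apply/orP; right.
      by apply/prodf_eq0; exists l; rewrite 1?eq_sym // hornerXsubC subrr.
    by rewrite map_inj_uniq ?enum_uniq.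
  rewrite size_map size_enum_ord ltnNge (leq_trans (size_polyD _ _)) //.
  rewrite geq_max sp size_polyN (leq_trans (size_sum _ _ _)) //.
  apply/bigmax_leqP => l _; by rewrite (leq_trans (size_scale_leq _ _)) ?sb.
rewrite {1}pL coef_sum; apply: eq_bigr => l _; rewrite coefZ.
have /monicP : b l \is monic by apply: monic_prod_XsubC.
by rewrite lead_coefE sb /= => ->; rewrite mulr1.
Qed.

(** The residue at infinity of N / \prod (x - mu l) is minus the sum of the
    finite residues. *)
Lemma residue_sum m k (mu : 'I_m.+1 -> F) (N : {poly F}) :
    injective mu -> (size N <= (m.+1 + k).+1)%N ->
  \sum_l N.[mu l] / \prod_(j | j != l) (mu l - mu j) =
    (binform (m.+1 + k) N 1 't / \prod_l (1 - seriesC (mu l) * 't)) k.+1.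
Proof.
move=> muI sN; pose s := [seq mu l | l <- enum 'I_m.+1].
pose D := \prod_(c <- s) ('X - c%:P).
have sD : size D = m.+2 by rewrite size_prod_XsubC size_map size_enum_ord.
have D0 : D != 0 by rewrite -size_poly_eq0 sD.
have Dr l : D.[mu l] = 0.
  by apply/rootP; rewrite root_prod_XsubC map_f ?mem_enum.
have sr : (size (N %% D)%R <= m.+1)%N by rewrite -ltnS -sD ltn_modp.
have sq : (size (N %/ D)%R <= k.+1)%N.
  by rewrite size_divp // sD /= leq_subLR addnS.
have -> : \prod_l (1 - seriesC (mu l) * 't) = \prod_(c <- s) (1 - seriesC c * 't).
  by rewrite big_map big_enum.
set P := \prod_(c <- s) _.
have uP : P \is a GRing.unit by exact: series_prod_lin_unit.
have -> : binform (m.+1 + k) N 1 't = P * binform k (N %/ D) 1 't + 't ^+ k.+1 * binform m (N %% D) 1 't.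
  rewrite {1}(divp_eq N D) formD mulrC; congr (_ + _); last first.
    by rewrite addSnnS form_shift.
  by rewrite -(form_prod s _ _ sq) size_map size_enum_ord.
rewrite mulrDl mulrAC divrr // mul1r -mulrA seriesDE seriesXnM ltnn subnn.
have -> : binform k (N %/ D) 1 't k.+1 = 0.
  rewrite /binform series_sumE big1 // => r _; rewrite expr1n mulr1 seriesCM seriesXnE.
  by rewrite gtn_eqF ?mulr0 // ltnS leq_subr.
have P0 : P 0%N = 1 by exact: series_prod_lin0.
rewrite add0r series_M0 ev0V // P0 invr1 mulr1.
have -> : binform m (N %% D) 1 't 0%N = (N %% D)`_m.
  rewrite /binform series_sumE big_ord_recr /= [X in X + _]big1 ?add0r.
    by rewrite subnn expr1n !mulr1 seriesCE eqxx.
  move=> r _; rewrite expr1n mulr1 seriesCM seriesXnE.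
  by rewrite ltn_eqF ?mulr0 // subn_gt0.
rewrite (lagrange_lead muI sr); apply: eq_bigr => l _; congr (_ / _).
by rewrite {1}(divp_eq N D) hornerD hornerM Dr mulr0 add0r.
Qed.

End Residue.

(** * Free cumulants *)

Section Cumulants.
Variables (A : comUnitRingType) (m : nat) (c : 'I_m -> A).
Implicit Types R : series A.

(* The difference of the two sides of G(R(z) / z) = 1 / z, cleared of its
   denominators, for G(x) = (x + m) \prod (x - c l) / (x - c l + 1). *)
Definition cumulant_defect R : series A :=
  (R + seriesC m%:R * 't) * \prod_l (R - seriesC (c l) * 't) -
    \prod_l (R - seriesC (c l - 1) * 't).

Let defect_poly : {poly series A} :=
  ('X + (seriesC m%:R * 't)%:P) * \prod_l ('X - (seriesC (c l) * 't)%:P) -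
    \prod_l ('X - (seriesC (c l - 1) * 't)%:P).

Let defect_polyE R : defect_poly.[R] = cumulant_defect R.
Proof.
rewrite /defect_poly !hornerE !horner_prod; congr (_ * _ - _).
  by apply: eq_bigr => l _; rewrite hornerXsubC.
by apply: eq_bigr => l _; rewrite hornerXsubC.
Qed.

Let defect_poly0 : map_poly (@ev0 A) defect_poly = 'X * 'X^m - 'X^m.
Proof.
have e0 a : (@ev0 A) (seriesC a * 't) = 0 by rewrite /ev0 seriesCM seriesXE mulr0.
have pr (d : 'I_m -> A) :
    map_poly (@ev0 A) (\prod_l ('X - (seriesC (d l) * 't)%:P)) = 'X^m.
  rewrite rmorph_prod /= (eq_bigr (fun=> 'X)).
    by rewrite prodr_const card_ord.
  by move=> l _; rewrite rmorphB /= map_polyX map_polyC /= e0 subr0.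
by rewrite rmorphB rmorphM rmorphD /= !pr map_polyX map_polyC /= e0 addr0.
Qed.

Let defect_root : defect_poly.[1] 0%N = 0.
Proof.
rewrite -[LHS]/(ev0 _) -horner_map rmorph1 defect_poly0.
by rewrite !hornerE expr1n subrr.
Qed.

Let defect_simple : (defect_poly^`()).[1] 0%N = 1.
Proof.
rewrite -[LHS]/(ev0 _) -horner_map rmorph1 -deriv_map defect_poly0 -exprS.
rewrite derivB !derivXn hornerD hornerN !hornerMn !hornerXn !expr1n.
by rewrite mulrS addrK.
Qed.

Definition is_cumulants R := R 0%N = 1 /\ cumulant_defect R = 0.

Lemma cumulants_exist : exists R, is_cumulants R.
Proof.
have [R R0 E] := hensel_exists defect_root defect_simple.
by exists R; split; rewrite // -defect_polyE.
Qed.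

Lemma cumulants_agree n R R' : is_cumulants R -> R' 0%N = 1 ->
  agree n (cumulant_defect R') 0 -> agree n R' R.
Proof.
case=> R0 E R'0 E'; apply: (hensel_unique defect_simple) => //.
by rewrite !defect_polyE E.
Qed.

Lemma cumulants_unique R R' : is_cumulants R -> is_cumulants R' -> R' = R.
Proof.
move=> cR [R'0 E']; apply: seriesP => n; apply: (@cumulants_agree n.+1) => //.
by rewrite E'.
Qed.

End Cumulants.

Lemma is_cumulants_map (A B : comUnitRingType) (phi : {rmorphism A -> B}) m
    (c : 'I_m -> A) R :
  is_cumulants c R -> is_cumulants (phi \o c) (series_map phi R).
Proof.
case=> R0 E; split; first by rewrite /series_map R0 rmorph1.
have lin a : series_map phi (seriesC a * 't) = seriesC (phi a) * 't.
  by rewrite rmorphM /= series_mapC series_mapX.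
have <- : series_map phi (cumulant_defect c R) = 0 by rewrite E rmorph0.
rewrite /cumulant_defect rmorphB rmorphM rmorphD !rmorph_prod /= lin (rmorph_nat phi).
congr (_ * _ - _); apply: eq_bigr => l _; rewrite [RHS]rmorphB /= lin //.
by rewrite (rmorphB phi) rmorph1.
Qed.

Section DiagramCumulants.
Variable w : seq nat.
Local Notation m := (size w).
Local Notation part := (nth 0%N w).
Hypothesis w_strict : forall i, (i < m)%N -> (part i.+1 < part i)%N.

Definition row_content (R : pzRingType) (l : 'I_m) : R := (part l)%:R - l%:R.

(* In a partition with distinct parts every row ends in a removable cell and
   takes an addable one; the last addable cell opens a new row. *)
Lemma prod_addable (R : comNzRingType) (f : int -> R) :
  \prod_(x <- addable_contents w) f x =
    f (- m%:Z) * \prod_(l < m) f ((part l)%:Z - l%:Z).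
Proof.
rewrite /addable_contents (eq_in_filter (a2 := predT)); last first.
  move=> [|r] //; rewrite mem_iota /= add0n !ltnS => rm.
  by rewrite w_strict.
rewrite filter_predT big_map -addn1 iotaD big_cat /= big_seq1 add0n.
rewrite nth_default // sub0r mulrC; congr (_ * _).
by rewrite -[m in iota 0 m]subn0 -/(index_iota 0 m) big_mkord.
Qed.

Lemma prod_removable (R : comNzRingType) (f : int -> R) :
  \prod_(y <- removable_contents w) f y = \prod_(l < m) f ((part l)%:Z - l%:Z - 1).
Proof.
rewrite /removable_contents (eq_in_filter (a2 := predT)); last first.
  by move=> r; rewrite mem_iota /= add0n => rm; rewrite w_strict.
rewrite filter_predT big_map -[m in iota 0 m]subn0 -/(index_iota 0 m) big_mkord.
by apply: eq_bigr => l _; rewrite addrAC.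
Qed.

Let h : series rat := H_series w.
Let r : series rat := fps_rev h.
Let X : {poly rat} := \prod_(x <- addable_contents w) (1 - x%:~R *: 'X).
Let Y : {poly rat} := \prod_(y <- removable_contents w) (1 - y%:~R *: 'X).

Let lin0 (s : seq int) : (\prod_(x <- s) (1 - x%:~R *: 'X : {poly rat}))`_0 = 1.
Proof.
rewrite -horner_coef0 horner_prod big1 // => x _.
by rewrite !hornerE ?mulr0 ?oppr0 ?addr0.
Qed.

Let hE : h * series_poly X = series_poly ('X * Y).
Proof.
have XV : series_poly X * (fps_inv (fps_of_poly X) : series rat) = 1.
  apply: seriesP => n; rewrite -[LHS]/(fps_mul (fps_of_poly X) (fps_inv (fps_of_poly X)) n).
  by rewrite fps_mulV // /fps_of_poly lin0.
have -> : h = series_poly ('X * Y) * (fps_inv (fps_of_poly X) : series rat) by [].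
by rewrite -mulrA [X in _ * X]mulrC XV mulr1.
Qed.

Let h0 : h 0%N = 0.
Proof.
have := congr1 (@ev0 _) hE; rewrite rmorphM /= /ev0 /series_poly lin0 mulr1 => ->.
by rewrite coefXM.
Qed.

Let h1 : h 1%N = 1.
Proof.
have := congr1 (fun f : series rat => f 1%N) hE; rewrite seriesME 2!big_ord_recr big_ord0 /=.
by rewrite h0 /series_poly add0r mul0r add0r subnn lin0 mulr1 coefXM /= lin0.
Qed.

Let r0 : r 0%N = 0.
Proof. by rewrite /r /fps_rev /= coef0. Qed.

Let rX j n : (n < j)%N -> (r ^+ j) n = 0.
Proof.
have /agree0P[u ->] : agree 1 r 0 by case.
by move=> nj; rewrite expr1 exprMn seriesXnM nj.
Qed.

Let horner_h N : agree N.+1 (map_poly (@seriesC rat) (series_trunc h N)).[r] 't.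
Proof.
move=> n; rewrite ltnS => nN; rewrite seriesXE.
have h1n0 : h 1%N != 0 by rewrite h1 oner_eq0.
rewrite -(fps_comp_rev n h0 h1n0) /fps_comp -/r.
have wide k (p : {poly rat}) (B : nzRingType) (g : {rmorphism rat -> B}) :
    (size p <= k)%N -> (size (map_poly g p) <= k)%N.
  by move=> sp; rewrite (leq_trans (size_poly _ _)).
rewrite (@horner_coef_wide _ N.+1) ?wide ?size_poly // series_sumE.
rewrite /comp_poly (@horner_coef_wide _ n.+1) ?wide ?size_poly // coef_sum.
have powE j : ((fps_trunc r n) ^+ j)`_n = (r ^+ j) n.
  have ag : agree n.+1 (series_poly (fps_trunc r n)) r.
    by move=> i iN; rewrite /series_poly coef_poly iN.
  by rewrite -(agreeX j ag) // -rmorphXn.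
under [RHS]eq_bigr => j _ do rewrite coef_map coef_poly ltn_ord coefCM powE.
under [LHS]eq_bigr => j _ do rewrite coef_map coef_poly ltn_ord seriesCM.
rewrite -!(big_mkord predT (fun j => h j * (r ^+ j) n)) (@big_cat_nat _ _ _ n.+1) //=.
rewrite [X in _ + X]big_nat [X in _ + X]big1 ?addr0 // => j /andP[nj _].
by rewrite rX // mulr0.
Qed.

Let rE : 't * (map_poly (@seriesC rat) X).[r] = r * (map_poly (@seriesC rat) Y).[r].
Proof.
pose hC (p : {poly rat}) := (map_poly (@seriesC rat) p).[r].
have hCM p q : hC (p * q) = hC p * hC q by rewrite /hC rmorphM hornerM.
apply: seriesP => N.
pose D := series_trunc h N * X - 'X * Y.
have D0 j : (j <= N)%N -> D`_j = 0.
  move=> jN; rewrite coefB; apply/eqP; rewrite subr_eq0; apply/eqP.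
  rewrite -[RHS]/(series_poly ('X * Y) j) -hE; symmetry.
  by apply: series_mul_trunc => // i ij; rewrite coef_poly ltnS (leq_trans ij).
have DE : D = drop_poly N.+1 D * 'X^(N.+1).
  rewrite -[LHS](poly_take_drop N.+1) [X in X + _](_ : _ = 0) ?add0r //.
  by apply/polyP => j; rewrite coef_poly coef0; case: ltnP => // /D0.
have hCD : agree N.+1 (hC D) 0.
  rewrite DE hCM mulrC; apply: agree0M => j jN.
  by rewrite /hC map_polyXn hornerXn rX.
rewrite -(agreeM (@horner_h N) (@agree_refl _ N.+1 (hC X)) (ltnSn N)).
have -> : r * (map_poly (@seriesC rat) Y).[r] = hC ('X * Y).
  by rewrite hCM /hC map_polyX hornerX.
rewrite -hCM.
have := hCD N (ltnSn N); rewrite /D /hC rmorphB hornerD hornerN seriesDE seriesNE => /eqP.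
by rewrite subr_eq0 => /eqP.
Qed.

(** Composing the definition of H with its compositional inverse r gives an
    algebraic equation for r, and R is t / r. *)
Lemma free_cumulantE : is_cumulants (row_content rat) (free_cumulant w).
Proof.
pose r' : series rat := fun n => r n.+1.
pose R : series rat := free_cumulant w.
have rt : r = 't * r' by apply: seriesP => -[|n]; rewrite seriesXM ?r0.
have prodE (s : seq int) : (map_poly (@seriesC rat) (\prod_(x <- s) (1 - x%:~R *: 'X))).[r] =
    \prod_(x <- s) (1 - seriesC x%:~R * r).
  rewrite rmorph_prod horner_prod; apply: eq_bigr => x _ /=.
  by rewrite rmorphB rmorph1 /= map_polyZ map_polyX !hornerE.
have tI (f g : series rat) : 't * f = 't * g -> f = g.
  move=> fg; apply: seriesP => n.
  by have := congr1 (fun u : series rat => u n.+1) fg; rewrite !seriesXM.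
have E1 : \prod_(x <- addable_contents w) (1 - seriesC x%:~R * r) =
    r' * \prod_(y <- removable_contents w) (1 - seriesC y%:~R * r).
  by apply: tI; rewrite -prodE rE prodE rt mulrA.
have lin1 (s : seq int) : (\prod_(x <- s) (1 - seriesC x%:~R * r)) 0%N = 1.
  rewrite -[LHS]/(ev0 _) rmorph_prod big1 // => x _ /=.
  by rewrite /ev0 seriesDE seriesNE seriesCM r0 mulr0 subr0.
have r'0 : r' 0%N = 1.
  by have := congr1 (@ev0 _) E1; rewrite rmorphM /= /ev0 !lin1 mulr1.
have rR : r' * R = 1.
  apply: seriesP => n; rewrite -[LHS]/(fps_mul r' (fps_inv r') n) fps_mulV //.
  by rewrite r'0 oner_eq0.
have rRt : r * R = 't by rewrite rt -mulrA rR mulr1.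
split; first by have := congr1 (@ev0 _) rR; rewrite rmorphM /= /ev0 r'0 mul1r.
rewrite prod_addable prod_removable in E1.
have := congr1 (fun f => f * R ^+ m.+1) E1.
have RE a : (1 - seriesC a * r) * R = R - seriesC a * 't.
  by rewrite mulrBl mul1r -mulrA rRt.
have prR (f : 'I_m -> series rat) : (\prod_l f l) * R ^+ m = \prod_l (f l * R).
  by rewrite big_split /= prodr_const card_ord.
have cE (l : 'I_m) : ((part l)%:Z - l%:Z)%:~R = row_content rat l by rewrite rmorphB.
have cE1 (l : 'I_m) : ((part l)%:Z - l%:Z - 1)%:~R = row_content rat l - 1.
  by rewrite rmorphB /= cE.
rewrite exprS mulrACA RE prR => E2.
rewrite /cumulant_defect; apply/eqP; rewrite subr_eq0; apply/eqP.
transitivity ((R - seriesC (- m%:Z)%:~R * 't) *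
    \prod_(l < m) ((1 - seriesC ((part l)%:Z - l%:Z)%:~R * r) * R)).
  rewrite rmorphN rmorphN mulNr opprK; congr (_ * _); apply: eq_bigr => l _.
  by rewrite RE cE.
rewrite E2 mulrACA rR mul1r prR; apply: eq_bigr => l _.
by rewrite RE cE1.
Qed.

End DiagramCumulants.

(** * The value at a cycle as a coefficient of a series *)

Lemma mmap_intr_map (A B : comNzRingType) (phi : {rmorphism A -> B}) k
    (S : {mpoly int[k]}) (h : 'I_k -> A) :
  phi (mmap intr h S) = mmap intr (phi \o h) S.
Proof.
rewrite /mmap rmorph_sum; apply: eq_bigr => a _ /=.
rewrite rmorphM rmorph_int; congr (_ * _).
by rewrite /mmap1 rmorph_prod; apply: eq_bigr => j _; rewrite rmorphXn.
Qed.

(** The product of the series 't G(1 / 't - j) over -J <= j <= J, where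
    G(x) = (x + m) \prod (x - c l) / (x - c l + 1): almost all the factors of
    the numerators and of the denominators cancel. *)
Definition cycle_expansion (A : comUnitRingType) m (c : 'I_m -> A) J : series A :=
  \prod_(r < J.*2.+1) (1 - seriesC (r%:R - m%:R - J%:R) * 't) *
  \prod_l (1 - seriesC (c l + J%:R) * 't) /
  \prod_l (1 - seriesC (c l - J%:R - 1) * 't).

Lemma cycle_expansion_map (A B : comUnitRingType) (phi : {rmorphism A -> B}) m
    (c : 'I_m -> A) J :
  series_map phi (cycle_expansion c J) = cycle_expansion (phi \o c) J.
Proof.
have lin a : series_map phi (1 - seriesC a * 't) = 1 - seriesC (phi a) * 't.
  by rewrite rmorphB rmorph1 rmorphM /= series_mapC series_mapX.
rewrite /cycle_expansion !rmorphM rmorphV ?series_prod_lin_unit // !rmorph_prod /=.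
congr (_ * _ / _); apply: eq_bigr => l _; rewrite lin.
- by rewrite !rmorphB !rmorph_nat.
- by rewrite rmorphD rmorph_nat.
- by rewrite !rmorphB rmorph_nat rmorph1.
Qed.

(** Frobenius's formula is a sum of residues, hence a residue at infinity. The
    latter is invariant under translation, which allows a window of translations
    symmetric around 0. *)
Lemma frobenius_residue (F : fieldType) m (lam : 'I_m -> F) J (k := J.*2.+1)
    (c := fun l => lam l - m.-1%:R) : (0 < m)%N -> injective lam ->
  k%:R * (\sum_l falling k (lam l) *
     \prod_(j | j != l) ((lam l - k%:R - lam j) / (lam l - lam j))) =
  - cycle_expansion c J k.+1.
Proof.
case: m lam @c => [//|m] lam c _ lamI.
pose mu l := c l - J%:R - 1.
have muB i j : mu i - mu j = lam i - lam j by rewrite /mu /c; ring.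
have muI : injective mu.
  by move=> i j /eqP; rewrite -subr_eq0 muB subr_eq0 => /eqP/lamI.
pose s := [seq ((nat_of_ord r)%:R - m.+1%:R - J%:R : F) | r <- enum 'I_k] ++
          [seq c l + J%:R | l <- enum 'I_m.+1].
pose N : {poly F} := \prod_(a <- s) ('X - a%:P).
have ss : size s = (m.+1 + k)%N.
  by rewrite size_cat !size_map -!enumT !size_enum_ord addnC.
have sN : (size N <= (m.+1 + k).+1)%N by rewrite size_prod_XsubC ss.
have := residue_sum muI sN.
have -> : binform (m.+1 + k) N 1 't = \prod_(a <- s) (1 - seriesC a * 't).
  rewrite -ss -[N]mulr1 -[size s]addn0 form_prod ?size_poly1 //.
  by rewrite form1 mulr1.
rewrite {1}/s big_cat /= !big_map -!enumT !big_enum /= -/(cycle_expansion c J) => <-.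
rewrite -sumrN mulr_sumr; apply: eq_bigr => l _.
under [in RHS]eq_bigr => j _ do rewrite muB.
rewrite prodf_div; set D := \prod_(j | _) _.
suff -> : N.[mu l] = - (k%:R * (falling k (lam l) * \prod_(j | j != l) (lam l - k%:R - lam j))).
  by rewrite mulNr opprK !mulrA.
rewrite horner_prod big_cat /= !big_map -!enumT !big_enum /=.
have -> : \prod_(i < k) ('X - (i%:R - m.+1%:R - J%:R)%:P).[mu l] = falling k (lam l).
  apply: eq_bigr => i _; rewrite hornerXsubC /mu /c /= -addn1 natrD; ring.
rewrite (bigD1 l) //=.
have kE : k%:R = J%:R + J%:R + 1 :> F by rewrite -natrD addnn natr1.
have -> : \prod_(i < m.+1 | i != l) ('X - (c i + J%:R)%:P).[mu l] =
    \prod_(j | j != l) (lam l - k%:R - lam j).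
  by apply: eq_bigr => i _; rewrite hornerXsubC /mu /c kE; ring.
rewrite hornerXsubC.
have -> : mu l - (c l + J%:R) = - k%:R by rewrite /mu kE; ring.
by rewrite mulNr mulrN; congr (- _); rewrite mulrCA.
Qed.

(** * From partitions to arbitrary complex contents *)

Section Kerov.
Variables (J : nat) (k : nat).
Hypothesis kE : k = J.*2.+1.
Variable Sigma : {mpoly int[k]}.
Hypothesis kerov : is_kerov_polynomial Sigma.

Definition kerov_value (A : comNzRingType) (R : series A) : A :=
  mmap intr (fun j : 'I_k => R (j + 2)%N) Sigma.

Lemma kerov_value_map (A B : comNzRingType) (phi : {rmorphism A -> B}) R :
  phi (kerov_value R) = kerov_value (series_map phi R).
Proof. exact: mmap_intr_map. Qed.

(* The universal formula for Sigma, at the cumulants of the contents c. *)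
Definition kerov_identity (A : comUnitRingType) m (c : 'I_m -> A) :=
  exists2 R, is_cumulants c R & k%:R * kerov_value R + cycle_expansion c J k.+1 = 0.

Section IntegerPoint.
Variables (m : nat) (u : nat -> nat).
Hypothesis u_desc : forall i, (i.+1 < m)%N -> (u i.+1 < u i)%N.
Hypothesis u_big : forall i, (i < m)%N -> (k <= u i)%N.
Hypothesis m_gt0 : (0 < m)%N.

Let w := [seq u i | i <- iota 0 m].

Let sw : size w = m. Proof. by rewrite size_map size_iota. Qed.

Let nth_w i : (i < m)%N -> nth 0%N w i = u i.
Proof. by move=> im; rewrite (nth_map 0%N) ?size_iota // nth_iota. Qed.

Let k_gt0 : (0 < k)%N. Proof. by rewrite kE. Qed.

Let w_strict i : (i < size w)%N -> (nth 0%N w i.+1 < nth 0%N w i)%N.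
Proof.
rewrite sw => im; rewrite (nth_w im); case: (ltnP i.+1 m) => [im1|mi].
  by rewrite nth_w // u_desc.
by rewrite nth_default ?sw // (leq_trans k_gt0) ?u_big.
Qed.

Let w_partition : is_partition_of (sumn w) w.
Proof.
apply/and3P; split=> //; last first.
  apply/mapP => -[i]; rewrite mem_iota /= add0n => im E.
  by have := u_big im; rewrite -E leqNgt k_gt0.
rewrite /w sorted_map; apply/(sortedP 0%N) => i; rewrite size_iota => im.
by rewrite /= !nth_iota ?(ltnW im) // !add0n ltnW // u_desc.
Qed.

Lemma kerov_identity_integer : kerov_identity (fun l : 'I_m => (u l)%:R - l%:R : algC).
Proof.
have sum_ge : (k <= sumn w)%N.
  by rewrite /w -(prednK m_gt0) /= (leq_trans (u_big m_gt0)) // leq_addr.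
have := w_partition; rewrite -(subnKC sum_ge); set r := (_ - k)%N => wn.
have [ch chw] := indexed_character_exists (k + r) w.
have type : has_cycle_type (k_cycle k r) (k :: nseq (k + r - k) 1%N) by exact: k_cycle_type.
have := kerov (leq_addr r k) wn chw type.
rewrite (character_k_cycle k_gt0 wn chw).
have cR := is_cumulants_map (@ratr algC) (free_cumulantE w_strict).
set R := series_map _ _ in cR.
have -> : ratr (mmap intr (fun j : 'I_k => free_cumulant w (j + 2)) Sigma) = kerov_value R.
  exact: mmap_intr_map.
have lamI : injective (fun l => (@beta w l)%:R : algC).
  by move=> i j /eqP; rewrite eqr_nat => /eqP/(beta_inj wn).
have w_gt0 : (0 < size w)%N by rewrite sw.
have := frobenius_residue J w_gt0 lamI; rewrite -kE => E Sv; rewrite Sv in E.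
have lm (l : 'I_(size w)) : (l < m)%N by have := ltn_ord l; rewrite {2}sw.
have cE l : (@beta w l)%:R - (size w).-1%:R = (u l)%:R - l%:R :> algC.
  by rewrite /beta /staircase nth_w // natrD natrB -1?ltnS ?prednK //; ring.
suff: kerov_identity (fun l : 'I_(size w) => (u l)%:R - l%:R : algC).
  by case: _ / sw.
exists R.
  have <- : ratr \o @row_content w rat = (fun l : 'I_(size w) => (u l)%:R - l%:R : algC).
    by apply: funext => l; rewrite /= /row_content rmorphB !rmorph_nat nth_w ?lm.
  exact: cR.
rewrite E (_ : (fun l => _) = (fun l : 'I_(size w) => (u l)%:R - l%:R : algC)) ?addNr //.
by apply: funext => l; rewrite cE.
Qed.

End IntegerPoint.

(** The two sides at the contents with the l-th one replaced by an indeterminate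
    specialise to those at any value of that content, since the cumulants are
    natural in the ring; so it is enough to have infinitely many values. *)
Lemma kerov_identity_poly m (c : 'I_m -> algC) l (N : nat) (a : algC) :
    (forall x : nat, (N <= x)%N ->
       kerov_identity (fun i => if i == l then x%:R - a else c i)) ->
  kerov_identity c.
Proof.
move=> H.
pose cX i : {poly algC} := if i == l then 'X else (c i)%:P.
have [R cR] := cumulants_exist cX.
pose p : {poly algC} := k%:R * kerov_value R + cycle_expansion cX J k.+1.
have ev x : horner_eval x \o cX = (fun i => if i == l then x else c i).
  by apply: funext => i; rewrite /cX /= /horner_eval; case: eqP; rewrite !hornerE.
have pE x : p.[x] = k%:R * kerov_value (series_map (horner_eval x) R) +
     cycle_expansion (fun i => if i == l then x else c i) J k.+1.
  rewrite -ev -cycle_expansion_map -kerov_value_map.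
  rewrite /p hornerD hornerM; congr (_ * _ + _).
  by rewrite -[LHS]/(horner_eval x _) rmorph_nat.
have cRx x : is_cumulants (fun i => if i == l then x else c i) (series_map (horner_eval x) R).
  by rewrite -ev; apply: is_cumulants_map.
have p0 : p = 0.
  apply/eqP; apply: contraT => nz.
  pose s := [seq (x%:R - a : algC) | x <- iota N (size p)].
  have : (size s < size p)%N.
    apply: max_poly_roots => //.
      apply/allP => _ /mapP[x xs ->]; move: xs; rewrite mem_iota => /andP[Nx _].
      rewrite rootE pE; have [R' cR' <-] := H x Nx.
      by rewrite (cumulants_unique (cRx _) cR').
    rewrite map_inj_uniq ?iota_uniq // => x y /addIr/eqP.
    by rewrite eqr_nat => /eqP.
  by rewrite size_map size_iota ltnn.
have cc : (fun i => if i == l then c l else c i) = c.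
  by apply: funext => i; case: eqP => [->|].
exists (series_map (horner_eval (c l)) R); first by have := cRx (c l); rewrite cc.
by have := pE (c l); rewrite p0 horner0 cc.
Qed.

(** Freeing the contents one row at a time, from the longest row on. *)
Lemma kerov_identity_complex m (c : 'I_m -> algC) : (0 < m)%N -> kerov_identity c.
Proof.
move=> m_gt0.
suff free j (v : nat -> nat) (d : 'I_m -> algC) : (j <= m)%N ->
    (forall i, (j <= i)%N -> (i.+1 < m)%N -> (v i.+1 < v i)%N) ->
    (forall i, (j <= i)%N -> (i < m)%N -> (k <= v i)%N) ->
    (forall i : 'I_m, (j <= i)%N -> d i = (v i)%:R - i%:R) -> kerov_identity d.
  apply: (free m (fun=> 0%N) c) => // i mi.
  - by move=> im; move: (leq_trans (ltnW im) mi); rewrite ltnn.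
  - by rewrite ltnNge mi.
  - by have := ltn_ord i; rewrite ltnNge mi.
elim: j v d => [|j IH] v d jm vd vb dE.
  rewrite (_ : d = fun l : 'I_m => (v l)%:R - l%:R).
    by apply: kerov_identity_integer => // i im; [apply: vd|apply: vb].
  by apply: funext => i; apply: dE.
apply: (@kerov_identity_poly _ _ (Ordinal jm) (k + v j.+1).+1 j%:R) => x xN.
apply: (IH (fun i => if i == j then x else v i)) => [|i ji im|i ji im|i ji].
- exact: ltnW.
- rewrite gtn_eqF ?ltnS //; case: eqP => [->|/eqP ij].
    by rewrite (leq_trans _ xN) // ltnS leq_addl.
  by apply: vd => //; rewrite ltn_neqAle eq_sym ij.
- case: eqP => [_|/eqP ij]; first by rewrite ltnW // (leq_trans _ xN) // ltnS leq_addr.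
  by apply: vb => //; rewrite ltn_neqAle eq_sym ij.
- rewrite -val_eqE /=; case: eqP => [->//|/eqP ij].
  by apply: dE; rewrite ltn_neqAle eq_sym ij.
Qed.

End Kerov.

(** * Contents whose only free cumulant is the second one *)

Section SpecialPoint.
Variables (m : nat) (T : algC).

Let rho : series algC := 1 + seriesC T * 't ^+ 2.

Let rho0 : rho 0%N = 1.
Proof. by rewrite /rho seriesDE seriesCM seriesXnE mulr0 addr0. Qed.

(* The defect of the cumulant equation, linear in the monic polynomial q whose
   roots are the contents. *)
Let defect (q : {poly algC}) : series algC :=
  (rho + seriesC m%:R * 't) * binform m q rho 't - binform m q (rho + 't) 't.

Let first_order s : agree 2 ((rho + seriesC m%:R * 't) * rho ^+ s - (rho + 't) ^+ s)
                            (seriesC (m%:R - s%:R) * 't).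
Proof.
have r1 : agree 2 rho 1.
  move=> j j2; rewrite /rho -[RHS]addr0 seriesDE; congr (_ + _).
  by rewrite mulrC seriesXnM j2.
have rs : agree 2 (rho ^+ s) 1 by rewrite -(expr1n _ s); apply: agreeX.
have t2 : agree 2 ('t * 't) (0 : series algC).
  by apply/agree0P; exists 1; rewrite mulr1 expr2.
have ts : agree 2 ((rho + 't) ^+ s) (1 + seriesC s%:R * 't).
  apply: (@agree_trans _ _ _ ((1 + 't) ^+ s)); first by apply: agreeX; apply: agreeD.
  elim: s {rs} => [|s IH]; first by rewrite expr0 rmorph0 mul0r addr0.
  rewrite exprSr; apply: (agree_trans (agreeM IH (@agree_refl _ 2 _))).
  have -> : (1 + seriesC s%:R * 't) * (1 + 't) =
     1 + seriesC (s.+1)%:R * 't + seriesC s%:R * ('t * 't) :> series algC.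
    by rewrite -natr1 rmorphD rmorph1; ring.
  rewrite -[X in agree 2 _ X]addr0; apply: agreeD => //.
  by rewrite mulrC; apply: agree0M.
have -> : seriesC (m%:R - s%:R) * 't =
   (1 + seriesC m%:R * 't) * 1 - (1 + seriesC s%:R * 't) :> series algC.
  by rewrite rmorphB; ring.
apply: agreeD; last exact: agreeN.
by apply: agreeM => //; apply: agreeD.
Qed.

Let binform_Xn s (x : series algC) : (s <= m)%N -> binform m 'X^s x 't = x ^+ s * 't ^+ (m - s).
Proof.
move=> sm; rewrite /binform (bigD1 (Ordinal (sm : (s < m.+1)%N))) //= coefXn eqxx rmorph1 mul1r.
rewrite big1 ?addr0 // => r /negPf rs; rewrite coefXn [_ == s]rs rmorph0 !mul0r.
by [].
Qed.

Let defect_solve n : (n <= m)%N ->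
  exists q : {poly algC}, [/\ q \is monic, size q = m.+1 & agree n.+2 (defect q) 0].
Proof.
elim: n => [_|n IH nm].
  exists 'X^m; split; rewrite ?monicXn ?size_polyXn //.
  rewrite /defect !binform_Xn // subnn !mulr1; apply: (agree_trans (first_order m)).
  by rewrite subrr rmorph0 mul0r.
have [q [qm sq D0]] := IH (ltnW nm).
pose s := (m - n.+1)%N; pose a := - (defect q n.+2 / n.+1%:R).
have sm : (s <= m)%N by exact: leq_subr.
have ltsm : (s < m)%N by rewrite /s; lia.
have dE : defect (q + a *: 'X^s) = defect q + 't ^+ n.+1 * (seriesC a *
    ((rho + seriesC m%:R * 't) * rho ^+ s - (rho + 't) ^+ s)).
  rewrite /defect !formD !formZ !binform_Xn // (_ : (m - s)%N = n.+1); last by rewrite subKn.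
  by move: (binform _ _ _ _) (binform _ _ (_ + _) _) => u v; ring.
have ltsz : (size (a *: 'X^s : {poly algC})%R < size q)%N.
  by rewrite (leq_ltn_trans (size_scale_leq _ _)) // size_polyXn sq ltnS.
exists (q + a *: 'X^s); split.
- by rewrite monicE lead_coefDl // -monicE.
- by rewrite size_polyDl.
move=> j; rewrite dE seriesDE seriesXnM ltnS leq_eqVlt => /orP[/eqP->|jn].
  rewrite ltnNge leqnSn /= subSn // subnn seriesCM first_order // seriesCM seriesXE mulr1.
  rewrite natrB // opprB addrCA subrr addr0 /a mulNr divfK ?subrr //.
  by rewrite pnatr_eq0.
rewrite D0 // add0r; case: ltnP => // nj.
have -> : (j - n.+1 = 0)%N by apply/eqP; rewrite subn_eq0.
by rewrite seriesCM first_order // seriesCM seriesXE !mulr0.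
Qed.

(** The coefficient of q of degree m - n - 1 first enters the defect in degree
    n + 2, where it is multiplied by n + 1; so q can be found one coefficient
    after another. *)
Lemma special_contents : exists c : 'I_m -> algC,
  agree m.+2 (cumulant_defect c (1 + seriesC T * 't ^+ 2)) 0.
Proof.
have [q [qm sq D0]] := defect_solve (leqnn m).
have [z zE] := closed_field_poly_normal q; rewrite (monicP qm) scale1r in zE.
have sz : size z = m by apply/eqP; rewrite -eqSS -sq zE size_prod_XsubC.
exists (fun l => z`_l).
have zP (f : algC -> series algC) : \prod_(x <- z) f x = \prod_(l < m) f z`_l.
  by rewrite (big_nth 0) sz big_mkord.
have bq x : binform m q x 't = \prod_(l < m) (x - seriesC z`_l * 't).
  rewrite -(zP (fun a => x - seriesC a * 't)).
  rewrite zE -[X in binform _ X]mulr1 -{1}sz -[size z]addn0 form_prod ?size_poly1 //.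
  by rewrite form1 mulr1.
suff <- : defect q = cumulant_defect (fun l : 'I_m => z`_l) (1 + seriesC T * 't ^+ 2) by [].
rewrite /defect !bq /cumulant_defect; congr (_ - _); apply: eq_bigr => l _.
by rewrite rmorphB rmorph1 /rho; ring.
Qed.

End SpecialPoint.

Section Quadratic.
Variables (A : comUnitRingType).

(** Because x has constant term 1, the N leading coefficients of E vanish. *)
Lemma binform_agree0 d N (E : {poly A}) (x y : series A) : x 0%N = 1 -> (N <= d.+1)%N ->
  agree N (binform d E x 't) 0 -> agree N (binform d E y 't) 0.
Proof.
move=> x0 Nd H.
have xs s : (x ^+ s) 0%N = 1 by rewrite -[LHS]/(ev0 _) rmorphXn /= /ev0 x0 expr1n.
have term (z : series A) s j : (seriesC E`_s * z ^+ s * 't ^+ (d - s)) j =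
    if (j < d - s)%N then 0 else E`_s * (z ^+ s) (j - (d - s))%N.
  rewrite -mulrA seriesCM (mulrC (z ^+ s)) seriesXnM.
  by case: ifP => // _; rewrite mulr0.
have E0 r : (r < N)%N -> E`_(d - r) = 0.
  elim/ltn_ind: r => r IH rN; have := H r rN.
  have rd : (r <= d)%N by rewrite -ltnS (leq_trans rN).
  have dr : (d - r < d.+1)%N by rewrite ltnS leq_subr.
  rewrite /binform series_sumE (bigD1 (Ordinal dr)) //= term subKn // ltnn subnn xs mulr1.
  rewrite big1 ?addr0 // => s sr; rewrite term; case: ltnP => // srd.
  have sd : (s <= d)%N by rewrite -ltnS ltn_ord.
  have -> : E`_s = 0.
    rewrite -(subKn sd) IH //; last by rewrite (leq_ltn_trans srd).
    rewrite ltn_neqAle srd andbT; apply: contraNneq sr => rs.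
    by rewrite -val_eqE /= -rs subKn.
  by rewrite mul0r.
move=> j jN; rewrite /binform series_sumE big1 // => s _; rewrite term.
case: ltnP => // sj; have sd : (s <= d)%N by rewrite -ltnS ltn_ord.
have -> : E`_s = 0 by rewrite -(subKn sd) E0 // (leq_ltn_trans sj).
by rewrite mul0r.
Qed.

(* The series 't G(1 / 't - a), where G(x) is the quotient of
   (x + m) \prod (x - c l) by \prod (x - c l + 1). *)
Definition gamma m (c : 'I_m -> A) a : series A :=
  (1 - seriesC (a - m%:R) * 't) * \prod_l (1 - seriesC (c l + a) * 't) /
    \prod_l (1 - seriesC (c l + a - 1) * 't).

Lemma gamma0 m (c : 'I_m -> A) a : gamma c a 0%N = 1.
Proof.
rewrite /gamma !series_M0 series_lin0 ev0V ?series_prod_lin_unit //.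
by rewrite !series_prod_lin0 invr1 !mulr1.
Qed.

Lemma cycle_expansion_gamma m (c : 'I_m -> A) J :
  cycle_expansion c J = \prod_(r < J.*2.+1) gamma c (r%:R - J%:R).
Proof.
pose b r := \prod_l (1 - seriesC (c l + r%:R - J%:R - 1) * 't).
have ub r : b r \is a GRing.unit by exact: series_prod_lin_unit.
have gE r : gamma c (r%:R - J%:R) = (1 - seriesC (r%:R - m%:R - J%:R) * 't) * (b r.+1 / b r).
  have -> : b r.+1 = \prod_l (1 - seriesC (c l + (r%:R - J%:R)) * 't).
    by apply: eq_bigr => l _; congr (1 - seriesC _ * _); rewrite -natr1; ring.
  have -> : b r = \prod_l (1 - seriesC (c l + (r%:R - J%:R) - 1) * 't).
    by apply: eq_bigr => l _; congr (1 - seriesC _ * _); ring.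
  have -> : r%:R - m%:R - J%:R = r%:R - J%:R - m%:R :> A by ring.
  by rewrite mulrA.
have tele n : \prod_(r < n) (b r.+1 / b r) = b n / b 0%N.
  elim: n => [|n IH]; first by rewrite big_ord0 divrr.
  by rewrite big_ord_recr IH /= mulrC mulrA divrK.
under [RHS]eq_bigr => r _ do rewrite gE.
rewrite big_split /= tele /cycle_expansion -mulrA.
have -> : b J.*2.+1 = \prod_l (1 - seriesC (c l + J%:R) * 't).
  apply: eq_bigr => l _; congr (1 - seriesC _ * _).
  by rewrite -natr1 -addnn natrD; ring.
have -> // : b 0%N = \prod_l (1 - seriesC (c l - J%:R - 1) * 't).
by apply: eq_bigr => l _; rewrite addr0.
Qed.

(** Write G = u / v, with u and v as in gamma, and let E = u^2 - x u v + T v^2.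
    On the curve x = 1 / z + T z it factors as (u - v / z) (u - T z v), where the
    first factor is the defect. So E has low degree, and it keeps it after any
    translation of x. *)
Lemma gamma_quadratic m (c : 'I_m -> A) T a :
    agree m.+2 (cumulant_defect c (1 + seriesC T * 't ^+ 2)) 0 ->
  agree m.+2 (gamma c a ^+ 2 - (1 - seriesC a * 't) * gamma c a + seriesC T * 't ^+ 2) 0.
Proof.
set rho := 1 + _ => D0.
pose u : {poly A} := \prod_(x <- - m%:R :: [seq c l | l <- enum 'I_m]) ('X - x%:P).
pose v : {poly A} := \prod_(x <- [seq c l - 1 | l <- enum 'I_m]) ('X - x%:P).
pose U x := (x - seriesC (- m%:R) * 't) * \prod_l (x - seriesC (c l) * 't) : series A.
pose V x := \prod_l (x - seriesC (c l - 1) * 't) : series A.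
pose E := u * u - 'X * (u * v) + T *: (v * v).
have su : size u = m.+2 by rewrite size_prod_XsubC /= size_map size_enum_ord.
have sv : size v = m.+1 by rewrite size_prod_XsubC size_map size_enum_ord.
have uE d (p : {poly A}) x : (size p <= d.+1)%N -> binform (m.+1 + d) (u * p) x 't = U x * binform d p x 't.
  move=> sp; rewrite (_ : m.+1 = size (- m%:R :: [seq c l | l <- enum 'I_m])).
    by rewrite form_prod // big_cons big_map big_enum.
  by rewrite /= size_map size_enum_ord.
have vE d (p : {poly A}) x : (size p <= d.+1)%N -> binform (m + d) (v * p) x 't = V x * binform d p x 't.
  move=> sp; rewrite {1}(_ : m = size [seq c l - 1 | l <- enum 'I_m]).
    by rewrite form_prod // big_map big_enum.
  by rewrite size_map size_enum_ord.
have u1 x : binform m.+1 u x 't = U x.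
  by rewrite -[u]mulr1 -[m.+1]addn0 uE ?size_poly1 // form1 mulr1.
have v1 x : binform m v x 't = V x.
  by rewrite -[v]mulr1 -[m in binform m]addn0 vE ?size_poly1 // form1 mulr1.
have EE x : binform (m.+1 + m.+1) E x 't =
    U x ^+ 2 - x * (U x * V x) + seriesC T * 't ^+ 2 * V x ^+ 2.
  rewrite /E !formD formN formZ uE ?su // u1 -[in binform _ ('X * _)](addSnnS m.+1 m).
  rewrite form_XM; last first.
    by rewrite (leq_trans (size_polyMleq _ _)) // su sv addnS.
  rewrite uE ?sv // v1.
  have -> : (m.+1 + m.+1 = (m + m) + 2)%N by rewrite addn2 addSn addnS.
  rewrite form_shift; last by rewrite (leq_trans (size_polyMleq _ _)) // sv addnS.
  by rewrite vE ?sv // v1; ring.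
have : agree m.+2 (binform (m.+1 + m.+1) E rho 't) 0.
  have -> : binform (m.+1 + m.+1) E rho 't =
      (U rho - V rho) * (U rho - seriesC T * 't ^+ 2 * V rho).
    by rewrite EE /rho; ring.
  apply: agree0M; suff -> : U rho - V rho = cumulant_defect c rho by [].
  by rewrite /U /V /cumulant_defect rmorphN mulNr opprK.
have rho0 : rho 0%N = 1 by rewrite /rho seriesDE seriesCM seriesXnE mulr0 addr0.
have Nd : (m.+2 <= (m.+1 + m.+1).+1)%N by lia.
move=> /(binform_agree0 (1 - seriesC a * 't) rho0 Nd); rewrite EE => H.
have VE : V (1 - seriesC a * 't) = \prod_l (1 - seriesC (c l + a - 1) * 't).
  by apply: eq_bigr => l _; rewrite !rmorphB rmorphD rmorph1; ring.
have UE : U (1 - seriesC a * 't) =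
    (1 - seriesC (a - m%:R) * 't) * \prod_l (1 - seriesC (c l + a) * 't).
  have -> : 1 - seriesC (a - m%:R) * 't = 1 - seriesC a * 't - seriesC (- m%:R) * 't :> series A.
    by rewrite rmorphB rmorphN; ring.
  suff -> : \prod_l (1 - seriesC (c l + a) * 't) =
     \prod_l (1 - seriesC a * 't - seriesC (c l) * 't) by [].
  by apply: eq_bigr => l _; rewrite rmorphD; ring.
have xE : U (1 - seriesC a * 't) / V (1 - seriesC a * 't) = gamma c a by rewrite UE VE.
have uV : V (1 - seriesC a * 't) \is a GRing.unit by rewrite VE series_prod_lin_unit.
apply: (@agree_div _ _ _ _ (V (1 - seriesC a * 't) ^+ 2)); first exact: unitrX.
rewrite mul0r; have := H; rewrite -xE.
set x := 1 - _ in uV *; have -> : U x = U x / V x * V x by rewrite divrK.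
rewrite mulrK //; set g := U x / V x; move=> {}H.
have -> : (g ^+ 2 - x * g + seriesC T * 't ^+ 2) * V x ^+ 2 =
   (g * V x) ^+ 2 - x * (g * V x * V x) + seriesC T * 't ^+ 2 * V x ^+ 2 by ring.
exact: H.
Qed.

End Quadratic.

(** * Lagrange inversion for s = p / (1 + p)^2 *)

Section Lagrange.
Variable A : comUnitRingType.

Lemma unit_1Dt : (1 + 't : series A) \is a GRing.unit.
Proof. by rewrite series_unit1 // seriesDE seriesXE addr0. Qed.

Lemma unit_1Bt : (1 - 't : series A) \is a GRing.unit.
Proof. by rewrite series_unit1 // seriesDE seriesNE seriesXE subr0. Qed.

Lemma coef_1Dt_exp N n : ((1 + 't : series A) ^+ N) n = ('C(N, n))%:R.
Proof.
rewrite exprDn series_sumE.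
transitivity (\sum_(j < N.+1) (if j == n :> nat then 'C(N, j)%:R else 0 : A)).
  apply: eq_bigr => j _; rewrite expr1n mul1r -mulr_natl -(rmorph_nat (@seriesC A)).
  by rewrite seriesCM seriesXnE eq_sym; case: eqP; rewrite ?mulr1 ?mulr0.
case: (leqP n N) => [nN|Nn].
  by rewrite -big_mkcond (big_pred1 (Ordinal (nN : (n < N.+1)%N))).
rewrite big1 ?bin_small // => j _; case: eqP => // jn.
by have := ltn_ord j; rewrite jn ltnS leqNgt Nn.
Qed.

(** The central binomial coefficient kills all the lower powers of s. *)
Lemma lagrange_power i b : (0 < i)%N ->
  ((1 - 't) * (1 + 't) ^+ (2 * i - 1) * ('t / (1 + 't) ^+ 2) ^+ b : series A) i =
    (b == i)%:R.
Proof.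
move=> i_gt0; rewrite exprMn mulrCA seriesXnM.
have [ib|bi] := ltnP i b; first by rewrite gtn_eqF.
set v := 1 + 't; have uv : v \is a GRing.unit by exact: unit_1Dt.
have [<-|bni] := eqVneq b i.
  have e1 : ev0 (1 - 't : series A) = 1 by rewrite /ev0 seriesDE seriesNE seriesXE subr0.
  have e0 : ev0 v = 1 by rewrite /ev0 /v seriesDE seriesXE addr0.
  rewrite subnn -[LHS]/(ev0 _) !rmorphM rmorphXn [X in _ * X]rmorphXn.
  by rewrite rmorphV ?unitrX // rmorphXn /= e0 e1 !(expr1n, invr1, mulr1).
have {bni}bi : (b < i)%N by rewrite ltn_neqAle bni.
pose n := (i - b)%N; have n_gt0 : (0 < n)%N by rewrite subn_gt0.
have -> : (1 - 't) * v ^+ (2 * i - 1) * (v ^+ 2)^-1 ^+ b = (1 - 't) * v ^+ (2 * n - 1).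
  rewrite -mulrA exprVn -exprM; congr (_ * _).
  have -> : (2 * i - 1 = (2 * n - 1) + 2 * b)%N by rewrite /n; lia.
  by rewrite exprD mulrK // unitrX.
rewrite -/n mulrBl mul1r seriesDE seriesNE seriesXM coef_1Dt_exp.
case: n n_gt0 => // n _; rewrite coef_1Dt_exp.
rewrite -bin_sub; last lia.
have -> : (2 * n.+1 - 1 - n.+1 = n)%N by lia.
by rewrite subrr.
Qed.

Lemma lagrange_coef (q : {poly A}) i : (0 < i)%N ->
  q`_i = ((1 - 't) * (1 + 't) ^+ (2 * i - 1) *
            (map_poly (@seriesC A) q).['t / (1 + 't) ^+ 2]) i.
Proof.
move=> i_gt0; rewrite (@horner_coef_wide _ (size q + i.+1)); last first.
  by rewrite (leq_trans (size_poly _ _)) // leq_addr.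
rewrite mulr_sumr series_sumE.
under eq_bigr => b _.
  rewrite coef_map mulrCA seriesCM lagrange_power // mulr_natr mulrb.
  over.
rewrite -big_mkcond (big_pred1 (Ordinal (ltn_addl (size q) (ltnSn i)))) //.
Qed.

Lemma coef_geo_exp b n : ((1 - 't : series A)^-1 ^+ b.+1) n = 'C(n + b, b)%:R.
Proof.
have gE : (1 - 't : series A)^-1 = geo 1.
  by have g := geoK (1 : A); rewrite rmorph1 mul1r in g; rewrite -[RHS](mulKr unit_1Bt) g mulr1.
elim: b n => [|b IH] n.
  by rewrite expr1 gE /geo expr1n bin0.
rewrite exprSr seriesME.
under eq_bigr => j _ do rewrite IH gE /geo expr1n mulr1.
rewrite -natr_sum; congr _%:R.
elim: n => [|n IHn]; first by rewrite big_ord1 !add0n !binn.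
by rewrite big_ord_recr /= IHn !addSn !addnS [RHS]binS.
Qed.

End Lagrange.

Section NumericCoefficients.
Variable K : fieldType.

(* For i < c both sides are 0; for c <= b the product then has a zero factor. *)
Lemma coef_geo_shift b c i : (c <= b)%N ->
  ('t ^+ c * (1 - 't : series K)^-1 ^+ b.+1) i * (b`!)%:R = \prod_(l < b) (i%:R - c%:R + l.+1%:R).
Proof.
move=> cb; rewrite seriesXnM; case: ltnP => [ic|ci].
  rewrite mul0r; symmetry; apply/eqP/prodf_eq0.
  have lb : (c - i.+1 < b)%N by lia.
  exists (Ordinal lb) => //=; rewrite -subSn // subSS natrB ?(ltnW ic) //.
  by rewrite addrC addrA subrK subrr.
rewrite coef_geo_exp -natrM bin_ffact -natrB //.
move: (i - c)%N => n; elim: b {cb} => [|b IH]; first by rewrite big_ord0.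
by rewrite addnS ffactSS natrM IH big_ord_recr /= mulrC -natrD addnS.
Qed.

End NumericCoefficients.

(** * The coefficient of a power of the second cumulant *)

Section QuadraticRoot.
Variables (A : comUnitRingType) (a b : series A).
Hypotheses (a0 : a 0%N = 1) (b0 : b 0%N = 0).

Let quad : {poly series A} := 'X ^+ 2 - a%:P * 'X + b%:P.

Let quadE x : quad.[x] = x ^+ 2 - a * x + b.
Proof. by rewrite /quad !hornerE. Qed.

Let quad_root : quad.[1] 0%N = 0.
Proof. by rewrite quadE !seriesDE seriesNE expr1n mulr1 a0 b0 series1E subrr addr0. Qed.

Let quad_simple : (quad^`()).[1] 0%N = 1.
Proof.
have -> : quad^`() = 'X *+ 2 - a%:P.
  by rewrite /quad derivD derivB derivXn derivM derivX !derivC mul0r add0r mulr1 addr0.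
by rewrite hornerD hornerN hornerMn hornerX hornerC mulr2n !seriesDE seriesNE a0 series1E addrK.
Qed.

Lemma quadratic_root : exists2 x : series A, x 0%N = 1 & x ^+ 2 - a * x + b = 0.
Proof.
by have [x x0 xE] := hensel_exists quad_root quad_simple; exists x; rewrite -?quadE.
Qed.

Lemma quadratic_unique n (x y : series A) : x 0%N = 1 -> y 0%N = 1 ->
  agree n (x ^+ 2 - a * x + b) 0 -> agree n (y ^+ 2 - a * y + b) 0 -> agree n x y.
Proof.
move=> x0 y0 Ex Ey; apply: (hensel_unique quad_simple) => //.
by rewrite !quadE; apply: (agree_trans Ex); apply: agree_sym.
Qed.

End QuadraticRoot.

Section Catalan.

Let catalan_exists : exists2 x : series algC, x 0%N = 1 & x ^+ 2 - 1 * x + 't = 0.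
Proof. by apply: quadratic_root; rewrite ?seriesXE. Qed.

(* The series 1 - s - s ^+ 2 - 2 s ^+ 3 - 5 s ^+ 4 - ... of Catalan numbers. *)
Definition catalan : series algC := s2val (cid2 catalan_exists).

Lemma catalan0 : catalan 0%N = 1.
Proof. by rewrite /catalan; case: cid2. Qed.

Lemma catalanE : catalan ^+ 2 - catalan + 't = 0.
Proof. by rewrite /catalan; case: cid2 => x /= _; rewrite mul1r. Qed.

Definition catalan_poly N : {poly algC} := series_trunc catalan N.

Lemma catalan_poly_quadratic (B : comNzRingType) (g : {rmorphism algC -> B}) N z :
  let h := (map_poly g (catalan_poly N)).[z] in
  exists q, h ^+ 2 - h + z = z ^+ N.+1 * q.
Proof.
pose p := catalan_poly N; pose D := p * p - p + 'X.
have D0 j : (j <= N)%N -> D`_j = 0.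
  move=> jN; have := congr1 (fun f : series algC => f j) catalanE; rewrite !seriesDE seriesNE.
  have pE i : (i <= j)%N -> p`_i = catalan i.
    by move=> ij; rewrite coef_poly ltnS (leq_trans ij).
  rewrite coefD coefB pE // coefX seriesXE expr2.
  by have -> : (catalan * catalan) j = (p * p)`_j by exact: series_mul_trunc.
have DE : D = drop_poly N.+1 D * 'X^(N.+1).
  rewrite -[LHS](poly_take_drop N.+1) [X in X + _](_ : _ = 0) ?add0r //.
  by apply/polyP => j; rewrite coef_poly coef0; case: ltnP => // /D0.
exists (map_poly g (drop_poly N.+1 D)).[z].
transitivity (map_poly g D).[z].
  by rewrite /D rmorphD rmorphB rmorphM /= map_polyX !hornerE -/p.
by rewrite {1}DE rmorphM /= map_polyXn hornerM hornerXn mulrC.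
Qed.

Lemma catalan_poly_const (B : comNzRingType) (g : {rmorphism algC -> B}) N z :
  exists q, (map_poly g (catalan_poly N)).[z] = 1 + z * q.
Proof.
exists (map_poly g (drop_poly 1 (catalan_poly N))).[z].
rewrite -{1}(poly_take_drop 1 (catalan_poly N)) rmorphD rmorphM /= map_polyX.
rewrite !hornerE [X in _ = _ + X]mulrC; congr (_ + _).
have -> : take_poly 1 (catalan_poly N) = 1%:P.
  by apply/polyP => -[|j]; rewrite coef_poly coefC //= coef_poly catalan0.
by rewrite map_polyC hornerC /= rmorph1.
Qed.

Variable N : nat.

(** A polynomial in s that approximates the root of X^2 - (1 - a t) X + s. *)
Definition theta (a : algC) : {poly series algC} :=
  let e := 1 - seriesC a * 't in
  e *: (map_poly (@seriesC algC) (catalan_poly N) \Po (e^-1 ^+ 2 *: 'X)).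

Let e_unit a : (1 - seriesC a * 't : series algC) \is a GRing.unit.
Proof. by rewrite series_unit1 // series_lin0. Qed.

Let theta_horner (B : comNzRingType) (g : {rmorphism series algC -> B}) a y :
  let e := 1 - seriesC a * 't in
  (map_poly g (theta a)).[y] =
     g e * (map_poly (g \o @seriesC algC) (catalan_poly N)).[g (e^-1 ^+ 2) * y].
Proof.
rewrite /theta /= map_polyZ hornerZ map_comp_poly horner_comp map_polyZ map_polyX.
by rewrite hornerZ hornerX -map_poly_comp.
Qed.

Lemma theta_quadratic (B : comNzRingType) (g : {rmorphism series algC -> B}) a y :
  let x := (map_poly g (theta a)).[y] in
  exists q, x ^+ 2 - g (1 - seriesC a * 't) * x + y = y ^+ N.+1 * q.
Proof.
rewrite /= theta_horner; set e := 1 - _; set z := g _ * y.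
have [q] := catalan_poly_quadratic (g \o @seriesC algC) N z; set h := _.[z] => hE.
have ge : g (e ^+ 2) * g (e^-1 ^+ 2) = 1.
  by rewrite -rmorphM -exprMn divrr ?e_unit // expr1n rmorph1.
exists (g (e ^+ 2) * g (e^-1 ^+ 2) ^+ N.+1 * q).
have yE : g (e ^+ 2) * z = y by rewrite mulrA ge mul1r.
transitivity (g (e ^+ 2) * (h ^+ 2 - h + z)).
  by rewrite mulrDr yE rmorphXn; ring.
by rewrite hE [z ^+ _]exprMn; ring.
Qed.

Lemma theta_const (B : comNzRingType) (g : {rmorphism series algC -> B}) a y :
  exists q, (map_poly g (theta a)).[y] = g (1 - seriesC a * 't) + y * q.
Proof.
rewrite theta_horner; set e := 1 - _; set z := g _ * y.
have [q ->] := catalan_poly_const (g \o @seriesC algC) N z.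
by exists (g e * g (e^-1 ^+ 2) * q); rewrite /z; ring.
Qed.

End Catalan.

Section SecondCumulant.
Variables (J k : nat).
Hypothesis kE : k = J.*2.+1.
Variable Sigma : {mpoly int[k]}.
Hypothesis kerov : is_kerov_polynomial Sigma.

Definition theta_prod : {poly series algC} :=
  \prod_(r < J.*2.+1) theta k.+1 (r%:R - J%:R).

Let k_gt0 : (0 < k)%N. Proof. by rewrite kE. Qed.

(** At the special contents the factors of the expansion are approximated by the
    roots of a quadratic equation in which T occurs only through T t^2. *)
Lemma kerov_value_special (T : algC) (s := seriesC T * 't ^+ 2) :
  k%:R * kerov_value Sigma (1 + s) + theta_prod.[s] k.+1 = 0.
Proof.
have [c D0] := special_contents k T.
have [R cR] := kerov_identity_complex kE kerov c k_gt0.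
have s0 : s 0%N = 0 by rewrite /s seriesCM seriesXnE mulr0.
have RE : agree k.+2 (1 + s) R.
  by apply: (cumulants_agree cR) => //; rewrite seriesDE s0 addr0.
have -> : kerov_value Sigma R = kerov_value Sigma (1 + s).
  rewrite /kerov_value; congr (mmap _ _ _); apply: funext => j.
  by rewrite RE // addn2 !ltnS.
rewrite cycle_expansion_gamma => E; rewrite -[RHS]E; congr (_ + _); symmetry.
apply: (@agree_trans _ k.+2 _ _ _ _ (@agree_refl _ _ _)) => //.
rewrite horner_prod; apply: agree_prod => r _.
have [q qE] := theta_quadratic k.+1 (idfun : {rmorphism series algC -> series algC}) (r%:R - J%:R) s.
have [q' q'E] := theta_const k.+1 (idfun : {rmorphism series algC -> series algC}) (r%:R - J%:R) s.
rewrite map_poly_id //= in qE q'E.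
apply: (@quadratic_unique _ (1 - seriesC (r%:R - J%:R) * 't) s) => //.
- exact: series_lin0.
- exact: gamma0.
- by rewrite q'E seriesDE series_lin0 series_M0 s0 mul0r addr0.
- exact: gamma_quadratic.
rewrite qE /s; apply/agree0P; exists (seriesC T ^+ k.+2 * 't ^+ k.+2 * q).
rewrite exprMn -exprM mul2n -addnn exprD.
by move: (seriesC T ^+ k.+2) ('t ^+ k.+2) => x y; ring.
Qed.

(** Both terms of kerov_value_special are polynomials in T. *)
Lemma kerov_coefficient i : (2 * i <= k.+1)%N ->
  k%:R * (Sigma@_(mnm_R2 k i))%:~R + (theta_prod`_i) (k.+1 - 2 * i)%N = 0.
Proof.
move=> ik.
pose kv : {poly algC} := kerov_value Sigma (1 + seriesC 'X * 't ^+ 2).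
pose th : {poly algC} := \poly_(b < size theta_prod)
   (if (k.+1 < 2 * b)%N then 0 else (theta_prod`_b) (k.+1 - 2 * b)%N).
have P0 : k%:R *: kv + th = 0.
  apply/eqP; apply: contraT => nz.
  set p := _ + _ in nz.
  have : (size [seq (x%:R : algC) | x <- iota 0 (size p)] < size p)%N.
    apply: max_poly_roots => //; last first.
      by rewrite map_inj_uniq ?iota_uniq // => x y /eqP; rewrite eqr_nat => /eqP.
    apply/allP => _ /mapP[x _ ->]; set T := x%:R; rewrite rootE -(kerov_value_special T).
    rewrite hornerD hornerZ; apply/eqP; congr (_ * _ + _).
      rewrite -[LHS]/(horner_eval T _) kerov_value_map; congr kerov_value.
      rewrite rmorphD rmorphM rmorph1 rmorphXn /= series_mapC series_mapX.
      by rewrite /= /horner_eval hornerX.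
    rewrite horner_poly [in RHS]horner_coef series_sumE; apply: eq_bigr => b _.
    rewrite exprMn -exprM -(rmorphXn (@seriesC algC)) mulrCA seriesCM mulrC [_ * 't ^+ _]mulrC seriesXnM.
    by rewrite mulnC; case: ifP.
  by rewrite size_map size_iota ltnn.
have := congr1 (fun p : {poly algC} => p`_i) P0; rewrite coefD coefZ coef0 => <-.
congr (_ * _ + _); last first.
  rewrite coef_poly (ltnNge k.+1) ik /=; case: ltnP => // si.
  by rewrite nth_default.
rewrite /kv /kerov_value /mmap coef_sum.
have RE j : (1 + seriesC 'X * 't ^+ 2 : series {poly algC}) (j + 2)%N = if j == 0%N then 'X else 0.
  by rewrite seriesDE series1E addn2 add0r seriesCM seriesXnE !eqSS; case: (j == 0%N); rewrite ?mulr1 ?mulr0.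
have mE (a : 'X_{1..k}) :
    mmap1 (fun j : 'I_k => (1 + seriesC 'X * 't ^+ 2 : series {poly algC}) (j + 2)%N) a =
    if a == mnm_R2 k (a (Ordinal k_gt0)) then 'X^(a (Ordinal k_gt0)) else 0.
  rewrite /mmap1 (bigD1 (Ordinal k_gt0)) //= RE /=.
  case: eqP => [aE|aN].
    rewrite big1 ?mulr1 // => j j0; rewrite aE mnmE.
    by rewrite (_ : (j == 0%N :> nat) = false) ?expr0 //; apply: negbTE.
  have [j /andP[j0 aj]] : exists j : 'I_k, (j != Ordinal k_gt0) && (a j != 0%N).
    apply/existsP; apply: contra_notT aN => /existsPn H; apply/mnmP => j; rewrite mnmE.
    case: eqP => [j0|/eqP j0]; first by congr (a _); apply: val_inj.
    have := H j; rewrite negb_and negbK => /orP[/eqP jE|]; last by rewrite negbK => /eqP.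
    by rewrite jE eqxx in j0.
  rewrite (bigD1 j) //= RE (_ : (j == 0%N :> nat) = false) ?expr0n ?(negbTE aj) ?mul0r ?mulr0 //.
  exact: negbTE.
have term (a : 'X_{1..k}) : ((Sigma@_a)%:~R * mmap1 (fun j : 'I_k =>
      (1 + seriesC 'X * 't ^+ 2 : series {poly algC}) (j + 2)%N) a)`_i =
    if a == mnm_R2 k i then (Sigma@_a)%:~R else 0.
  rewrite mE -(rmorph_int (@polyC algC)) coefCM.
  have [->|ai] := eqVneq a (mnm_R2 k i).
    by rewrite !mnmE /= eqxx coefXn eqxx mulr1.
  case: eqP => [aE|_]; last by rewrite coef0 mulr0.
  rewrite coefXn; case: eqP => [E|_]; last by rewrite mulr0.
  by rewrite E -aE eqxx in ai.
under [RHS]eq_bigr => a _ do rewrite term.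
rewrite -big_mkcond; have [Ri|Ri] := boolP (mnm_R2 k i \in msupp Sigma).
  rewrite -big_filter (_ : filter _ _ = [:: mnm_R2 k i]) ?big_seq1 //.
  by rewrite filter_pred1_uniq ?msupp_uniq.
rewrite memN_msupp_eq0 // rmorph0 big_seq_cond big1 // => a /andP[aS /eqP aE].
by rewrite -aE aS in Ri.
Qed.

End SecondCumulant.

(** * Expansion of the product to fourth order in the translations *)

Section Bivariate.
Variable K : comUnitRingType.
Local Notation SS := (series (series K)).
Implicit Types f g h : SS.

(* Congruence modulo the N-th power of the outer variable and the fifth power of
   the inner one. *)
Definition agree2 N f g := forall a, (a < N)%N -> agree 5 (f a) (g a).

Lemma agree2_refl N f : agree2 N f f. Proof. by []. Qed.

Lemma agree2_trans N f g h : agree2 N f g -> agree2 N g h -> agree2 N f h.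
Proof. by move=> fg gh a aN; apply: agree_trans (gh a aN); apply: fg. Qed.

Lemma agree2D N f f' g g' : agree2 N f f' -> agree2 N g g' -> agree2 N (f + g) (f' + g').
Proof. by move=> ff gg a aN; apply: agreeD; [apply: ff | apply: gg]. Qed.

Lemma agree2M N f f' g g' : agree2 N f f' -> agree2 N g g' -> agree2 N (f * g) (f' * g').
Proof.
move=> ff gg a aN j j5; rewrite !seriesME !series_sumE; apply: eq_bigr => b _.
have ba : (b < N)%N by rewrite (leq_ltn_trans _ aN) // -ltnS.
apply: (agreeM _ _ j5); first exact: ff.
by apply: gg; rewrite (leq_ltn_trans _ aN) // leq_subr.
Qed.

Lemma agree2_prod N (I : Type) (r : seq I) (F G : I -> SS) :
    (forall i, agree2 N (F i) (G i)) ->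
  agree2 N (\prod_(i <- r) F i) (\prod_(i <- r) G i).
Proof. by move=> FG; elim/big_ind2: _ => // f f' g g'; apply: agree2M. Qed.

Lemma agree2_outer N f : agree2 N ('t ^+ N * f) 0.
Proof. by move=> a aN j _; rewrite seriesXnM aN. Qed.

Lemma agree2_inner N f : agree2 N (seriesC 't ^+ 5 * f) 0.
Proof.
move=> a aN; rewrite -(rmorphXn (@seriesC _)) seriesCM => j j5.
by rewrite seriesXnM j5.
Qed.

Lemma agree2_div N f g h : h \is a GRing.unit -> agree2 N ((f - g) * h) 0 -> agree2 N f g.
Proof.
move=> uh fg; have -> : f = g + (f - g) * h * h^-1 by rewrite mulrK // addrC subrK.
rewrite -[X in agree2 _ _ X]addr0; apply: agree2D => //.
by rewrite -(mul0r h^-1); apply: agree2M.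
Qed.

(* Series in the outer variable alone. *)
Definition outer : series K -> SS := series_map (@seriesC K).
HB.instance Definition _ := GRing.RMorphism.on outer.

Lemma outerX : outer 't = 't.
Proof. exact: series_mapX. Qed.

Lemma outer_coef (f g : series K) i n : (outer f * seriesC g) i n = f i * g n.
Proof. by rewrite mulrC seriesCM mulrC /outer /series_map seriesCM. Qed.

End Bivariate.

(** The expansion in eta of the square root of z^2 - 4 eta + 4 eta^2, increased
    by 1 - 2 eta, where d is the inverse of z. *)
Section Root.
Variables (A : comNzRingType) (z d : A).
Hypothesis zd : z * d = 1.

Definition root_beta (eta : A) : A :=
  1 - 2%:R * d ^+ 2 * eta + 2%:R * (d ^+ 2 - d ^+ 4) * eta ^+ 2
  + 4%:R * (d ^+ 4 - d ^+ 6) * eta ^+ 3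
  + (12%:R * d ^+ 6 - 2%:R * d ^+ 4 - 10%:R * d ^+ 8) * eta ^+ 4.

Definition root_series (eta : A) : A := 1 - 2%:R * eta + z * root_beta eta.

Let zd2 : z ^+ 2 * d ^+ 2 = 1. Proof. by rewrite -exprMn zd expr1n. Qed.
Let zdd : z * d ^+ 2 = d. Proof. by rewrite expr2 mulrA zd mul1r. Qed.

Lemma root_series_quadratic eta : exists q,
  root_series eta ^+ 2 - 2%:R * (1 - 2%:R * eta) * root_series eta + (1 - z ^+ 2) = eta ^+ 5 * q.
Proof.
pose b1 := - (2%:R * d ^+ 2); pose b2 := 2%:R * (d ^+ 2 - d ^+ 4).
pose b3 := 4%:R * (d ^+ 4 - d ^+ 6); pose b4 := 12%:R * d ^+ 6 - 2%:R * d ^+ 4 - 10%:R * d ^+ 8.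
pose q := 2%:R * b1 * b4 + 2%:R * b2 * b3 + (2%:R * b2 * b4 + b3 ^+ 2) * eta
          + 2%:R * b3 * b4 * eta ^+ 2 + b4 ^+ 2 * eta ^+ 3.
have bE : root_beta eta ^+ 2 = 1 - 4%:R * d ^+ 2 * (eta - eta ^+ 2) + eta ^+ 5 * q.
  by rewrite /root_beta /q /b1 /b2 /b3 /b4; ring.
exists (z ^+ 2 * q).
transitivity (z ^+ 2 * root_beta eta ^+ 2 - (1 - 2%:R * eta) ^+ 2 + (1 - z ^+ 2)).
  by rewrite /root_series; ring.
rewrite bE; transitivity (4%:R * (1 - z ^+ 2 * d ^+ 2) * (eta - eta ^+ 2) + eta ^+ 5 * (z ^+ 2 * q)).
  by ring.
by rewrite zd2 subrr mulr0 mul0r add0r.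
Qed.

Definition pair2 : A := - (4%:R * d ^+ 3).
Definition pair4 : A := 8%:R * d ^+ 6 + 12%:R * d ^+ 5 - 20%:R * d ^+ 7.

Lemma root_series_pair eta : exists q,
  root_series eta * root_series (- eta) =
    (1 + z) ^+ 2 * (1 + pair2 * eta ^+ 2 + pair4 * eta ^+ 4) + eta ^+ 5 * q.
Proof.
pose b1 := - (2%:R * d ^+ 2); pose b2 := 2%:R * (d ^+ 2 - d ^+ 4).
pose b3 := 4%:R * (d ^+ 4 - d ^+ 6); pose b4 := 12%:R * d ^+ 6 - 2%:R * d ^+ 4 - 10%:R * d ^+ 8.
exists (eta * z ^+ 2 * (2%:R * b2 * b4 - b3 ^+ 2) + eta ^+ 3 * z ^+ 2 * b4 ^+ 2).
have -> : (1 + z) ^+ 2 * (1 + pair2 * eta ^+ 2 + pair4 * eta ^+ 4) =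
   (1 + z) ^+ 2
   - (4%:R * d ^+ 3 + 8%:R * (z * d) * d ^+ 2 + 4%:R * (z ^+ 2 * d ^+ 2) * d) * eta ^+ 2
   + (8%:R * d ^+ 6 + 12%:R * d ^+ 5 - 20%:R * d ^+ 7
      + (z * d) * (16%:R * d ^+ 5 + 24%:R * d ^+ 4 - 40%:R * d ^+ 6)
      + (z ^+ 2 * d ^+ 2) * (8%:R * d ^+ 4 + 12%:R * d ^+ 3 - 20%:R * d ^+ 5)) * eta ^+ 4.
  by rewrite /pair2 /pair4; ring.
transitivity ((1 + z) ^+ 2
   + (- 4%:R - 4%:R * (z * d ^+ 2) - 4%:R * (z * d ^+ 2) * d ^+ 2
      + 4%:R * (z ^+ 2 * d ^+ 2) - 8%:R * (z ^+ 2 * d ^+ 2) * d ^+ 2) * eta ^+ 2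
   + ((z * d ^+ 2) * (12%:R * d ^+ 2 + 8%:R * d ^+ 4 - 20%:R * d ^+ 6)
      + (z ^+ 2 * d ^+ 2) * (32%:R * d ^+ 4 - 32%:R * d ^+ 6)) * eta ^+ 4
   + eta ^+ 5 * (eta * z ^+ 2 * (2%:R * b2 * b4 - b3 ^+ 2) + eta ^+ 3 * z ^+ 2 * b4 ^+ 2)).
  by rewrite /root_series /root_beta /b1 /b2 /b3 /b4; ring.
by rewrite zdd zd2 zd; ring.
Qed.

End Root.

Lemma root_series0 (A : comNzRingType) (z d : A) : root_series z d 0 = 1 + z.
Proof. by rewrite /root_series /root_beta; ring. Qed.

Lemma root_series_map (A B : comNzRingType) (phi : {rmorphism A -> B}) z d eta :
  phi (root_series z d eta) = root_series (phi z) (phi d) (phi eta).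
Proof.
by rewrite /root_series /root_beta !(rmorph1, rmorph_nat, rmorphXn, rmorphN, rmorphD, rmorphM).
Qed.

Lemma pair2_map (A B : comNzRingType) (phi : {rmorphism A -> B}) d :
  phi (pair2 d) = pair2 (phi d).
Proof. by rewrite /pair2 rmorphN rmorphM rmorphXn rmorph_nat. Qed.

Lemma pair4_map (A B : comNzRingType) (phi : {rmorphism A -> B}) d :
  phi (pair4 d) = pair4 (phi d).
Proof. by rewrite /pair4 !(rmorph_nat, rmorphXn, rmorphN, rmorphD, rmorphM). Qed.

(* Power sums over 1, ..., n, and the second elementary symmetric function of
   the squares. *)
Definition sum2 n : nat := \sum_(j < n) j.+1 ^ 2.
Definition sum4 n : nat := \sum_(j < n) j.+1 ^ 4.
Definition esym2 n : nat := \sum_(j < n) sum2 j * j.+1 ^ 2.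

(** The symmetric window pairs opposite translations. *)
Lemma prod_symmetric (A : comNzRingType) (B : comNzRingType) (f : B -> A) J :
  \prod_(r < J.*2.+1) f (r%:R - J%:R) =
    f 0 * \prod_(j < J) (f (j.+1)%:R * f (- (j.+1)%:R)).
Proof.
elim: J => [|J IH]; first by rewrite big_ord1 big_ord0 mulr1 subr0.
rewrite doubleS big_ord_recl big_ord_recr /= [in RHS]big_ord_recr /= [RHS]mulrA -IH sub0r.
have -> : \prod_(i < J.*2.+1) f ((bump 0 i)%:R - J.+1%:R) = \prod_(r < J.*2.+1) f (r%:R - J%:R).
  by apply: eq_bigr => i _; rewrite /bump leq0n add1n -!natr1; congr f; ring.
have -> : (bump 0 J.*2.+1)%:R - J.+1%:R = J.+1%:R :> B.
  by rewrite /bump leq0n add1n -addnn -addSn -addnS natrD addrK.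
by rewrite mulrC -mulrA [X in _ * X]mulrC.
Qed.

Lemma prod_pairs (A : comNzRingType) (a b x : A) n : exists q,
  \prod_(j < n) (1 + a * (j.+1%:R * x) ^+ 2 + b * (j.+1%:R * x) ^+ 4) =
    1 + a * (sum2 n)%:R * x ^+ 2 + (b * (sum4 n)%:R + a ^+ 2 * (esym2 n)%:R) * x ^+ 4 + x ^+ 5 * q.
Proof.
elim: n => [|n [q IH]].
  by exists 0; rewrite big_ord0 /sum2 /sum4 /esym2 !big_ord0; ring.
rewrite big_ord_recr /= IH /sum2 /sum4 /esym2 !big_ord_recr /= -/(sum2 n) -/(sum4 n) -/(esym2 n).
rewrite !natrD natrM !natrX; move: (n.+1)%:R (sum2 n)%:R (sum4 n)%:R (esym2 n)%:R => j s2 s4 e2.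
exists (q * (1 + a * (j * x) ^+ 2 + b * (j * x) ^+ 4)
  + x * (a * s2 * b * j ^+ 4 + (b * s4 + a ^+ 2 * e2) * a * j ^+ 2)
  + x ^+ 3 * (b * s4 + a ^+ 2 * e2) * b * j ^+ 4).
by ring.
Qed.

Section Expansion.

Let SS := series (series algC).
Let s : SS := 't / (1 + 't) ^+ 2.
Let z0 : series algC := (1 - 't) / (1 + 't).
Let d0 : series algC := (1 + 't) / (1 - 't).
Let z : SS := outer z0.
Let d : SS := outer d0.
Let eta (a : algC) : SS := seriesC (seriesC (a / 2%:R) * 't).

Let zd : z * d = 1.
Proof.
rewrite /z /d -rmorphM -[RHS](rmorph1 (@outer _)); congr outer.
by rewrite /z0 /d0 mulrA divrK ?unit_1Dt // divrr ?unit_1Bt.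
Qed.

Let zE : z = (1 - 't) / (1 + 't).
Proof.
by rewrite /z /z0 rmorphM rmorphV ?unit_1Dt // rmorphB rmorphD rmorph1 /= outerX.
Qed.

Let four_s : 4%:R * s = 1 - z ^+ 2.
Proof.
have zv : z * (1 + 't) = 1 - 't by rewrite zE divrK // unit_1Dt.
have u : (1 + 't : SS) ^+ 2 \is a GRing.unit by rewrite unitrX // unit_1Dt.
apply: (mulIr u); rewrite -mulrA [s * _]divrK //.
transitivity ((1 + 't) ^+ 2 - (z * (1 + 't)) ^+ 2); last by ring.
by rewrite zv; ring.
Qed.

Let eta_scale a : eta a = seriesC (seriesC a) * eta 1.
Proof. by rewrite /eta -rmorphM mulrA -rmorphM mulrA mulr1. Qed.

Let eta5 N a f : agree2 N (eta a ^+ 5 * f) 0.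
Proof.
by rewrite /eta rmorphM exprMn -mulrA mulrCA; apply: agree2_inner.
Qed.

(** Each factor of the product, doubled, is a square root plus 1 - 2 eta. *)
Lemma theta_expansion N a :
  agree2 N.+1 (2%:R * (map_poly (@seriesC (series algC)) (theta N a)).[s])
    (root_series z d (eta a)).
Proof.
set x := _.[s]; set e := (1 - seriesC a * 't : series algC).
have [q qE] := theta_quadratic N (@seriesC (series algC)) a s.
have [q1 q1E] := theta_const N (@seriesC (series algC)) a s.
rewrite -/x -/e in qE q1E.
have eE : seriesC e = 1 - 2%:R * eta a.
  have aE : a = 2%:R * (a / 2%:R) by rewrite mulrC divfK ?pnatr_eq0.
  rewrite /e /eta rmorphB rmorph1 {1}aE [in LHS](rmorphM (@seriesC algC)) rmorph_nat.
  by rewrite -mulrA [in LHS]rmorphM rmorph_nat.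
have [q2 q2E] := root_series_quadratic zd (eta a); set y := root_series z d _ in q2E *.
apply: (@agree2_div _ _ _ _ (2%:R * x + y - 2%:R * seriesC e)).
  pose ee : {rmorphism SS -> algC} := @ev0 algC \o @ev0 (series algC).
  have eeX : ee 't = 0 by rewrite /= [ev0 't]seriesXE rmorph0.
  have ee_s : ee s = 0 by rewrite rmorphM eeX mul0r.
  have ee_z : ee z = 1.
    rewrite zE rmorphM rmorphV ?unit_1Dt // rmorphB rmorphD rmorph1 eeX.
    by rewrite subr0 addr0 invr1 mulr1.
  have ee_eta : ee (eta a) = 0.
    by rewrite /= /eta /ev0 seriesCE eqxx mulr1n seriesCM seriesXE mulr0.
  have ee_e : ee (seriesC e) = 1 by rewrite eE rmorphB rmorphM ee_eta rmorph1 mulr0 subr0.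
  have ee_x : ee x = 1 by rewrite q1E rmorphD rmorphM ee_s mul0r addr0.
  rewrite series_unitE series_unitE.
  suff : ee (2%:R * x + y - 2%:R * seriesC e) \is a GRing.unit by [].
  rewrite rmorphB rmorphD !(rmorphM ee) ee_x ee_e /y root_series_map ee_eta root_series0 ee_z.
  by rewrite rmorph_nat unitfE mulr1 addrAC subrr add0r -mulr2n pnatr_eq0.
have -> : (2%:R * x - y) * (2%:R * x + y - 2%:R * seriesC e) =
    4%:R * s ^+ N.+1 * q + (- 1) * (eta a ^+ 5 * q2).
  have xE : x ^+ 2 - seriesC e * x + s = s ^+ N.+1 * q := qE.
  by rewrite -mulrA -xE -q2E -four_s eE; ring.
rewrite -[X in agree2 _ _ X]addr0; apply: agree2D.
  have -> : 4%:R * s ^+ N.+1 * q = 't ^+ N.+1 * (4%:R * ((1 + 't) ^+ 2)^-1 ^+ N.+1 * q).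
    by rewrite /s exprMn mulrCA -!mulrA.
  exact: agree2_outer.
by rewrite -[X in agree2 _ _ X](mulr0 (-1)); apply: agree2M.
Qed.

(** By symmetry only the even orders survive, through power sums of squares. *)
Lemma root_series_prod N J : agree2 N
  (\prod_(r < J.*2.+1) root_series z d (eta (r%:R - J%:R)))
  ((1 + z) ^+ J.*2.+1 * (1 + pair2 d * (sum2 J)%:R * eta 1 ^+ 2 +
     (pair4 d * (sum4 J)%:R + pair2 d ^+ 2 * (esym2 J)%:R) * eta 1 ^+ 4)).
Proof.
rewrite (prod_symmetric (fun a => root_series z d (eta a))).
have -> : root_series z d (eta 0) = 1 + z.
  by rewrite eta_scale rmorph0 rmorph0 mul0r root_series0.
rewrite exprS -mulrA; apply: agree2M => //.
have pairE j : agree2 N (root_series z d (eta j.+1%:R) * root_series z d (eta (- j.+1%:R)))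
   ((1 + z) ^+ 2 * (1 + pair2 d * (j.+1%:R * eta 1) ^+ 2 + pair4 d * (j.+1%:R * eta 1) ^+ 4)).
  have -> : eta (- j.+1%:R) = - eta (j.+1%:R) by rewrite eta_scale rmorphN rmorphN mulNr -eta_scale.
  have [q ->] := root_series_pair zd (eta j.+1%:R).
  have -> : eta j.+1%:R = j.+1%:R * eta 1 by rewrite eta_scale !rmorph_nat.
  rewrite -[X in agree2 _ _ X]addr0; apply: agree2D => //.
  by rewrite exprMn mulrAC mulrC; apply: eta5.
apply: (agree2_trans (agree2_prod _ (fun j : 'I_J => pairE j))).
rewrite big_split prodr_const card_ord -exprM mul2n /=; apply: agree2M => //.
have [q ->] := prod_pairs (pair2 d) (pair4 d) (eta 1) J.
by rewrite -[X in agree2 _ _ X]addr0; apply: agree2D.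
Qed.

Let eta1_sq n i (f : series algC) : (outer f * eta 1 ^+ n) i 4%N =
  if n == 4%N then f i / 16%:R else 0.
Proof.
rewrite /eta -rmorphXn exprMn -rmorphXn outer_coef seriesCM seriesXnE eq_sym div1r.
case: eqP => [->|_]; last by rewrite !mulr0.
by rewrite mulr1 exprVn -natrX.
Qed.

(** The coefficient of the fourth power of the inner variable only sees the term
    in eta^4, where eta is half that variable; whence the factor 1 / 16. *)
Lemma theta_prod_coef J i : (0 < i)%N -> (J = i.+1) ->
  (theta_prod J J.*2.+1)`_i 4%N =
    (((1 - 't) * (1 + 't)^-1 ^+ 4 *
      (pair4 d0 * (sum4 J)%:R + pair2 d0 ^+ 2 * (esym2 J)%:R)) i) / 16%:R.
Proof.
move=> i_gt0 Ji; set k := J.*2.+1.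
rewrite lagrange_coef // -/s.
pose N := k.+1.
have two0 : 2%:R ^+ k != 0 :> algC by rewrite expf_neq0 // pnatr_eq0.
apply: (mulfI two0).
pose G0 : series algC := (1 - 't) * (1 + 't) ^+ (2 * i - 1).
have G0E : outer G0 = (1 - 't) * (1 + 't) ^+ (2 * i - 1).
  by rewrite rmorphM rmorphXn rmorphB rmorphD rmorph1 /= outerX.
have oneDz : 1 + z = outer (2%:R / (1 + 't)).
  rewrite /z -(rmorph1 (@outer _)) -rmorphD; congr outer; rewrite /z0.
  rewrite -{1}(divrr (unit_1Dt algC)) -mulrDl; congr (_ / _); ring.
have pd2 : pair2 d = outer (pair2 d0) by rewrite pair2_map.
have pd4 : pair4 d = outer (pair4 d0) by rewrite pair4_map.
have pull (f : SS) : 2%:R ^+ k * f i 4%N = (2%:R ^+ k * f) i 4%N.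
  have -> : (2%:R : SS) ^+ k = seriesC (seriesC (2%:R ^+ k)) by rewrite !rmorphXn !rmorph_nat.
  by rewrite !seriesCM.
rewrite pull -G0E rmorph_prod horner_prod mulrCA.
have -> : 2%:R ^+ k * \prod_(r < J.*2.+1) (map_poly (@seriesC (series algC)) (theta N (r%:R - J%:R))).[s] =
    \prod_(r < J.*2.+1) (2%:R * (map_poly (@seriesC (series algC)) (theta N (r%:R - J%:R))).[s]).
  by rewrite big_split prodr_const card_ord.
have iN : (i < N.+1)%N by rewrite /N /k Ji; lia.
have ex := agree2_prod (index_enum 'I_J.*2.+1) (fun r : 'I_J.*2.+1 => @theta_expansion N (r%:R - J%:R)).
rewrite (agree2M (@agree2_refl _ N.+1 (outer G0)) (agree2_trans ex (@root_series_prod N.+1 J)) iN) //.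
rewrite oneDz pd2 pd4 -/k.
pose a := pair2 d0 * (sum2 J)%:R.
pose b := pair4 d0 * (sum4 J)%:R + pair2 d0 ^+ 2 * (esym2 J)%:R.
pose G1 : series algC := G0 * (2%:R / (1 + 't)) ^+ k.
have -> : outer G0 * (outer (2%:R / (1 + 't)) ^+ k *
     (1 + outer (pair2 d0) * (sum2 J)%:R * eta 1 ^+ 2 +
      (outer (pair4 d0) * (sum4 J)%:R + outer (pair2 d0) ^+ 2 * (esym2 J)%:R) * eta 1 ^+ 4)) =
   outer G1 * eta 1 ^+ 0 + outer (G1 * a) * eta 1 ^+ 2 + outer (G1 * b) * eta 1 ^+ 4.
  have -> : outer (G1 * a) = outer G1 * (outer (pair2 d0) * (sum2 J)%:R).
    by rewrite rmorphM; congr (_ * _); rewrite rmorphM rmorph_nat.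
  have -> : outer (G1 * b) =
      outer G1 * (outer (pair4 d0) * (sum4 J)%:R + outer (pair2 d0) ^+ 2 * (esym2 J)%:R).
    rewrite rmorphM; congr (_ * _); rewrite rmorphD; congr (_ + _).
      by rewrite rmorphM rmorph_nat.
    by rewrite rmorphM [X in _ * X]rmorph_nat rmorphXn.
  have -> : outer G1 = outer G0 * outer (2%:R / (1 + 't)) ^+ k.
    by rewrite /G1 rmorphM rmorphXn.
  by move: (outer G0) (_ ^+ k) => g1 g2; ring.
rewrite 2!seriesDE 2!seriesDE !eta1_sq /= !add0r mulrA; congr (_ / _).
rewrite -/b -seriesCM mulrA; congr ((_ * b) i).
rewrite /G1 /G0 exprMn (rmorphXn (@seriesC algC)) rmorph_nat.
have -> : (1 + 't : series algC)^-1 ^+ k = (1 + 't)^-1 ^+ (2 * i - 1) * (1 + 't)^-1 ^+ 4.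
  by rewrite -exprD; congr (_ ^+ _); rewrite /k Ji; lia.
have V : (1 + 't : series algC) ^+ (2 * i - 1) * (1 + 't)^-1 ^+ (2 * i - 1) = 1.
  by rewrite -exprMn divrr ?unit_1Dt // expr1n.
move: V; set u := _ ^+ _; set u' := _ ^+ (2 * i - 1); set w := _ ^+ 4; set t2 := _ ^+ k => V.
transitivity (t2 * ((1 - 't) * ((u * u') * w))); first by ring.
by rewrite V mul1r.
Qed.

End Expansion.

(** * The coefficient in closed form *)

(** R_2^i has the weight 2 i = k - 3 selected by the grading. *)
Lemma kerov_graded_R2 i (Sigma : {mpoly int[2 * i + 3]}) :
  (kerov_graded Sigma 4)@_(mnm_R2 (2 * i + 3) i) = Sigma@_(mnm_R2 (2 * i + 3) i).
Proof.
set k := (2 * i + 3)%N; set M := mnm_R2 k i.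
rewrite /kerov_graded ifT; last by rewrite /k; lia.
have -> : (k.+1 - 4 = 2 * i)%N by rewrite /k; lia.
pose wt (a : 'X_{1..k}) := (\sum_(j < k) (j + 2) * a j)%N.
have k0 : (0 < k)%N by rewrite /k addnC.
have wtM : wt M = (2 * i)%N.
  rewrite /wt (bigD1 (Ordinal k0)) //= mnmE /= add0n big1 ?addn0 // => j j0.
  by rewrite mnmE (_ : (j == 0%N :> nat) = false) ?muln0 //; apply: negbTE.
rewrite /kerov_weighted /mmap coef_sum raddf_sum /=.
transitivity (\sum_(a <- msupp Sigma) (if a == M then Sigma@_a else 0)).
  apply: eq_bigr => a _.
  have -> : mmap1 (fun j : 'I_k => ('X_j : {mpoly int[k]})%:P * 'X^(j + 2)) a =
      ('X_[a] : {mpoly int[k]})%:P * 'X^(wt a).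
    rewrite /mmap1; under eq_bigr => j _ do rewrite exprMn -exprM.
    rewrite big_split prodrXr mpolyXE_id rmorph_prod; congr (_ * _).
    by apply: eq_bigr => j _; rewrite rmorphXn.
  rewrite coefCM coefCM coefXn mcoeffCM.
  have [->|aM] := eqVneq a M.
    by rewrite wtM eqxx mulr1 mcoeffX eqxx mulr1.
  by case: eqP => _; rewrite ?mulr1 ?mulr0 ?mcoeff0 ?mcoeffX ?(negbTE aM) ?mulr0.
rewrite -big_mkcond; have [Ri|Ri] := boolP (M \in msupp Sigma).
  rewrite -big_filter (_ : filter _ _ = [:: M]) ?big_seq1 //.
  by rewrite filter_pred1_uniq ?msupp_uniq.
rewrite memN_msupp_eq0 // big_seq_cond big1 // => a /andP[aS /eqP aM].
by rewrite -aM aS in Ri.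
Qed.

Section PowerSums.
Implicit Types n : nat.

Lemma sum2E n : 6%:R * (sum2 n)%:R = n%:R * (n%:R + 1) * (2%:R * n%:R + 1) :> algC.
Proof.
elim: n => [|n IH]; first by rewrite /sum2 big_ord0 mulr0 !mul0r.
rewrite /sum2 big_ord_recr /= -/(sum2 n) natrD mulrDr IH natrX -natr1; ring.
Qed.

Lemma sum4E n : 30%:R * (sum4 n)%:R =
  n%:R * (n%:R + 1) * (2%:R * n%:R + 1) * (3%:R * n%:R ^+ 2 + 3%:R * n%:R - 1) :> algC.
Proof.
elim: n => [|n IH]; first by rewrite /sum4 big_ord0 mulr0 !mul0r.
rewrite /sum4 big_ord_recr /= -/(sum4 n) natrD mulrDr IH natrX -natr1; ring.
Qed.

Lemma esym2E n : 2%:R * (esym2 n)%:R = (sum2 n)%:R ^+ 2 - (sum4 n)%:R :> algC.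
Proof.
elim: n => [|n IH]; first by rewrite /esym2 /sum2 /sum4 !big_ord0 mulr0 expr0n subrr.
rewrite /esym2 /sum2 /sum4 !big_ord_recr /= -/(sum2 n) -/(sum4 n) -/(esym2 n).
rewrite !natrD natrM !natrX mulrDr IH; ring.
Qed.

End PowerSums.

(** In terms of v = 1 + p and h = 1 / (1 - p), the fourth-order term is a
    combination of v^2 h^5, v h^4 and v^3 h^6, whose coefficients are
    polynomials in i. *)
Lemma R2_coefficient i (Sigma : {mpoly int[2 * i + 3]}) : (0 < i)%N ->
    is_kerov_polynomial Sigma -> let x : algC := i%:R in
  (Sigma@_(mnm_R2 (2 * i + 3) i))%:~R =
    1 / 540%:R * x * (x + 1) ^+ 3 * (x + 2%:R) ^+ 3 * (x + 3%:R) * (2%:R * x + 3%:R).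
Proof.
move=> i_gt0 kerov x.
have kE : (2 * i + 3 = i.+1.*2.+1)%N by rewrite -mul2n; lia.
have i2 : (2 * i <= (2 * i + 3).+1)%N by lia.
have := kerov_coefficient kE kerov i2.
have -> : ((2 * i + 3).+1 - 2 * i = 4)%N by lia.
have -> : theta_prod i.+1 (2 * i + 3) = theta_prod i.+1 i.+1.*2.+1 by rewrite -kE.
rewrite (theta_prod_coef i_gt0 erefl).
set y := _%:~R; set v := 1 + 't; set h := (1 - 't)^-1.
have vV : v * v^-1 = 1 by rewrite divrr ?unit_1Dt.
have hV : (1 - 't) * h = 1 by rewrite divrr ?unit_1Bt.
pose F b c : algC := (\prod_(l < b) (x - c%:R + l.+1%:R)) / b`!%:R.
have FE b c : (c <= b)%N -> ('t ^+ c * h ^+ b.+1) i = F b c.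
  move=> cb; rewrite /F -(coef_geo_shift _ i cb) mulfK //.
  by rewrite pnatr_eq0 -lt0n fact_gt0.
pose S4 : algC := (sum4 i.+1)%:R; pose E2 : algC := (esym2 i.+1)%:R.
have -> : (1 - 't) * v^-1 ^+ 4 * (pair4 (v / (1 - 't)) * (sum4 i.+1)%:R +
      pair2 (v / (1 - 't)) ^+ 2 * (esym2 i.+1)%:R) =
    seriesC (8%:R * S4 + 16%:R * E2) * ('t ^+ 0 * h ^+ 5)
  + seriesC (2%:R * (8%:R * S4 + 16%:R * E2)) * ('t ^+ 1 * h ^+ 5)
  + seriesC (8%:R * S4 + 16%:R * E2) * ('t ^+ 2 * h ^+ 5)
  + seriesC (12%:R * S4) * ('t ^+ 0 * h ^+ 4) + seriesC (12%:R * S4) * ('t ^+ 1 * h ^+ 4)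
  - seriesC (20%:R * S4) * ('t ^+ 0 * h ^+ 6) - seriesC (60%:R * S4) * ('t ^+ 1 * h ^+ 6)
  - seriesC (60%:R * S4) * ('t ^+ 2 * h ^+ 6) - seriesC (20%:R * S4) * ('t ^+ 3 * h ^+ 6).
  have cM n (u : algC) : seriesC (n%:R * u) = n%:R * seriesC u by rewrite rmorphM rmorph_nat.
  rewrite !cM (rmorphD (@seriesC algC)) /= !cM -(rmorph_nat (@seriesC algC) (sum4 _)).
  rewrite -(rmorph_nat (@seriesC algC) (esym2 _)) -/S4 -/E2 -/h /pair4 /pair2.
  set u4 := seriesC S4; set u2 := seriesC E2.
  transitivity (((1 - 't) * h) * (v * v^-1) ^+ 4 *
     ((8%:R * v ^+ 2 * h ^+ 5 + 12%:R * v * h ^+ 4 - 20%:R * v ^+ 3 * h ^+ 6) * u4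
      + 16%:R * v ^+ 2 * h ^+ 5 * u2)).
    by set w := v^-1; ring.
  by rewrite vV hV expr1n !mul1r /v; ring.
rewrite !seriesDE !seriesNE !seriesCM !FE // /F !(big_ord_recr, big_ord0) /=.
have f3 : 3`!%:R = 6%:R :> algC by [].
have f4 : 4`!%:R = 24%:R :> algC by [].
have f5 : 5`!%:R = 120%:R :> algC by [].
rewrite f3 f4 f5 {f3 f4 f5 FE F}.
have xn : (i.+1)%:R = x + 1 by rewrite natr1.
have E2E : E2 = ((sum2 i.+1)%:R ^+ 2 - S4) / 2%:R.
  by rewrite -esym2E mulrAC divff ?mul1r ?pnatr_eq0.
have S2E : (sum2 i.+1)%:R = (x + 1) * (x + 2%:R) * (2%:R * x + 3%:R) / 6%:R :> algC.
  apply: (mulfI (_ : 6%:R != 0 :> algC)); rewrite ?pnatr_eq0 // sum2E xn.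
  by field.
have S4E : S4 = (x + 1) * (x + 2%:R) * (2%:R * x + 3%:R) *
    (3%:R * x ^+ 2 + 9%:R * x + 5%:R) / 30%:R.
  apply: (mulfI (_ : 30%:R != 0 :> algC)); rewrite ?pnatr_eq0 // sum4E xn.
  by field.
have kx : (2 * i + 3)%:R = 2%:R * x + 3%:R :> algC by rewrite natrD natrM.
have k0 : 2%:R * x + 3%:R != 0 by rewrite -kx pnatr_eq0 addnC.
rewrite kx E2E S4E S2E => /eqP; rewrite addr_eq0 => /eqP kyE.
apply: (mulfI k0); rewrite kyE; clear.
by field.
Qed.

Lemma R2_coefficient_map (F G : fieldType) (phi : {rmorphism F -> G}) i :
  phi (1 / 540%:R * i%:R * (i%:R + 1) ^+ 3 * (i%:R + 2%:R) ^+ 3 * (i%:R + 3%:R)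
      * (2%:R * i%:R + 3%:R)) =
    1 / 540%:R * i%:R * (i%:R + 1) ^+ 3 * (i%:R + 2%:R) ^+ 3 * (i%:R + 3%:R)
      * (2%:R * i%:R + 3%:R).
Proof.
have nat n : phi n%:R = n%:R by exact: rmorph_nat.
by rewrite !(nat, rmorph1 phi, fmorphV phi, rmorphXn phi, rmorphM phi, rmorphD phi).
Qed.

Theorem mainTheorem5 (i : nat) (hi : (1 <= i)%N)
    (Sigma : {mpoly int[2 * i + 3]}) (hSigma : is_kerov_polynomial Sigma) :
  ((kerov_graded Sigma 4)@_(mnm_R2 (2 * i + 3) i))%:~R =
    1 / 540%:R * i%:R * (i%:R + 1) ^+ 3 * (i%:R + 2%:R) ^+ 3 * (i%:R + 3%:R)
      * (2%:R * i%:R + 3%:R) :> rat.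
Proof.
apply: (fmorph_inj (@ratr algC)); rewrite kerov_graded_R2 rmorph_int (R2_coefficient hi hSigma).
by rewrite R2_coefficient_map.
Qed.
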